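(* Let $\mathbb{K}$ be a field of characteristic zero, and let $(F,F_{0},F_{2}):1Cob\rightarrow Vect_{\mathbb{K}}$ be a strong $1$-dimensional topological quantum field theory which maps the null-dimensional manifold consisting of one point (that is, $+$ and $-$) to a vector space of dimension at least $2$. Then $F$ is faithful; i.e. for all objects $a,b$ of $1Cob$ and all morphisms $K,L:a\to b$ of $1Cob$, $F(K)=F(L)$ implies $K=L$.
   Context: **The category $1Cob$.** Objects are closed oriented $0$-manifolds presented as pairs $(n,\varepsilon)$, where $n=\{0,\ldots,n-1\}$ is a natural number and $\varepsilon:n\to\{-1,1\}$; equivalently, finite (possibly empty) words $a_1\ldots a_n$ in the letters $+,-$. The empty word is denoted $\emptyset$. A $1$-cobordism from $(n,\varepsilon_0)$ to $(m,\varepsilon_1)$ is a triple $(M,f_0:(n,\varepsilon_0)\to M,f_1:(m,\varepsilon_1)\to M)$, where $M$ is a compact oriented $1$-dimensional manifold whose boundary is a disjoint union $\partial M=\Sigma_0\sqcup\Sigma_1$, $f_0$ is an orientation preserving embedding with image $\Sigma_0$ (ingoing boundary), and $f_1$ is an orientation reversing embedding with image $\Sigma_1$ (outgoing boundary). The boundary convention is that the initial point of an oriented interval has sign $+$ and its terminal point has sign $-$ as points of $\partial M$; thus $[0,1]$ with its standard orientation gives cobordisms $+\to+$ (with $0$ ingoing), $-\to-$ (with $1$ ingoing), $+-\to\emptyset$ and $\emptyset\to-+$. Cobordisms $(M,f_0,f_1)$ and $(M',f_0',f_1')$ are equivalent if there is an orientation preserving homeomorphism $\Phi:M\to M'$ with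 $\Phi f_0=f_0'$ and $\Phi f_1=f_1'$. Morphisms of $1Cob$ are equivalence classes of $1$-cobordisms; composition is gluing along the common boundary; identities are cylinders. $1Cob$ is strict monoidal: the tensor product is concatenation of words on objects and ''putting side by side'' (disjoint union) on morphisms (denoted $\otimes$), with unit $\emptyset$. It is symmetric via the cobordisms $\tau_{a,b}:ab\to ba$ ($a$ of length $n$, $b$ of length $m$) consisting of intervals joining the ingoing point $i$ to the outgoing point $m+i$ ($0\le i<n$) and the ingoing point $n+j$ to the outgoing point $j$ ($0\le j<m$). **$Vect_{\mathbb{K}}$** is the category of finite dimensional vector spaces over $\mathbb{K}$ and linear maps, with the usual tensor product, unit $\mathbb{K}$, associativity isomorphisms $\alpha_{V,W,U}:V\otimes(W\otimes U)\to(V\otimes W)\otimes U$, $v\otimes(w\otimes u)\mapsto(v\otimes w)\otimes u$, unit isomorphisms $\lambda_V(c\otimes v)=cv$, $\rho_V(v\otimes c)=cv$, and symmetry $\sigma_{V,W}(v\otimes w)=w\otimes v$. **Strong $1$-dimensional topological quantum field theory (strong $1$-TQFT):** a strong symmetric monoidal functor $(F,F_0,F_2)$ from $(1Cob,\otimes,\emptyset,\tau)$ to $(Vect_{\mathbb{K}},\otimes,\mathbb{K},\alpha,\lambda,\rho,\sigma)$. That is, $F:1Cob\to Vect_{\mathbb{K}}$ is a functor equipped with an isomorphism $F_0:\mathbb{K}\to F(\emptyset)$ and a natural family of isomorphisms $F_2(a,b):F(a)\otimes F(b)\to F(ab)$ satisfying the usual coherence conditions with $\alpha,\lambda,\rho$,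 and $F(\tau_{a,b})\circ F_2(a,b)=F_2(b,a)\circ\sigma_{F(a),F(b)}$. *)

(* Defs.v *)
From HB Require Import structures.
From mathcomp Require Import all_boot all_order all_algebra.
From mathcomp Require Import all_classical all_reals all_analysis.

Set Implicit Arguments.
Unset Strict Implicit.
Unset Printing Implicit Defensive.

Import Order.TTheory GRing.Theory Num.Theory.
Import numFieldNormedType.Exports.

Local Open Scope classical_set_scope.
Local Open Scope ring_scope.

(** * Compact oriented 1-dimensional manifolds *)

(** The local model is the unit interval: the relatively open subsets of
    [0, 1] are models for interior points, for initial boundary points (at 0)
    and for terminal boundary points (at 1).  Having both kinds of ends in the
    model lets every orientation be described by charts whose transition maps
    are increasing; with the half-line [0, +oo[ alone this would fail at
    terminal points. *)
Record chart (R : realType) (M : topologicalType) := Chart {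
  chart_dom : set M;
  chart_map : M -> R
}.

Definition unit_open (R : realType) (V : set R) : Prop :=
  exists2 O : set R, open O & V = O `&` `[0, 1].

(** [chart_map] restricts to a homeomorphism from the open set [chart_dom] onto a
    relatively open subset of [0, 1]; its values outside [chart_dom] are junk. *)
Definition is_chart (R : realType) (M : topologicalType) (c : chart R M) :=
  [/\ open (chart_dom c),
      {in chart_dom c &, injective (chart_map c)},
      (forall x, chart_dom c x -> {for x, continuous (chart_map c)}) &
      (forall V : set M, open V -> V `<=` chart_dom c -> unit_open (chart_map c @` V))].

(** The map [f], read in the charts [c] and [d], is increasing near [x]. *)
Definition increasing_near (R : realType) (M N : topologicalType)
    (c : chart R M) (d : chart R N) (f : M -> N) (x : M) : Prop :=
  exists2 W : set M, nbhs x W &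
    forall y z, W y -> W z -> chart_map c y < chart_map c z ->
      chart_map d (f y) < chart_map d (f z).

Definition atlas_preserving (R : realType) (M N : topologicalType)
    (A : set (chart R M)) (B : set (chart R N)) (f : M -> N) : Prop :=
  forall c d x, A c -> B d -> chart_dom c x -> chart_dom d (f x) ->
    increasing_near c d f x.

(** Second countability is automatic for compact locally Euclidean spaces. *)
Record omanifold (R : realType) := OManifold {
  space :> topologicalType;
  atlas : set (chart R space);
  space_compact : compact [set: space];
  space_hausdorff : hausdorff_space space;
  atlas_chart : forall c, atlas c -> is_chart c;
  atlas_cover : forall x, exists2 c, atlas c & chart_dom c x;
  atlas_oriented : atlas_preserving atlas atlas id
}.

Definition orientation_preserving (R : realType) (M N : omanifold R)
  (f : M -> N) : Prop := atlas_preserving (@atlas R M) (@atlas R N) f.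

(** Boundary points of sign + and of sign -, respectively. *)
Definition initial_point (R : realType) (M : omanifold R) (x : M) : Prop :=
  exists c, [/\ atlas c, chart_dom c x & chart_map c x = 0].

Definition terminal_point (R : realType) (M : omanifold R) (x : M) : Prop :=
  exists c, [/\ atlas c, chart_dom c x & chart_map c x = 1].

Definition boundary_sign (R : realType) (M : omanifold R) (s : bool) (x : M) :=
  if s then initial_point x else terminal_point x.

(** * The category 1Cob *)

(** Words in + and -; [true] stands for +, [false] for -. *)
Definition word := seq bool.

Definition letter (a : word) (i : 'I_(size a)) : bool := tnth (in_tuple a) i.

(** An embedding of a 0-manifold is an injection; [inp] preserves and [out]
    reverses orientation, and their images partition the boundary. *)
Record cob (R : realType) (a b : word) := Cob {
  mfd :> omanifold R;
  inp : 'I_(size a) -> mfd;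
  out : 'I_(size b) -> mfd;
  inp_inj : injective inp;
  out_inj : injective out;
  inp_out_disjoint : forall i j, inp i <> out j;
  inp_sign : forall i, boundary_sign (letter i) (inp i);
  out_sign : forall j, boundary_sign (~~ letter j) (out j);
  boundary_cover : forall x : mfd, initial_point x \/ terminal_point x ->
    (exists i, x = inp i) \/ (exists j, x = out j)
}.

(** Morphisms of 1Cob are the classes of [cob] for this relation. *)
Definition cob_equiv (R : realType) (a b : word) (K L : cob R a b) : Prop :=
  exists (f : K -> L) (g : L -> K),
    [/\ cancel f g /\ cancel g f, continuous f /\ continuous g,
        orientation_preserving f,
        (forall i, f (inp K i) = inp L i) &
        (forall j, f (out K j) = out L j)].

(** [N] is the quotient of the disjoint union of [M] and [M'] obtained by
    identifying [x] in [M] with [y] in [M'] whenever [glue x y], where [glue]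
    is a partial injection; [k] and [l] are the two canonical maps, and the
    orientation of [N] extends those of [M] and [M']. *)
Record amalgam (R : realType) (M M' N : omanifold R) (glue : M -> M' -> Prop)
    (k : M -> N) (l : M' -> N) : Prop := Amalgam {
  amalgam_injl : injective k;
  amalgam_injr : injective l;
  amalgam_glue : forall x y, k x = l y <-> glue x y;
  amalgam_surj : forall z, (exists x, z = k x) \/ (exists y, z = l y);
  amalgam_open : forall U : set N, open U <-> open (k @^-1` U) /\ open (l @^-1` U);
  amalgam_orl : orientation_preserving k;
  amalgam_orr : orientation_preserving l
}.

(** [N] represents the composite of [K] followed by [L]. *)
Definition is_comp (R : realType) (a b c : word)
    (K : cob R a b) (L : cob R b c) (N : cob R a c) : Prop :=
  exists (k : K -> N) (l : L -> N),
    [/\ amalgam (fun x y => exists p, x = out K p /\ y = inp L p) k l,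
        (forall i, inp N i = k (inp K i)) &
        (forall j, out N j = l (out L j))].

(** [N] represents the tensor product of [K] and [L]. *)
Definition is_tensor (R : realType) (a b a' b' : word)
    (K : cob R a a') (L : cob R b b') (N : cob R (a ++ b) (a' ++ b')) : Prop :=
  exists (k : K -> N) (l : L -> N),
    [/\ amalgam (fun _ _ => False) k l,
        (forall (i : 'I_(size (a ++ b))) (i' : 'I_(size a)),
           i = i' :> nat -> inp N i = k (inp K i')),
        (forall (i : 'I_(size (a ++ b))) (i' : 'I_(size b)),
           i = (size a + i')%N :> nat -> inp N i = l (inp L i')),
        (forall (j : 'I_(size (a' ++ b'))) (j' : 'I_(size a')),
           j = j' :> nat -> out N j = k (out K j')) &
        (forall (j : 'I_(size (a' ++ b'))) (j' : 'I_(size b')),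
           j = (size a' + j')%N :> nat -> out N j = l (out L j'))].

(** [N] consists of intervals joining the ingoing point [i] to the outgoing
    point [p i].  The orientation of each interval is forced by the sign of
    its ingoing end. *)
Definition is_strands (R : realType) (a b : word) (p : nat -> nat)
    (N : cob R a b) : Prop :=
  exists g : 'I_(size a) -> R -> N,
    [/\ (forall i, {within `[0, 1], continuous (g i)}),
        (forall i j s t, `[0, 1]%classic s -> `[0, 1]%classic t ->
           g i s = g j t -> i = j /\ s = t),
        (forall x, exists i, exists2 t, `[0, 1]%classic t & x = g i t),
        (forall i, g i 0 = inp N i) &
        (forall (i : 'I_(size a)) (j : 'I_(size b)),
           j = p i :> nat -> g i 1 = out N j)].

Definition is_id (R : realType) (a : word) (N : cob R a a) : Prop :=
  is_strands id N.

(** [N] represents the symmetry [tau_{a,b}]. *)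
Definition is_sym (R : realType) (a b : word)
    (N : cob R (a ++ b) (b ++ a)) : Prop :=
  is_strands
    (fun i => if (i < size a)%N then (size b + i)%N else (i - size a)%N) N.

(** * Finite dimensional vector spaces as a symmetric monoidal category *)

Section Tensor.
Variable k : fieldType.
Implicit Types U V W : vectType k.

(** Coordinates with respect to the products of the basis vectors of [V]
    and [W]. *)
Definition tens V W : vectType k := 'M[k]_(\dim {:V}, \dim {:W}).

Definition pure V W (v : V) (w : W) : tens V W :=
  \matrix_(i, j) (coord (vbasis {:V}) i v * coord (vbasis {:W}) j w).

(** The linear map out of [tens V W] induced by a bilinear map [h]; see
    [tlift_pure]. *)
Definition tlift V W U (h : V -> W -> U) : 'Hom(tens V W, U) :=
  linfun (fun A : tens V W =>
    \sum_i \sum_j A i j *: h (vbasis {:V})`_i (vbasis {:W})`_j).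

Definition tmap V V' W W' (f : 'Hom(V, V')) (g : 'Hom(W, W')) :
    'Hom(tens V W, tens V' W') := tlift (fun v w => pure (f v) (g w)).

Definition tassoc V W U : 'Hom(tens V (tens W U), tens (tens V W) U) :=
  tlift (fun v => tlift (fun w u => pure (pure v w) u)).

Definition tunitl V : 'Hom(tens k^o V, V) := tlift (fun (c : k^o) v => (c : k) *: v).

Definition tunitr V : 'Hom(tens V k^o, V) := tlift (fun v (c : k^o) => (c : k) *: v).

Definition tswap V W : 'Hom(tens V W, tens W V) :=
  tlift (fun v w => pure w v).

Definition is_iso V W (f : 'Hom(V, W)) : Prop :=
  exists2 g : 'Hom(W, V), (g \o f)%VF = \1%VF & (f \o g)%VF = \1%VF.

Fact tlift_linear V W U (h : V -> W -> U) :
  linear (fun A : tens V W =>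
    \sum_i \sum_j A i j *: h (vbasis {:V})`_i (vbasis {:W})`_j).
Proof.
move=> c A B; rewrite scaler_sumr -big_split; apply: eq_bigr => i _ /=.
rewrite scaler_sumr -big_split; apply: eq_bigr => j _ /=.
by rewrite !mxE scalerDl scalerA.
Qed.

Lemma tliftE V W U (h : V -> W -> U) (A : tens V W) :
  tlift h A = \sum_i \sum_j A i j *: h (vbasis {:V})`_i (vbasis {:W})`_j.
Proof.
pose F : {linear tens V W -> U} := HB.pack
  (fun A : tens V W =>
    \sum_i \sum_j A i j *: h (vbasis {:V})`_i (vbasis {:W})`_j)
  (GRing.isLinear.Build _ _ _ _ _ (tlift_linear h)).
exact: (lfunE F).
Qed.

Lemma tlift_pure V W U (h : V -> W -> U) :
    (forall v, linear (h v)) -> (forall w, linear (h^~ w)) ->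
  forall v w, tlift h (pure v w) = h v w.
Proof.
move=> hr hl v w; rewrite tliftE.
pose Hr v' : {linear W -> U} := HB.pack (h v')
  (GRing.isLinear.Build _ _ _ _ _ (hr v')).
pose Hl w' : {linear V -> U} := HB.pack (h^~ w')
  (GRing.isLinear.Build _ _ _ _ _ (hl w')).
transitivity (Hl w v) => //.
rewrite {2}(coord_vbasis (memvf v)) linear_sum; apply: eq_bigr => i _.
rewrite linearZ /=; set vi := (vbasis {:V})`_i.
transitivity (coord (vbasis {:V}) i v *: Hr vi w) => //.
rewrite {2}(coord_vbasis (memvf w)) linear_sum scaler_sumr.
by apply: eq_bigr => j _; rewrite linearZ /= scalerA mxE.
Qed.

Lemma pure_linearl V W (w : W) : linear ((@pure V W)^~ w).
Proof. by move=> c u v; apply/matrixP => i j; rewrite !mxE linearP mulrDl mulrA. Qed.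

Lemma pure_linearr V W (v : V) : linear (@pure V W v).
Proof.
by move=> c u w; apply/matrixP => i j; rewrite !mxE linearP mulrDr mulrCA.
Qed.

Lemma tmapE V V' W W' (f : 'Hom(V, V')) (g : 'Hom(W, W')) v w :
  tmap f g (pure v w) = pure (f v) (g w).
Proof.
by rewrite tlift_pure // => [{}v c x y|{}w c x y];
  rewrite linearP (pure_linearl, pure_linearr).
Qed.

Lemma tassocE V W U (v : V) (w : W) (u : U) :
  tassoc V W U (pure v (pure w u)) = pure (pure v w) u.
Proof.
have inner v' : tlift (fun w u => pure (pure v' w) u) (pure w u) =
    pure (pure v' w) u.
  rewrite (@tlift_pure _ _ _ (fun w u => pure (pure v' w) u)) //.
    by move=> w' c x y; rewrite pure_linearr.
  by move=> u' c x y; rewrite /= pure_linearr pure_linearl.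
rewrite tlift_pure ?inner// => [v' c x y|A c x y]; first exact: linearP.
rewrite !tliftE scaler_sumr -big_split; apply: eq_bigr => i _ /=.
rewrite scaler_sumr -big_split; apply: eq_bigr => j _ /=.
by rewrite !pure_linearl scalerDr !scalerA mulrC.
Qed.

Lemma tunitlE V (c : k) (v : V) : tunitl V (pure (c : k^o) v) = c *: v.
Proof.
rewrite (@tlift_pure k^o V V (fun c v => (c : k) *: v)) //.
  by move=> d e x y; rewrite scalerDr !scalerA mulrC.
by move=> x d e f; rewrite scalerDl -scalerA.
Qed.

Lemma tunitrE V (v : V) (c : k) : tunitr V (pure v (c : k^o)) = c *: v.
Proof.
rewrite (@tlift_pure V k^o V (fun v c => (c : k) *: v)) //.
  by move=> x d e f; rewrite scalerDl -scalerA.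
by move=> d e x y; rewrite scalerDr !scalerA mulrC.
Qed.

Lemma tswapE V W (v : V) (w : W) : tswap V W (pure v w) = pure w v.
Proof.
by rewrite (@tlift_pure V W _ (fun v w => pure w v)) // => [x|x] c u u';
  rewrite /= (pure_linearl, pure_linearr).
Qed.

End Tensor.

(** * Strong 1-dimensional TQFTs *)

(** The identity [F a -> F b] for equal words [a] and [b]; the monoidal
    structure of 1Cob is strict, but associativity and right unitality of
    concatenation are not definitional. *)
Definition eq_hom (k : fieldType) (F : word -> vectType k) (a b : word)
    (e : a = b) : 'Hom(F a, F b) :=
  match e in _ = b' return 'Hom(F a, F b') with erefl => \1%VF end.

(** A functor on 1Cob is given on representatives of morphisms, compatibly
    with [cob_equiv]. *)
Record tqft (R : realType) (k : fieldType) := Tqft {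
  obj : word -> vectType k;
  hom : forall a b : word, cob R a b -> 'Hom(obj a, obj b);
  tqft_F0 : 'Hom(k^o, obj [::]);
  tqft_F2 : forall a b : word, 'Hom(tens (obj a) (obj b), obj (a ++ b));

  hom_equiv : forall (a b : word) (K L : cob R a b),
    cob_equiv K L -> hom K = hom L;
  hom_id : forall (a : word) (N : cob R a a), is_id N -> hom N = \1%VF;
  hom_comp : forall (a b c : word)
    (K : cob R a b) (L : cob R b c) (N : cob R a c),
    is_comp K L N -> hom N = (hom L \o hom K)%VF;

  F0_iso : is_iso tqft_F0;
  F2_iso : forall a b, is_iso (tqft_F2 a b);
  F2_natural : forall (a b a' b' : word)
    (K : cob R a a') (L : cob R b b') (N : cob R (a ++ b) (a' ++ b')),
    is_tensor K L N ->
    (hom N \o tqft_F2 a b)%VF = (tqft_F2 a' b' \o tmap (hom K) (hom L))%VF;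

  F2_assoc : forall a b c : word,
    (tqft_F2 (a ++ b) c \o (tmap (tqft_F2 a b) \1 \o tassoc _ _ _))%VF =
    (eq_hom obj (catA a b c) \o
      (tqft_F2 a (b ++ c) \o tmap \1 (tqft_F2 b c)))%VF;
  F2_unitl : forall a : word,
    (tqft_F2 [::] a \o tmap tqft_F0 \1)%VF = tunitl (obj a);
  F2_unitr : forall a : word,
    (eq_hom obj (cats0 a) \o (tqft_F2 a [::] \o tmap \1 tqft_F0))%VF =
    tunitr (obj a);
  F2_sym : forall (a b : word) (N : cob R (a ++ b) (b ++ a)), is_sym N ->
    (hom N \o tqft_F2 a b)%VF = (tqft_F2 b a \o tswap (obj a) (obj b))%VF
}.

Definition faithful (R : realType) (k : fieldType) (F : tqft R k) : Prop :=
  forall (a b : word) (K L : cob R a b), hom F K = hom F L -> cob_equiv K L.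

(* Main.v *)
Require Import Defs.
From HB Require Import structures.
From mathcomp Require Import all_boot all_order all_algebra.
From mathcomp Require Import all_classical all_reals all_analysis.
From mathcomp Require Import lra.

(** A compact oriented 1-manifold is a finite union of increasing arcs that meet
    only at their ends, an end of one being the start of another. Conversely every
    finite family of arcs can be glued along a partial injection, and the gluing
    data determine the manifold up to oriented homeomorphism. Concatenating
    consecutive arcs brings a cobordism [K : a -> b] into a normal form, given by a
    matching [mu] of the boundary points of sign + with those of sign - and by a
    number [c] of circles.

    The zigzag identities give the circle the value [dim F(+)], so that a closed
    cobordism with [n] circles has the value [(dim F(+)) ^ n], which determines [n].
    Now glue [K], and likewise [L], to the mirror image of [L] along their common
    boundary. The value of the result depends on [F K] only. With [s] the number of
    boundary points of sign +, gluing [L] to its own mirror image gives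
    [s + 2 c_L] circles, and gluing [K] to it gives at most [s + c_K + c_L], with
    equality if and only if the matchings agree. Hence [F K = F L] implies
    [c_L <= c_K]; by symmetry [c_L = c_K], and then the matchings agree. *)

Set Implicit Arguments.
Unset Strict Implicit.
Unset Printing Implicit Defensive.

Import Order.TTheory GRing.Theory Num.Theory.
Import numFieldNormedType.Exports.

Local Open Scope classical_set_scope.
Local Open Scope ring_scope.

(** * Arcs and decompositions of manifolds into arcs *)

(** The laws of a TQFT apply only to composites and tensor products that are exhibited as manifolds.
    Both are gluings, and the description by arcs turns gluing into combinatorics. An arc must be
    able to close up to a circle, and two arcs must be able to meet at both ends; this is why
    injectivity is asked separately on [[0, 1)] and on [(0, 1]].

    No number of circles is attached to a manifold beforehand. A decomposition of a closed cobordism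
    into m arcs bounds the exponent: merging consecutive arcs leaves n <= m circles, with n = m
    exactly when every arc is already closed. In the gluing of K to the mirror image of L, the
    circles through the former boundary are the cycles of the permutation mu_L^{-1} mu_K of the s
    points of sign +, so there are s of them only if it is the identity. The cycles are never
    computed: two rounds of merging leave s + c_K + c_L arcs, and the question is whether all of
    them are closed. *)

Lemma nbhs_realP (R : realType) (x : R) (A : set R) :
  nbhs x A <-> exists2 e, 0 < e & forall y, `|y - x| < e -> A y.
Proof.
split=> [/nbhs_ballP[e e0 xA]|[e e0 xA]].
  by exists e => // y yx; apply: xA; rewrite /ball /= distrC.
by apply/nbhs_ballP; exists e => // y; rewrite /ball /= distrC; exact: xA.
Qed.

Lemma continuous_paste (R : realType) (T : topologicalType) (f g : R -> T) (a : R) :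
  continuous f -> continuous g -> f a = g a ->
  continuous (fun t => if t <= a then f t else g t).
Proof.
move=> cf cg fg t V /=; case: (ltgtP t a) => [ta|ta|->].
- move=> fV; have Vf : nbhs t (f @^-1` V) := cf t V fV; have sa : \forall s \near t, s < a by exact: lt_nbhsl ta.
  by apply: filterS2 Vf sa => s /= Vs sa; rewrite (ltW sa).
- move=> gV; have Vf : nbhs t (g @^-1` V) := cg t V gV; have sa : \forall s \near t, a < s by exact: lt_nbhsr ta.
  by apply: filterS2 Vf sa => s /= Vs sa; rewrite leNgt sa.
- move=> fV; have Vf : nbhs a (f @^-1` V) := cf a V fV.
  rewrite fg in fV; have Vg : nbhs a (g @^-1` V) := cg a V fV.
  by apply: filterS2 Vf Vg => s /= Vs Vs'; case: ifP.
Qed.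

(** Monotonicity is only local in the parameter: an arc may leave the chart domain and return to
    another component of it, where the chart values are unrelated. *)
Definition increasing_along (R : realType) (T : topologicalType) (c : chart R T)
    (g : R -> T) : Prop :=
  forall t : R, 0 <= t <= 1 -> chart_dom c (g t) ->
    exists2 e : R, 0 < e & forall s s' : R, 0 <= s <= 1 -> 0 <= s' <= 1 ->
      `|s - t| < e -> `|s' - t| < e -> s < s' ->
      chart_map c (g s) < chart_map c (g s').

(** Only the values of an arc on [0, 1] matter. *)
Record arcs (R : realType) (T : topologicalType) (J : finType)
    (q : J -> R -> T) : Prop := Arcs {
  arc_continuous : forall j, continuous (q j);
  arc_inj0 : forall i j (s t : R), 0 <= s < 1 -> 0 <= t < 1 -> q i s = q j t ->
    i = j /\ s = t;
  arc_inj1 : forall i j (s t : R), 0 < s <= 1 -> 0 < t <= 1 -> q i s = q j t ->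
    i = j /\ s = t;
  arc_cover : forall x, exists j, exists2 t : R, 0 <= t <= 1 & x = q j t
}.

Record decomp (R : realType) (M : omanifold R) (J : finType)
    (q : J -> R -> M) : Prop := Decomp {
  decomp_arcs :> arcs q;
  decomp_increasing : forall c j, atlas c -> increasing_along c (q j)
}.

Section ArcsTheory.
Variables (R : realType) (T : topologicalType) (J : finType) (q : J -> R -> T).
Hypothesis hausT : hausdorff_space T.
Hypothesis aq : arcs q.

(** The two half-open injectivity conditions leave a single kind of coincidence, that of an end with
    a start. *)
Lemma arc_eq i j (s t : R) : 0 <= s <= 1 -> 0 <= t <= 1 -> q i s = q j t ->
  [\/ i = j /\ s = t, [/\ s = 1, t = 0 & q i 1 = q j 0] |
      [/\ s = 0, t = 1 & q j 1 = q i 0]].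
Proof.
move=> s01 t01 e.
have [s1|s1] := eqVneq s 1; last have [t1|t1] := eqVneq t 1.
- have [t0|t0] := eqVneq t 0; first by constructor 2; split=> //; move: e; rewrite s1 t0.
  constructor 1; apply: (arc_inj1 aq) e; move/eqP: t0; lra.
- have [s0|s0] := eqVneq s 0; first by constructor 3; split=> //; move: e; rewrite s0 t1.
  constructor 1; apply: (arc_inj1 aq) e; move/eqP: s0; lra.
- by constructor 1; apply: (arc_inj0 aq) e; move/eqP: t1; move/eqP: s1; lra.
Qed.

Lemma arc_start_inj i j : q i 0 = q j 0 -> i = j.
Proof. by move=> /(arc_inj0 aq)[||//]; lra. Qed.

Lemma arc_end_inj i j : q i 1 = q j 1 -> i = j.
Proof. by move=> /(arc_inj1 aq)[||//]; lra. Qed.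

Lemma compact_arc_set j (A : set R) : closed A -> A `<=` `[0, 1] ->
  compact (q j @` A).
Proof.
move=> cA A01; apply: continuous_compact.
  exact/continuous_subspaceT/(arc_continuous aq).
exact: subclosed_compact cA (@segment_compact R 0 1) A01.
Qed.

(** Closed sets can be tested on the arcs, so that [T] carries the quotient topology: [A] is the
    finite union of the images of its traces on [[0, 1]], which are compact. *)
Lemma closed_arcs (A : set T) :
  (forall j, closed [set s | 0 <= s <= 1 /\ A (q j s)]) -> closed A.
Proof.
move=> cA.
have -> : A = \bigcup_(j in [set: J]) (q j @` [set s | 0 <= s <= 1 /\ A (q j s)]).
  apply/seteqP; split=> [x Ax|x [j _ [s [_ As] <-]]] //.
  by have [j [t t01 e]] := arc_cover aq x; exists j => //; exists t; rewrite /= -?e.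
apply: closed_bigcup => [|j _]; first exact: finite_finset.
 apply: compact_closed => //.
apply: compact_arc_set => // s [+ _]; by rewrite /= in_itv.
Qed.

(** The parameters that are not [E]-close to a parameter of [x] form a compact set on each arc. The
    images of these finitely many sets have a closed union that misses [x], and [W] is its
    complement. *)
Lemma arcs_near (x : T) (E : J -> R -> R) : (forall j t, 0 < E j t) ->
  exists2 W, nbhs x W & forall y, W y -> exists j (t s : R),
    [/\ 0 <= t <= 1, 0 <= s <= 1, q j t = x, `|s - t| < E j t & y = q j s].
Proof.
move=> E0.
pose A j := [set s | 0 <= s <= 1 /\ ~ exists t : R, [/\ 0 <= t <= 1, q j t = x & `|s - t| < E j t]].
pose C := \bigcup_(j in [set: J]) (q j @` A j).
have cC : closed C.
  apply: closed_bigcup => [|j _]; first exact: finite_finset.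
 apply: compact_closed => //.
  apply: compact_arc_set; last by move=> s [+ _]; rewrite /= in_itv.
  have -> : A j = `[0, 1] `&` ~` [set s | exists t : R, [/\ 0 <= t <= 1, q j t = x & `|s - t| < E j t]].
    by apply/seteqP; split => s /=; rewrite in_itv.
  apply: closedI; first exact: itv_closed.
  apply: open_closedC; rewrite openE => s [t [t01 qt st]].
  apply/nbhs_realP; exists (E j t - `|s - t|); first by rewrite subr_gt0.
  move=> y ys; exists t; split=> //.
  have := ler_distD s y t; lra.
exists (~` C).
  apply: open_nbhs_nbhs; split; first exact: closed_openC.
  move=> [j _ [s [s01 +] qs]]; apply; exists s; split=> //.
  by rewrite subrr normr0.
move=> y Cy; have [j [s s01 ys]] := arc_cover aq y.
have : ~ A j s by move=> As; apply: Cy; exists j => //; exists s.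
move=> /not_andP[//|/contrapT[t [t01 qt st]]].
by exists j, t, s.
Qed.

Variables (T' : topologicalType) (J' : finType) (q' : J' -> R -> T').
Hypothesis cq' : forall j, continuous (q' j).
Variable phi : J -> J'.

(** The map is defined through an arbitrary choice of parameters; by [arc_eq] its values depend on
    the choice only at the glued ends, where the hypothesis makes them agree. Continuity is tested
    on the arcs. *)
Lemma arcs_map :
  (forall i j, q i 1 = q j 0 -> q' (phi i) 1 = q' (phi j) 0) ->
  exists2 k : T -> T', continuous k &
    forall j (t : R), 0 <= t <= 1 -> k (q j t) = q' (phi j) t.
Proof.
move=> glue.
have /choice[r rP] : forall x, exists p : J * R, 0 <= p.2 <= 1 /\ x = q p.1 p.2.
  by move=> x; have [j [t t01 e]] := arc_cover aq x; exists (j, t).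
pose k x := q' (phi (r x).1) (r x).2.
have kq j t : 0 <= t <= 1 -> k (q j t) = q' (phi j) t.
  rewrite /k => t01; have [r01 e] := rP (q j t).
  by have [[<- <-]|[-> -> /glue]|[-> -> /glue]] := arc_eq t01 r01 e.
exists k => //; apply/continuous_closedP => A cA.
apply: closed_arcs => j.
have -> : [set s | 0 <= s <= 1 /\ (k @^-1` A) (q j s)] =
    `[0, 1] `&` (q' (phi j) @^-1` A).
  apply/seteqP; split=> s /=; rewrite in_itv /=; first by move=> [s01]; rewrite kq.
  by move=> [s01]; split; rewrite ?kq.
apply: closedI; first exact: itv_closed.
exact: (continuous_closedP _).1 (@cq' (phi j)) A cA.
Qed.

(** Near [x] only the arc ending at [x] and the arc starting there matter. Points on the same piece
    are compared by monotonicity along that arc, points on different pieces by way of [x] itself. *)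
Lemma increasing_near_arcs (k : T -> T') (c : chart R T) (d : chart R T') x :
  (forall j (t : R), 0 <= t <= 1 -> k (q j t) = q' (phi j) t) ->
  (forall j, increasing_along c (q j)) ->
  (forall j, increasing_along d (q' (phi j))) ->
  chart_dom c x -> chart_dom d (k x) -> increasing_near c d k x.
Proof.
move=> kq ic id' cx dx.
have /choice[E EP] : forall p : J * R, exists e : R, 0 < e /\
    (0 <= p.2 <= 1 -> q p.1 p.2 = x -> forall s s' : R, 0 <= s <= 1 -> 0 <= s' <= 1 ->
      `|s - p.2| < e -> `|s' - p.2| < e -> s < s' ->
      chart_map c (q p.1 s) < chart_map c (q p.1 s') /\
      chart_map d (k (q p.1 s)) < chart_map d (k (q p.1 s'))).
  move=> [j t] /=; have [t01|t01] := boolP (0 <= t <= 1); last by exists 1; split.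
  have [qx|qx] := pselect (q j t = x); last by exists 1; split.
  have [|e e0 eP] := ic j t t01; first by rewrite qx.
  have [|e' e'0 e'P] := id' j t t01; first by rewrite -kq // qx.
  exists (Num.min e e'); split; first by rewrite lt_min e0.
  move=> _ _ s s' s01 s'01; rewrite !lt_min => /andP[se se'] /andP[s'e s'e'] ss'.
  by rewrite !kq //; split; [exact: eP|exact: e'P].
have E0 j t : 0 < E (j, t) by case: (EP (j, t)).
have [W xW WP] := arcs_near x E0.
exists W => // y z /WP[i [t [s [t01 s01 qt st ->]]]] /WP[j [t' [s' [t'01 s'01 qt' s't' ->]]]] cyz.
have [_ /(_ t01 qt) /= Ei] := EP (i, t).
have [_ /(_ t'01 qt') /= Ej] := EP (j, t').
have tt : `|t - t| < E (i, t) by rewrite subrr normr0.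
have tt' : `|t' - t'| < E (j, t') by rewrite subrr normr0.
have Eit u : `|u - t| < E (i, t) -> 0 <= u <= 1 -> u < t ->
    chart_map c (q i u) < chart_map c x /\ chart_map d (k (q i u)) < chart_map d (k x).
  by move=> ? ? ?; rewrite -qt; exact: Ei.
have Eti u : `|u - t| < E (i, t) -> 0 <= u <= 1 -> t < u ->
    chart_map c x < chart_map c (q i u) /\ chart_map d (k x) < chart_map d (k (q i u)).
  by move=> ? ? ?; rewrite -qt; exact: Ei.
have Ejt u : `|u - t'| < E (j, t') -> 0 <= u <= 1 -> u < t' ->
    chart_map c (q j u) < chart_map c x /\ chart_map d (k (q j u)) < chart_map d (k x).
  by move=> ? ? ?; rewrite -qt'; exact: Ej.
have Etj u : `|u - t'| < E (j, t') -> 0 <= u <= 1 -> t' < u ->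
    chart_map c x < chart_map c (q j u) /\ chart_map d (k x) < chart_map d (k (q j u)).
  by move=> ? ? ?; rewrite -qt'; exact: Ej.
have [] := @arc_eq i j t t' t01 t'01; first by rewrite qt.
- move=> [ij ett]; subst j t'.
  have [ss|ss|ss] := ltgtP s s'.
  + by have [] := Ei s s' s01 s'01 st s't' ss.
  + by have [] := Ei s' s s'01 s01 s't' st ss; lra.
  + by move: cyz; rewrite ss ltxx.
- move=> [t1 t'0 _].
  have [st1|st1] := eqVneq s t.
    have [st2|st2] := eqVneq s' t'; first by move: cyz; rewrite st1 st2 qt qt' ltxx.
    rewrite st1 qt; apply: (Etj s' s't' s'01 _).2; move/eqP: st2; lra.
  have [|_ yx] := Eit s st s01 _; first by move/eqP: st1; lra.
  have [st2|st2] := eqVneq s' t'; first by rewrite st2 qt'.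
  have [|_ xz] := Etj s' s't' s'01 _; first by move/eqP: st2; lra.
  exact: lt_trans yx xz.
- move=> [t0 t'1 _].
  have xy : chart_map c x <= chart_map c (q i s).
    have [->|st1] := eqVneq s t; first by rewrite qt.
    have [|/ltW//] := Eti s st s01 _; by move/eqP: st1; lra.
  have zx : chart_map c (q j s') <= chart_map c x.
    have [->|st1] := eqVneq s' t'; first by rewrite qt'.
    have [|/ltW//] := Ejt s' s't' s'01 _; by move/eqP: st1; lra.
  lra.
Qed.

End ArcsTheory.

(** All maps between manifolds in the proof come from here: the canonical maps of a gluing and, by
    applying it in both directions, the oriented homeomorphisms. *)
Lemma decomp_map (R : realType) (M N : omanifold R) (J J' : finType)
    (q : J -> R -> M) (q' : J' -> R -> N) (phi : J -> J') :
  decomp q -> decomp q' ->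
  (forall i j, q i 1 = q j 0 -> q' (phi i) 1 = q' (phi j) 0) ->
  exists k : M -> N, [/\ continuous k, orientation_preserving k &
    forall j (t : R), 0 <= t <= 1 -> k (q j t) = q' (phi j) t].
Proof.
move=> dq dq' glue.
have [k ck kq] := arcs_map (@space_hausdorff R M) dq (arc_continuous dq') glue.
exists k; split=> // c d x Ac Ad cx dx.
apply: (increasing_near_arcs (@space_hausdorff R M) dq kq) => // j.
  exact: decomp_increasing.
exact: decomp_increasing.
Qed.

Lemma decomp_reindex (R : realType) (M : omanifold R) (J J' : finType)
    (q : J -> R -> M) (f : J' -> J) :
  decomp q -> bijective f -> decomp (fun j => q (f j)).
Proof.
move=> dq [g fK gK]; split; last by move=> c j Ac; exact: decomp_increasing.
split.
- by move=> j; exact: (arc_continuous dq).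
- by move=> i j s t s01 t01 /(arc_inj0 dq s01 t01)[/(can_inj fK)].
- by move=> i j s t s01 t01 /(arc_inj1 dq s01 t01)[/(can_inj fK)].
- move=> x; have [j [t t01 e]] := arc_cover dq x; exists (g j), t => //.
  by rewrite gK.
Qed.

Definition concat (R : realType) (T : Type) (f g : R -> T) (t : R) : T :=
  if t <= 1/2 then f (2 * t) else g (2 * t - 1).

Lemma concat_continuous (R : realType) (T : topologicalType) (f g : R -> T) :
  continuous f -> continuous g -> f 1 = g 0 -> continuous (concat f g).
Proof.
move=> cf cg fg; apply: (@continuous_paste R T (fun t => f (2 * t)) (fun t => g (2 * t - 1))).
- move=> t; apply: (continuous_comp _ (cf _)); exact: mulrl_continuous.
- move=> t; apply: (@cvg_comp _ _ _ (fun t => 2 * t - 1) g _ (nbhs (2 * t - 1))); last exact: cg.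
  apply: cvgB; [exact: mulrl_continuous|exact: cvg_cst].
- by rewrite mul1r divff ?subrr // pnatr_eq0.
Qed.

Lemma concat_increasing (R : realType) (T : topologicalType) (c : chart R T)
    (f g : R -> T) : f 1 = g 0 ->
  increasing_along c f -> increasing_along c g -> increasing_along c (concat f g).
Proof.
move=> fg cf cg t t01; rewrite /concat; case: (ltgtP t (1/2)) => th.
- move=> /cf[|e e0 eP]; first lra.
  exists (Num.min (e / 2) (1/2 - t)); first by rewrite lt_min; lra.
  move=> s s' s01 s'01; rewrite !lt_min => /andP[se sh] /andP[s'e s'h] ss'.
  have -> : s <= 1/2 by move: sh; rewrite ltr_norml; lra.
  have -> : s' <= 1/2 by move: s'h; rewrite ltr_norml; lra.
  apply: eP; rewrite ?ltr_norml; move: se s'e sh s'h; rewrite ?ltr_norml; lra.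
- move=> /cg[|e e0 eP]; first lra.
  exists (Num.min (e / 2) (t - 1/2)); first by rewrite lt_min; lra.
  move=> s s' s01 s'01; rewrite !lt_min => /andP[se sh] /andP[s'e s'h] ss'.
  have -> : (s <= 1/2) = false by apply/negbTE; rewrite -ltNge; move: sh; rewrite ltr_norml; lra.
  have -> : (s' <= 1/2) = false by apply/negbTE; rewrite -ltNge; move: s'h; rewrite ltr_norml; lra.
  apply: eP; rewrite ?ltr_norml; move: se s'e sh s'h; rewrite ?ltr_norml; lra.
- have -> : 2 * t = 1 by lra.
  move=> cx; have [|e e0 eP] := cf 1 _ cx; first lra.
  rewrite fg in cx; have [|e' e'0 e'P] := cg 0 _ cx; first lra.
  exists (Num.min (e / 2) (e' / 2)); first by rewrite lt_min; lra.
  move=> s s' s01 s'01; rewrite !lt_min => /andP[se sh] /andP[s'e s'h] ss'.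
  have sf : s < 1/2 -> chart_map c (f (2 * s)) < chart_map c (f 1).
    by move=> ?; apply: eP; rewrite ?ltr_norml; move: se; rewrite ?ltr_norml; lra.
  have sg : 1/2 < s' -> chart_map c (f 1) < chart_map c (g (2 * s' - 1)).
    by rewrite fg => ?; apply: e'P; rewrite ?ltr_norml; move: s'h; rewrite ?ltr_norml; lra.
  case: (leP s (1/2)) => hs; case: (leP s' (1/2)) => hs'.
  + apply: eP; rewrite ?ltr_norml; move: se s'e; rewrite ?ltr_norml; lra.
  + have [hs1|hs1] := eqVneq s (1/2).
      by rewrite hs1 mul1r divff ?pnatr_eq0 //; exact: sg.
    apply: lt_trans (sg hs'); apply: sf; move/eqP: hs1; lra.
  + lra.
  + apply: e'P; rewrite ?ltr_norml; move: sh s'h; rewrite ?ltr_norml; lra.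
Qed.

(** Each arc of [D] is prepended to the arc of [J] that starts at its end. Since two arcs never
    share an end, [f] is injective and an arc of [J] absorbs at most one arc of [D]. Every later
    count of arcs rests on this step. *)
Lemma decomp_merge (R : realType) (M : omanifold R) (D J : finType)
    (q : D + J -> R -> M) (f : D -> J) :
  decomp q -> (forall d, q (inl d) 1 = q (inr (f d)) 0) ->
  exists q' : J -> R -> M, [/\ decomp q', (forall j, q' j 1 = q (inr j) 1),
    (forall d, q' (f d) 0 = q (inl d) 0) &
    (forall j, (forall d, f d <> j) -> q' j 0 = q (inr j) 0)].
Proof.
move=> dq qf.
have injf : injective f.
  move=> d e fde; have : q (inl d) 1 = q (inl e) 1 by rewrite !qf fde.
  by move=> /(arc_end_inj dq)[].
pose q' j := if [pick d | f d == j] is Some d then concat (q (inl d)) (q (inr j))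
             else q (inr j).
have q'f d : q' (f d) = concat (q (inl d)) (q (inr (f d))).
  rewrite /q'; case: pickP => [e /eqP/injf->//|/(_ d)]; by rewrite eqxx.
have q'n j : (forall d, f d <> j) -> q' j = q (inr j).
  by move=> fj; rewrite /q'; case: pickP => // d /eqP /fj.
have fP j : (exists d, f d = j) \/ (forall d, f d <> j).
  have [h|h] := pselect (exists d, f d = j); [by left|right => d fd].
  by apply: h; exists d.
exists q'; split; last 3 first.
- move=> j; have [[d <-]|fj] := fP j; last by rewrite q'n.
  rewrite q'f /concat; have -> : (1 <= 1/2 :> R) = false by apply/negbTE; lra.
  by congr (q _ _); lra.
- move=> d; rewrite q'f /concat; have -> : 0 <= 1/2 :> R by lra.
  by rewrite mulr0.
- by move=> j fj; rewrite q'n.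
split; last first.
  move=> c j Ac; have [[d <-]|fj] := fP j; last by rewrite q'n //; exact: decomp_increasing.
  by rewrite q'f; apply: concat_increasing => //; exact: decomp_increasing.
split.
- move=> j; have [[d <-]|fj] := fP j; last by rewrite q'n //; exact: (arc_continuous dq).
  by rewrite q'f; apply: concat_continuous => //; exact: (arc_continuous dq).
(* A parameter in [[0, 1)] of a merged arc is traced to a parameter in [[0, 1)] of an original arc.
   The midpoint has to count as the start of the second piece, since as the end of the first it
   would have parameter 1. *)
- have key j (s : R) : 0 <= s < 1 ->
      exists x (u : R), [/\ 0 <= u < 1, q' j s = q x u &
       [\/ [/\ x = inr j, u = s & forall d, f d <> j],
           exists d, [/\ f d = j, x = inl d, u = 2 * s & s < 1/2] |
           exists d, [/\ f d = j, x = inr j, u = 2 * s - 1 & 1/2 <= s]]].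
    move=> s01; have [[d <-]|fj] := fP j; last first.
      by exists (inr j), s; split; [lra|rewrite q'n|constructor 1].
    rewrite q'f /concat; case: (ltgtP s (1/2)) => hs.
    + exists (inl d), (2 * s); split=> //; first lra.
      by constructor 2; exists d.
    + exists (inr (f d)), (2 * s - 1); split=> //; first lra.
      by constructor 3; exists d.
    + exists (inr (f d)), (2 * s - 1); split; first lra.
        by rewrite hs mul1r divff ?pnatr_eq0 // subrr qf.
      by constructor 3; exists d.
  move=> i j s t s01 t01; have [x [u [u01 -> xP]]] := key i s s01.
  have [y [v [v01 -> yP]]] := key j t t01.
  move=> /(arc_inj0 dq u01 v01)[xy uv].
  case: xP => [[ex eu nx]|[d [ed ex eu hs]]|[d [ed ex eu hs]]];
  case: yP => [[ey ev ny]|[e [ee ey ev ht]]|[e [ee ey ev ht]]];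
  move: xy; rewrite ex ey // => -[] ij.
  + by split=> //; rewrite -eu -ev.
  + by case: (nx e); rewrite ij.
  + by rewrite -ed -ee ij; split=> //; lra.
  + by case: (ny d); rewrite -ij.
  + by split=> //; lra.
(* On [(0, 1]] the midpoint counts instead as the end of the first piece. *)
- have key j (s : R) : 0 < s <= 1 ->
      exists x (u : R), [/\ 0 < u <= 1, q' j s = q x u &
       [\/ [/\ x = inr j, u = s & forall d, f d <> j],
           exists d, [/\ f d = j, x = inl d, u = 2 * s & s <= 1/2] |
           exists d, [/\ f d = j, x = inr j, u = 2 * s - 1 & 1/2 < s]]].
    move=> s01; have [[d <-]|fj] := fP j; last first.
      by exists (inr j), s; split; [lra|rewrite q'n|constructor 1].
    rewrite q'f /concat; case: (leP s (1/2)) => hs.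
    + exists (inl d), (2 * s); split=> //; first lra.
      by constructor 2; exists d.
    + exists (inr (f d)), (2 * s - 1); split=> //; first lra.
      by constructor 3; exists d.
  move=> i j s t s01 t01; have [x [u [u01 -> xP]]] := key i s s01.
  have [y [v [v01 -> yP]]] := key j t t01.
  move=> /(arc_inj1 dq u01 v01)[xy uv].
  case: xP => [[ex eu nx]|[d [ed ex eu hs]]|[d [ed ex eu hs]]];
  case: yP => [[ey ev ny]|[e [ee ey ev ht]]|[e [ee ey ev ht]]];
  move: xy; rewrite ex ey // => -[] ij.
  + by split=> //; rewrite -eu -ev.
  + by case: (nx e); rewrite ij.
  + by rewrite -ed -ee ij; split=> //; lra.
  + by case: (ny d); rewrite -ij.
  + by split=> //; lra.
- move=> x; have [[d|j] [t t01 ->]] := arc_cover dq x.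
    exists (f d), (t / 2); first lra.
    rewrite q'f /concat; have -> : t / 2 <= 1 / 2 by lra.
    by congr (q _ _); lra.
  have [[d <-]|fj] := fP j; last by exists j, t; rewrite // q'n.
  have [->|/eqP t0] := eqVneq t 0.
    exists (f d), (1 / 2); first lra.
    by rewrite q'f /concat lexx -qf; congr (q _ _); lra.
  exists (f d), ((t + 1) / 2); first lra.
  rewrite q'f /concat; have -> : ((t + 1) / 2 <= 1 / 2) = false by apply/negbTE; lra.
  by congr (q _ _); lra.
Qed.

(** * Orientation reversal *)

Definition flip_chart (R : realType) (T : topologicalType) (c : chart R T) : chart R T :=
  Chart (chart_dom c) (fun x => 1 - chart_map c x).

Lemma flip_chartP (R : realType) (T : topologicalType) (c : chart R T) :
  is_chart c -> is_chart (flip_chart c).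
Proof.
move=> [oc ic cc im]; split=> //.
- by move=> x y xc yc /= /addrI/oppr_inj/(ic _ _ xc yc).
- by move=> x cx; apply: cvgB; [exact: cvg_cst|exact: cc].
- move=> V oV cV; have [U oU e] := im V oV cV.
  exists ((fun x => 1 - x) @^-1` U).
    apply: open_comp => // x _; apply: cvgB; [exact: cvg_cst|exact: cvg_id].
  apply/seteqP; split=> [_ [x Vx <-] /=|y /= [Oy]].
    have : (U `&` `[0, 1]) (chart_map c x) by rewrite -e; exists x.
    by move=> [] /=; rewrite !in_itv/= opprB addrC subrK => ? ?; split=> //; lra.
  rewrite in_itv/= => y01.
  have : (chart_map c @` V) (1 - y) by rewrite e; split=> //=; rewrite in_itv/=; lra.
  by move=> [x Vx e']; exists x => //=; lra.
Qed.

Lemma flip_atlas_oriented (R : realType) (T : topologicalType) (A : set (chart R T)) :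
  atlas_preserving A A id ->
  atlas_preserving (@flip_chart R T @` A) (@flip_chart R T @` A) id.
Proof.
move=> oA _ _ x [c Ac <-] [d Ad <-] cx dx; have [W xW WP] := oA c d x Ac Ad cx dx.
by exists W => // y z Wy Wz /=; rewrite !ltrD2l !ltrN2; exact: WP.
Qed.

(** Besides producing mirror images, this reduces statements about ends of arcs and terminal points
    to those about starts and initial points. It is transparent, so that its points are convertible
    to those of [M]. *)
Definition oreverse (R : realType) (M : omanifold R) : omanifold R.
Proof.
refine (@OManifold R (Defs.space M) (@flip_chart R M @` @atlas R M)
  (@space_compact R M) (@space_hausdorff R M) _ _
  (flip_atlas_oriented (@atlas_oriented R M))).
- by move=> _ [c Ac <-]; apply/flip_chartP/atlas_chart.
- move=> x; have [c Ac cx] := atlas_cover x.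
  by exists (flip_chart c) => //; exists c.
Defined.

Lemma boundary_sign_oreverse (R : realType) (M : omanifold R) s (x : M) :
  @boundary_sign R (oreverse M) s x <-> boundary_sign (~~ s) x.
Proof.
case: s; split.
- by move=> [_ [[c Ac <-] cx /= e]]; exists c; split=> //; lra.
- move=> [c [Ac cx e]]; exists (flip_chart c); split=> /=; [by exists c|by []|lra].
- by move=> [_ [[c Ac <-] cx /= e]]; exists c; split=> //; lra.
- move=> [c [Ac cx e]]; exists (flip_chart c); split=> /=; [by exists c|by []|lra].
Qed.

Lemma flip_increasing_along (R : realType) (T : topologicalType) (c : chart R T)
    (g : R -> T) :
  increasing_along c g -> increasing_along (flip_chart c) (fun t => g (1 - t)).
Proof.
move=> ig t t01 cx; have [||e e0 eP] := ig (1 - t); [lra|exact: cx|].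
exists e => // s s' s01 s'01 st s't ss' /=.
rewrite ltrD2l ltrN2; apply: eP; move: st s't; rewrite ?ltr_norml; lra.
Qed.

Lemma decomp_oreverse (R : realType) (M : omanifold R) (J : finType)
    (q : J -> R -> M) :
  decomp q -> decomp (fun j t => q j (1 - t) : oreverse M).
Proof.
move=> dq; split; first split.
- move=> j t; apply: (@cvg_comp _ _ _ (fun t => 1 - t) (q j) _ (nbhs (1 - t))).
    by apply: cvgB; [exact: cvg_cst|exact: cvg_id].
  exact: (arc_continuous dq).
- by move=> i j s t s01 t01 /(arc_inj1 dq)[||? ?]; [lra..|split=> //; lra].
- by move=> i j s t s01 t01 /(arc_inj0 dq)[||? ?]; [lra..|split=> //; lra].
- move=> x; have [j [t t01 ->]] := arc_cover dq x; exists j, (1 - t); first lra.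
  by congr (q _ _); lra.
- by move=> _ j [c Ac <-]; apply: flip_increasing_along; exact: (@decomp_increasing _ _ _ _ dq).
Qed.

(** * Boundary points in terms of arcs *)

Lemma chart_range (R : realType) (M : omanifold R) (c : chart R M) x : atlas c -> chart_dom c x ->
  0 <= chart_map c x <= 1.
Proof.
move=> Ac cx; have [oc _ _ im] := atlas_chart Ac.
have [U oU e] := im _ oc (fun y h => h).
have : (U `&` `[0, 1]) (chart_map c x) by rewrite -e; exists x.
by move=> [_] /=; rewrite in_itv.
Qed.

Lemma chart_arc (R : realType) (M : omanifold R) (c : chart R M) (g : R -> M) t :
  continuous g -> increasing_along c g -> atlas c -> 0 <= t <= 1 -> chart_dom c (g t) ->
  exists2 e : R, 0 < e & forall s s' : R, 0 <= s <= 1 -> 0 <= s' <= 1 ->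
    `|s - t| < e -> `|s' - t| < e ->
    [/\ chart_dom c (g s), 0 <= chart_map c (g s) <= 1 &
        s < s' -> chart_map c (g s) < chart_map c (g s')].
Proof.
move=> cg ig Ac t01 cx; have [e e0 eP] := ig t t01 cx.
have [oc _ _ _] := atlas_chart Ac.
have : nbhs t (g @^-1` chart_dom c).
  by apply: (cg t); exact: open_nbhs_nbhs.
move=> /nbhs_realP[e' e'0 e'P].
exists (Num.min e e'); first by rewrite lt_min e0.
move=> s s' s01 s'01; rewrite !lt_min => /andP[se se'] /andP[s'e s'e'].
have cs := e'P s se'; split=> //; first exact: chart_range.
exact: eP.
Qed.

Section Boundary.
Variables (R : realType) (M : omanifold R) (J : finType) (q : J -> R -> M).
Hypothesis dq : decomp q.

(** At a parameter [t > 0] the points just before it on the arc would have chart values below 0. *)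
Lemma initial_arc j t : 0 <= t <= 1 -> initial_point (q j t) -> t = 0.
Proof.
move=> t01 [c [Ac cx c0]]; have [//|/eqP t0] := eqVneq t 0.
have [e e0 eP] := chart_arc (@arc_continuous _ _ _ _ dq j) (@decomp_increasing _ _ _ _ dq c j Ac) Ac t01 cx.
have : 0 < Num.min e t by rewrite lt_min; lra.
set m := Num.min e t => m0.
have me : m <= e by rewrite ge_min lexx.
have mt : m <= t by rewrite ge_min lexx orbT.
have [||||] := eP (t - m / 2) t; [lra|lra|rewrite ltr_norml; lra|by rewrite subrr normr0|].
lra.
Qed.

(** If no arc ends at [q j 0], all nearby points lie after it on arc [j], so that any chart has a
    local minimum there. As charts are open onto subsets of [[0, 1]], the minimum can only be 0. *)
Lemma initial_pointP j :
  initial_point (q j 0) <-> forall i, q i 1 <> q j 0.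
Proof.
split=> [ij i e|nj].
  by move: ij; rewrite -e => /initial_arc; lra.
have [c Ac cx] := atlas_cover (q j 0); exists c; split=> //.
have /choice[E EP] : forall p : J * R, exists e : R, 0 < e /\
    (0 <= p.2 <= 1 -> q p.1 p.2 = q j 0 -> forall s : R, 0 <= s <= 1 ->
      `|s - p.2| < e -> chart_map c (q j 0) <= chart_map c (q p.1 s)).
  move=> [i t] /=; have [t01|t01] := boolP (0 <= t <= 1); last by exists 1; split.
  have [qx|qx] := pselect (q i t = q j 0); last by exists 1; split.
  have [|e e0 eP] := chart_arc (@arc_continuous _ _ _ _ dq i) (@decomp_increasing _ _ _ _ dq c i Ac) Ac t01; first by rewrite qx.
  exists e; split=> // _ _ s s01 st.
  have h01 : 0 <= (0 : R) <= 1 by lra.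
  have [[ij et]|[_ t1 e1]|[_ t1 e1]] := arc_eq dq t01 h01 qx.
  - subst i t.
    have [->//|/eqP s0] := eqVneq s 0.
    have [||_ _ H] := eP 0 s t01 s01; first by rewrite subrr normr0.
      by [].
    by apply/ltW/H; lra.
  - by case: (nj i).
  - lra.
have E0 i t : 0 < E (i, t) by case: (EP (i, t)).
have [W xW WP] := arcs_near (@space_hausdorff R M) dq (q j 0) E0.
have cW y : W y -> chart_map c (q j 0) <= chart_map c y.
  move=> /WP[i [t [s [t01 s01 qt st ->]]]].
  by have [_] := EP (i, t); exact.
have [oc _ _ im] := atlas_chart Ac.
have oV : open (W° `&` chart_dom c) by apply: openI => //; exact: open_interior.
have [|U oU e] := im _ oV; first by move=> y [].
have : (U `&` `[0, 1]) (chart_map c (q j 0)) by rewrite -e; exists (q j 0).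
move=> [/= Uu]; rewrite in_itv /= => u01.
have [//|/eqP u0] := eqVneq (chart_map c (q j 0)) 0.
have : nbhs (chart_map c (q j 0)) U by exact: open_nbhs_nbhs.
move=> /nbhs_realP[d d0 dP].
set u := chart_map c (q j 0) in u01 u0 dP cW *.
have : 0 < Num.min d u by rewrite lt_min; lra.
set m := Num.min d u => m0.
have md : m <= d by rewrite ge_min lexx.
have mu : m <= u by rewrite ge_min lexx orbT.
have : (U `&` `[0, 1]) (u - m / 2).
  by split; [apply: dP; rewrite ltr_norml; lra|rewrite /= in_itv /=; lra].
rewrite -e => -[y [/interior_subset Wy _] ey].
have := cW y Wy; lra.
Qed.

End Boundary.

Section Boundary2.
Variables (R : realType) (M : omanifold R) (J : finType) (q : J -> R -> M).
Hypothesis dq : decomp q.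

(** The parameter at which an arc has its end of sign [s], [true] standing for +. *)
Definition end_of (s : bool) : R := if s then 0 else 1.

Lemma end_of_itv s : 0 <= end_of s <= 1.
Proof. by case: s; rewrite /end_of /=; lra. Qed.

Lemma boundary_arc s j t : 0 <= t <= 1 -> boundary_sign s (q j t) -> t = end_of s.
Proof.
case: s => t01 => [/(initial_arc dq t01)//|].
move=> /(boundary_sign_oreverse true) h.
have := @initial_arc _ _ _ _ (decomp_oreverse dq) j (1 - t).
by rewrite /= /end_of subKr => /(_ _ h) H; apply/eqP; move: H; lra.
Qed.

Lemma boundary_signP s j :
  boundary_sign s (q j (end_of s)) <-> forall i, q i (end_of (~~ s)) <> q j (end_of s).
Proof.
case: s => /=; first exact: initial_pointP.
have H := @initial_pointP _ _ _ _ (decomp_oreverse dq) j; rewrite /= subr0 in H.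
have B := @boundary_sign_oreverse R M true (q j 1); rewrite /= in B.
split=> [/B/H h i|h]; first by have := h i; rewrite subrr.
by apply/B/H => i; rewrite subrr; exact: h.
Qed.

Lemma boundary_sign_uniq s s' (x : M) : boundary_sign s x -> boundary_sign s' x -> s = s'.
Proof.
have [j [t t01 ->]] := arc_cover dq x.
move=> /(boundary_arc t01)-> /(boundary_arc (end_of_itv _)).
by case: s s' => -[] //=; rewrite /end_of => /eqP; rewrite ?oner_eq0 // eq_sym oner_eq0.
Qed.

Lemma boundary_sign_arc s (x : M) : boundary_sign s x ->
  exists j, x = q j (end_of s).
Proof.
have [j [t t01 ->]] := arc_cover dq x.
by move=> /(boundary_arc t01)->; exists j.
Qed.

End Boundary2.

(** * Gluing arcs *)

(** The chart is described by a continuous map [e] inverse to it. The image of an open set [V] is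
    then the trace of its preimage under [e] on [[0, 1]], which is relatively open. *)
Lemma chart_of_param (R : realType) (T : topologicalType) (e : R -> T)
    (D : set T) (c : T -> R) : continuous e ->
  (forall V : set R, open V -> open (D `&` c @^-1` V)) ->
  (forall x, D x -> 0 <= c x <= 1 /\ e (c x) = x) ->
  (forall u, 0 <= u <= 1 -> D (e u) -> c (e u) = u) -> is_chart (Chart D c).
Proof.
move=> ce oD ec cE; split=> /=.
- by have := oD setT openT; rewrite preimage_setT setIT.
- move=> x y /set_mem Dx /set_mem Dy cxy.
  by rewrite -(ec x Dx).2 -(ec y Dy).2 cxy.
- move=> x Dx V; rewrite nbhsE => -[U [oU Ux] UV].
  have : nbhs x (D `&` c @^-1` U) by apply: open_nbhs_nbhs; split; [exact: oD|].
  by apply: filterS => y [_ /UV].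
- move=> V oV VD; exists (e @^-1` V); first by apply: open_comp => // u _; exact: ce.
  apply/seteqP; split=> [_ [x Vx <-]|u [Vu]].
    by have [cx01 ex] := ec x (VD x Vx); split; rewrite /= ?ex // in_itv.
  by rewrite /= in_itv /= => u01; exists (e u); rewrite ?cE //; exact: VD.
Qed.

Section Glued.
Variables (R : realType) (J : finType) (sigma : J -> option J).

(** Normal forms of the points of [J * [0, 1]] glued along [sigma]. *)
Definition is_normal (x : J * R) : bool :=
  (0 <= x.2 < 1) || (x.2 == 1) && (sigma x.1 == None).

Definition glued : Type := {x : J * R | is_normal x}.

HB.instance Definition _ := Choice.copy glued {x : J * R | is_normal x}.

(** Arcs are functions on all of [R]; clamping extends them by constants outside [[0, 1]] and keeps
    them continuous everywhere. *)
Definition clamp (t : R) : R := if t <= 0 then 0 else if t <= 1 then t else 1.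

Definition normal_form (j : J) (t : R) : J * R :=
  if clamp t < 1 then (j, clamp t) else
  if sigma j is Some j' then (j', 0) else (j, 1).

Lemma clamp_itv t : 0 <= clamp t <= 1.
Proof. by rewrite /clamp; case: (leP t 0) => ?; [lra|case: (leP t 1) => ?; lra]. Qed.

Lemma clamp_id t : 0 <= t <= 1 -> clamp t = t.
Proof. by move=> t01; rewrite /clamp; case: (leP t 0) => ?; [lra|case: (leP t 1) => ?; lra]. Qed.

Lemma clamp_continuous : continuous clamp.
Proof.
apply: (@continuous_paste R R (fun=> 0) (fun t => if t <= 1 then t else 1)).
- exact: cst_continuous.
- apply: (@continuous_paste R R id (fun=> 1)) => //; last exact: cst_continuous.
  by move=> t; exact: cvg_id.
- by rewrite ler01.
Qed.

Lemma normal_formP j t : is_normal (normal_form j t).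
Proof.
rewrite /normal_form /is_normal; case: ifPn => [t1|_] /=.
  by have /andP[-> _] := clamp_itv t; rewrite t1.
case e: (sigma j) => [j'|] /=; first by rewrite lexx ltr01.
by rewrite eqxx e orbT.
Qed.

Definition glued_arc (j : J) (t : R) : glued := exist (fun x => is_normal x) _ (normal_formP j t).

Definition gcoord (x : glued) : J * R := proj1_sig x.

Lemma gcoord_inj : injective gcoord.
Proof. exact: val_inj. Qed.

Arguments glued_arc : simpl never.
Arguments gcoord : simpl never.

Lemma gcoordE j t : gcoord (glued_arc j t) = normal_form j t.
Proof. by []. Qed.

(** The final topology with respect to the arcs, that is, the quotient topology on the normal
    forms. *)
Definition glued_open : set_system glued :=
  [set U | forall j, open (glued_arc j @^-1` U)].

Lemma glued_openT : glued_open setT.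
Proof. by move=> j; exact: openT. Qed.

Lemma glued_openI : setI_closed glued_open.
Proof. by move=> U V oU oV j; rewrite preimage_setI; exact: openI. Qed.

Lemma glued_open_bigU (I : Type) (U : I -> set glued) :
  (forall i, glued_open (U i)) -> glued_open (\bigcup_i U i).
Proof. by move=> oU j; rewrite preimage_bigcup; apply: bigcup_open => i _; exact: oU. Qed.

HB.instance Definition _ :=
  isOpenTopological.Build glued glued_openT glued_openI glued_open_bigU.

Lemma glued_openE (U : set glued) : open U = forall j, open (glued_arc j @^-1` U).
Proof. by []. Qed.

Lemma glued_arc_continuous j : continuous (glued_arc j).
Proof. by apply/continuousP => U; rewrite glued_openE; exact. Qed.

Lemma glued_arc_clamp j t : glued_arc j t = glued_arc j (clamp t).
Proof. by apply/gcoord_inj; rewrite ?gcoordE /normal_form (clamp_id (clamp_itv t)). Qed.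

Lemma glued_arc_lt j t : 0 <= t < 1 -> gcoord (glued_arc j t) = (j, t).
Proof.
move=> /andP[t0 t1]; rewrite ?gcoordE /normal_form clamp_id ?t1 //.
by rewrite t0 ltW.
Qed.

Lemma glued_arc1 j :
  gcoord (glued_arc j 1) = if sigma j is Some j' then (j', 0) else (j, 1).
Proof. by rewrite ?gcoordE /normal_form clamp_id ?ltxx // ler01 lexx. Qed.

Lemma gcoord_cases (x : glued) :
  0 <= (gcoord x).2 < 1 \/ (gcoord x).2 = 1 /\ sigma (gcoord x).1 = None.
Proof.
by case/orP: (proj2_sig x) => [?|/andP[/eqP ? /eqP ?]]; [left|right].
Qed.

Lemma glued_arcE (x : glued) : x = glued_arc (gcoord x).1 (gcoord x).2.
Proof.
apply/gcoord_inj; case: (gcoord_cases x) => [t01|[t1 sj]].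
  by rewrite glued_arc_lt //; case: (gcoord x).
by rewrite t1 glued_arc1 sj -t1; case: (gcoord x).
Qed.

Lemma glued_itv (x : glued) : 0 <= (gcoord x).2 <= 1.
Proof. by case: (gcoord_cases x) => [|[->]]; lra. Qed.

Lemma itv01_cases (t : R) : 0 <= t <= 1 -> 0 <= t < 1 \/ t = 1.
Proof.
by move=> /andP[-> ]; rewrite le_eqVlt => /orP[/eqP|]; [right|left].
Qed.

Lemma glued_arc10 i j : glued_arc i 1 = glued_arc j 0 <-> sigma i = Some j.
Proof.
have e0 : gcoord (glued_arc j 0) = (j, 0) by apply: glued_arc_lt; rewrite lexx ltr01.
split=> [/(congr1 gcoord)|e]; last by apply: gcoord_inj; rewrite e0 glued_arc1 e.
rewrite e0 glued_arc1; case: (sigma i) => [j' [->//]|[_ /eqP]].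
by rewrite oner_eq0.
Qed.

Hypothesis sigma_inj : forall i i' j, sigma i = Some j -> sigma i' = Some j -> i = i'.

Lemma glued_arcs : arcs glued_arc.
Proof.
split.
- exact: glued_arc_continuous.
- by move=> i j s t s01 t01 /(congr1 gcoord); rewrite !glued_arc_lt // => -[].
- have nz (s : R) : 0 < s -> s = 0 -> False by move=> + s0; rewrite s0 ltxx.
  move=> i j s t s01 t01 /(congr1 gcoord).
  have [|s1|s1] := @itv01_cases s; first lra; have [|t1|t1] := @itv01_cases t; try lra.
  + by rewrite !glued_arc_lt // => -[].
  + rewrite t1 glued_arc1 glued_arc_lt //; case: (sigma j) => [j'|] [_ s0]; lra.
  + rewrite s1 glued_arc1 glued_arc_lt //; case: (sigma i) => [j'|] [_ s0]; lra.
  + rewrite s1 t1 !glued_arc1; case ei: (sigma i) => [i'|]; case ej: (sigma j) => [j'|] //.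
    * by move=> [ij]; split=> //; apply: (sigma_inj ei); rewrite ej ij.
    * by move=> [_]; lra.
    * by move=> [_]; lra.
    * by move=> [->].
- move=> x; exists (gcoord x).1, (gcoord x).2; [exact: glued_itv|exact: glued_arcE].
Qed.

Lemma glued_function_continuous (g : J -> R -> R) :
  (forall j, continuous (g j)) ->
  (forall i j, sigma i = Some j -> g i 1 = g j 0) ->
  continuous (fun x : glued => g (gcoord x).1 (gcoord x).2).
Proof.
move=> cg gg; apply/continuousP => V oV; rewrite glued_openE => j.
have -> : glued_arc j @^-1` ((fun x : glued => g (gcoord x).1 (gcoord x).2) @^-1` V) =
    (g j \o clamp) @^-1` V.
  apply/seteqP; rewrite /preimage; split=> t; rewrite /= glued_arc_clamp;
  have [t1|->] := itv01_cases (clamp_itv t).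
  - by rewrite glued_arc_lt.
  - by rewrite glued_arc1; case e: (sigma j) => [j'|] //=; rewrite (gg _ _ e).
  - by rewrite glued_arc_lt.
  - by rewrite glued_arc1; case e: (sigma j) => [j'|] //=; rewrite (gg _ _ e).
apply: open_comp => // t _; apply: continuous_comp; first exact: clamp_continuous.
exact: cg.
Qed.

(** Interior points are separated by the bump functions [t (1 - t)] and
    [t ^ 2 (1 - t)] on the arcs, vertices by piecewise linear hat functions. *)
Lemma glued_separate (x y : glued) : x <> y ->
  exists2 G : glued -> R, continuous G & G x <> G y.
Proof.
move=> xy.
pose bump (p : R -> R) (j i : J) (t : R) : R := if i == j then p t * (t * (1 - t)) else 0.
have cb (p : R -> R) j : continuous p ->
    continuous (fun z : glued => bump p j (gcoord z).1 (gcoord z).2).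
  move=> cp; apply: glued_function_continuous => [i|i i' _]; last first.
    by rewrite /bump subrr !mulr0 mul0r mulr0; case: ifP; case: ifP.
  rewrite /bump; case: (i == j) => t; last exact: cvg_cst.
  apply: cvgM; first exact: cp.
  by apply: cvgM; [exact: cvg_id|apply: cvgB; [exact: cvg_cst|exact: cvg_id]].
have key (u v : glued) : 0 < (gcoord u).2 < 1 -> u <> v ->
    exists2 G : glued -> R, continuous G & G u <> G v.
  move=> u01 uv.
  have [|e1] := pselect (bump (fun=> 1) (gcoord u).1 (gcoord u).1 (gcoord u).2 <>
      bump (fun=> 1) (gcoord u).1 (gcoord v).1 (gcoord v).2).
    by exists (fun z : glued => bump (fun=> 1) (gcoord u).1 (gcoord z).1 (gcoord z).2) => //;
      apply: cb; exact: cst_continuous.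
  exists (fun z : glued => bump id (gcoord u).1 (gcoord z).1 (gcoord z).2).
    by apply: cb => t; exact: cvg_id.
  (* The first bump is positive at [u], so equal values put [v] on the same arc; the quotient of the
     two bumps is then the parameter. *)
  move: e1 => /contrapT; rewrite /bump eqxx !mul1r.
  have u1 : 0 < (gcoord u).2 * (1 - (gcoord u).2) by apply: mulr_gt0; lra.
  case: eqP => [e|_ e0]; last by move: u1; rewrite e0 ltxx.
  move=> e1; rewrite -e1 => /(mulIf (lt0r_neq0 u1)) e2; apply: uv.
  rewrite (glued_arcE u) (glued_arcE v) e -e2//.
have [x01|x01] := boolP (0 < (gcoord x).2 < 1); first exact: key.
have [y01|y01] := boolP (0 < (gcoord y).2 < 1).
  have [|G cG Gxy] := key y x y01; first by move/esym.
  by exists G => // /esym.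
pose hat i (t : R) : R := (glued_arc i 0 == x)%:R * (1 - t) + (glued_arc i 1 == x)%:R * t.
exists (fun z : glued => hat (gcoord z).1 (gcoord z).2).
  apply: glued_function_continuous => [i t|i j /glued_arc10 e].
    apply: cvgD; apply: cvgM; try exact: cvg_cst; last exact: cvg_id.
    by apply: cvgB; [exact: cvg_cst|exact: cvg_id].
  by rewrite /hat subrr mulr0 add0r mulr1 subr0 mulr1 mulr0 addr0 e.
have hz z : ~~ (0 < (gcoord z).2 < 1) -> hat (gcoord z).1 (gcoord z).2 = (z == x)%:R.
  move=> z01; have zE := glued_arcE z; have z01' := glued_itv z.
  have [z0|z0] := eqVneq (gcoord z).2 0.
    by rewrite z0 in zE *; rewrite /hat -zE mulr0 addr0 subr0 mulr1.
  have z1 : (gcoord z).2 = 1 by move/eqP: z0; lra.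
  by rewrite z1 in zE *; rewrite /hat -zE subrr mulr0 add0r mulr1.
rewrite !hz // eqxx; case: eqP => [/esym//|_] /eqP; by rewrite oner_eq0.
Qed.

Lemma glued_hausdorff : hausdorff_space glued.
Proof.
move=> x y cxy; apply: contrapT => /glued_separate[G cG]; apply.
apply: (@Rhausdorff R) => A B /(cG x) GA /(cG y) GB.
by have [z [zA zB]] := cxy _ _ GA GB; exists (G z).
Qed.

Lemma glued_compact : compact [set: glued].
Proof.
have -> : [set: glued] = \big[setU/set0]_(j <- enum J) (glued_arc j @` `[0, 1]).
  apply/seteqP; split=> // x _; rewrite -bigcup_seq; exists (gcoord x).1 => /=.
    by rewrite mem_enum.
  by exists (gcoord x).2; rewrite -?glued_arcE //= in_itv; exact: glued_itv.
apply: bigsetU_compact => j _; apply: continuous_compact; last exact: segment_compact.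
apply: continuous_subspaceT; exact: glued_arc_continuous.
Qed.

(** A chart for the interior of arc [j] and for those of its ends that are not glued. Only the start
    needs a condition: in normal form the parameter 1 occurs only when [sigma j = None]. *)
Lemma glued_chart_arc (j : J) :
  let D := [set x : glued | (gcoord x).1 = j /\
             (0 < (gcoord x).2 \/ forall i, sigma i <> Some j)] in
  let c := Chart D (fun x : glued => (gcoord x).2) in
  is_chart c /\ forall i, increasing_along c (glued_arc i).
Proof.
move=> D c; split.
  apply: (@chart_of_param _ _ (glued_arc j)) => [||x [<- _]|u u01].
  - exact: glued_arc_continuous.
  - move=> V oV; rewrite glued_openE => i; have [<-{i}|ij] := pselect (j = i); last first.
      rewrite (_ : _ @^-1` _ = set0); first exact: open0.
      apply/seteqP; split=> // t [[/=]]; 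
      rewrite glued_arc_clamp; have [t1|->] := itv01_cases (clamp_itv t).
        by rewrite glued_arc_lt // => /= /esym.
      rewrite glued_arc1; case ei: (sigma i) => [i'|] /= e; last by case: ij.
      by rewrite ltxx => -[//|/(_ i)]; rewrite ei e.
    pose P0 := forall i, sigma i <> Some j.
    pose P1 := sigma j = None.
    have -> : glued_arc j @^-1` (D `&` (fun x : glued => (gcoord x).2) @^-1` V) =
      clamp @^-1` (V `&` (([set s | 0 < s] `|` [set s | P0]) `&`
                          ([set s | s < 1] `|` [set s | P1]))).
      apply/seteqP; rewrite /preimage; split=> t; rewrite /D /=.
        rewrite glued_arc_clamp.
        have [t1|->] := itv01_cases (clamp_itv t).
          by rewrite glued_arc_lt //= => -[[_ h] Vt]; split=> //; split=> //; left; lra.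
        rewrite glued_arc1 /P1; case e: (sigma j) => [j'|] /=.
          by rewrite ltxx => -[[jj [//|nj]] _]; case: (nj j); rewrite e jj.
        by move=> [_ V1]; split=> //; split; [left; exact: ltr01|right].
      rewrite [glued_arc j t]glued_arc_clamp.
      have [t1|->] := itv01_cases (clamp_itv t).
        by rewrite glued_arc_lt //= => -[Vt [h _]].
      rewrite ltxx /P1 glued_arc1 => -[Vt [_ [//|->]]] /=.
      by split=> //; split=> //; left; exact: ltr01.
    have oP (P : Prop) : open [set s : R | P].
      have [p|p] := pselect P.
        by rewrite (_ : mkset _ = setT); [exact: openT|apply/seteqP; split].
      by rewrite (_ : mkset _ = set0); [exact: open0|apply/seteqP; split].
    apply: open_comp => [t _|]; first exact: clamp_continuous.
    by apply: openI => //; apply: openI; apply: openU => //; (exact: open_gt || exact: open_lt).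
  - by rewrite -glued_arcE; split=> //; exact: glued_itv.
  - have [u1|->] := itv01_cases u01; first by rewrite /D /= glued_arc_lt.
    rewrite /D /= glued_arc1.
    case e: (sigma j) => [j'|] //= -[jj]; rewrite ltxx => -[//|nj].
    by case: (nj j); rewrite e jj.
move=> i t t01 [/=]; 
have [t1|->] := itv01_cases t01.
  rewrite glued_arc_lt //= => -> _; exists (1 - t); first lra.
  move=> s s' s01 s'01; rewrite !ltr_norml => st s't ss'.
  rewrite !glued_arc_lt //=; lra.
rewrite glued_arc1; case e: (sigma i) => [i'|] /=.
  by move=> <-; rewrite ltxx => -[//|/(_ i)]; rewrite e.
move=> ij _; exists 1; first exact: ltr01.
have id_ s : 0 <= s <= 1 -> (gcoord (glued_arc i s)).2 = s.
  by move=> /itv01_cases[s1|->]; [rewrite glued_arc_lt|rewrite glued_arc1 e].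
move=> s s' s01 s'01 _ _ ss'.
by rewrite !id_.
Qed.

(** The second half of [j] followed by the first half of [j'], shifted so that the vertex has the
    value [1/2]. Both halves omit the midpoint, so they stay disjoint even if [j = j'] and the arc
    closes up to a circle. *)
Lemma glued_chart_vertex (j j' : J) : sigma j = Some j' ->
  let D := [set x : glued | ((gcoord x).1 = j /\ 1/2 < (gcoord x).2) \/
                            ((gcoord x).1 = j' /\ (gcoord x).2 < 1/2)] in
  let c := Chart D (fun x : glued =>
    if (gcoord x).2 < 1/2 then (gcoord x).2 + 1/2 else (gcoord x).2 - 1/2) in
  is_chart c /\ forall i, increasing_along c (glued_arc i).
Proof.
move=> sj D c.
have nlt (t : R) : 1/2 <= t -> (t < 1/2) = false by move=> h; apply/negbTE; rewrite -leNgt.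
split.
  pose e u := if u <= 1/2 then glued_arc j (u + 1/2) else glued_arc j' (u - 1/2).
  apply: (@chart_of_param _ _ e) => [||x|u u01].
  - have h (a : R) : continuous (fun t : R => t + a).
      by move=> t; apply: cvgD; [exact: cvg_id|exact: cvg_cst].
    apply: (@continuous_paste _ _ (fun u => glued_arc j (u + 1/2)) (fun u => glued_arc j' (u - 1/2))).
    + move=> t; apply: (@cvg_comp _ _ _ (fun t => t + 1/2) (glued_arc j) _ (nbhs (t + 1/2))).
        exact: h.
      exact: glued_arc_continuous.
    + move=> t; apply: (@cvg_comp _ _ _ (fun t => t - 1/2) (glued_arc j') _ (nbhs (t - 1/2))).
        exact: h.
      exact: glued_arc_continuous.
    + rewrite subrr (_ : 1/2 + 1/2 = 1); last lra.
      exact/glued_arc10.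
  - move=> V oV; rewrite glued_openE => i.
    have -> : glued_arc i @^-1` (D `&` chart_map c @^-1` V) =
      clamp @^-1` (([set s | i = j] `&` ([set s | 1/2 < s] `&` (fun s => s - 1/2) @^-1` V)) `|`
                   ([set s | i = j'] `&` ([set s | s < 1/2] `&` (fun s => s + 1/2) @^-1` V))).
      have h12 : (1/2 : R) < 1 by lra.
      have h02 : (0 : R) < 1/2 by lra.
      apply/seteqP; rewrite /preimage; split=> t; rewrite /D /=.
        rewrite glued_arc_clamp.
        have [t1|->] := itv01_cases (clamp_itv t).
          rewrite glued_arc_lt //= => -[[[-> h]|[-> h]]].
            by rewrite nlt ?(ltW h) // => Vt; left.
          by rewrite h => Vt; right.
        rewrite glued_arc1; case ei: (sigma i) => [i'|] /=.
          rewrite h02 add0r => -[[[_]|[e1 _]]]; first by move=> ?; lra.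
          move=> V2; left; split; first by apply: (sigma_inj ei); rewrite sj e1.
          by split=> //; rewrite (_ : 1 - 1/2 = 1/2 :> R) //; lra.
        move=> [[[e1 _]|[_ ?]]]; last lra.
        by move: sj; rewrite -e1 ei.
      rewrite [glued_arc i t]glued_arc_clamp.
      have [t1|->] := itv01_cases (clamp_itv t).
        rewrite glued_arc_lt //= => -[[-> [h Vt]]|[-> [h Vt]]].
          by rewrite nlt ?(ltW h) //; split=> //; left.
        by rewrite h; split=> //; right.
      move=> [[-> [_ V2]]|[_ [?]]]; last lra.
      rewrite glued_arc1 sj /= h02 add0r; split; first by right.
      by move: V2; rewrite (_ : 1 - 1/2 = 1/2 :> R) //; lra.
    have oP (P : Prop) : open [set s : R | P].
      have [p|p] := pselect P.
        by rewrite (_ : mkset _ = setT); [exact: openT|apply/seteqP; split].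
      by rewrite (_ : mkset _ = set0); [exact: open0|apply/seteqP; split].
    have h (a : R) : open ((fun t : R => t + a) @^-1` V).
      by apply: open_comp => // t _; apply: cvgD; [exact: cvg_id|exact: cvg_cst].
    apply: open_comp => [t _|]; first exact: clamp_continuous.
    apply: openU; (apply: openI; first exact: oP); apply: openI; try exact: h.
      exact: open_gt.
    exact: open_lt.
  - have x01 := glued_itv x; have xE := glued_arcE x.
    move=> [[xj h]|[xj h]]; rewrite xj in xE.
      rewrite nlt; last exact: ltW.
      split; first lra.
      rewrite /e; have -> : (gcoord x).2 - 1/2 <= 1/2 by lra.
      by rewrite subrK -xE.
    rewrite h; split; first lra.
    rewrite /e; have [x0|x0] := eqVneq (gcoord x).2 0.
      rewrite x0 add0r lexx (_ : 1/2 + 1/2 = 1 :> R); last lra.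
      by rewrite xE x0; apply/glued_arc10.
    have -> : ((gcoord x).2 + 1/2 <= 1/2) = false by apply/negbTE; move/eqP: x0; lra.
    by rewrite addrK -xE.
  - rewrite /e; case: (ltgtP u (1/2)) => hu.
    + rewrite glued_arc_lt /=; last lra.
      by rewrite nlt ?addrK //; lra.
    + rewrite /D /= glued_arc_lt /=; last lra.
      move=> h; have -> : u - 1/2 < 1/2 by case: h => -[]; lra.
      by rewrite subrK.
    + rewrite hu (_ : 1/2 + 1/2 = 1 :> R); last lra.
      rewrite glued_arc1 sj /=; have -> : 0 < 1/2 :> R by lra.
      by rewrite add0r.
have cj s : 1/2 <= s <= 1 -> chart_map c (glued_arc j s) = s - 1/2.
  rewrite /c => s01; have [|s1|->] := @itv01_cases s; first lra.
    by rewrite /chart_map glued_arc_lt //= nlt //; lra.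
  rewrite /chart_map glued_arc1 sj /=; have -> : 0 < 1/2 :> R by lra.
  lra.
have cj' s : 0 <= s < 1/2 -> chart_map c (glued_arc j' s) = s + 1/2.
  move=> s01; rewrite /c /chart_map glued_arc_lt /=; last lra.
  by have -> : s < 1/2 by lra.
move=> i t t01; have [t1|->] := itv01_cases t01.
  move=> [] /=; rewrite glued_arc_lt //= => -[-> h].
    exists (Num.min (t - 1/2) (1 - t)); first by rewrite lt_min; lra.
    move=> s s' s01 s'01; rewrite !lt_min !ltr_norml => /andP[? ?] /andP[? ?] ss'.
    rewrite -[X in X < _]/(chart_map c (glued_arc j s)) -[X in _ < X]/(chart_map c (glued_arc j s')) !cj; lra.
  exists (1/2 - t); first lra.
  move=> s s' s01 s'01; rewrite !ltr_norml => ? ? ss'.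
  rewrite -[X in X < _]/(chart_map c (glued_arc j' s)) -[X in _ < X]/(chart_map c (glued_arc j' s')) !cj'; lra.
move=> h; have ij : i = j.
  have h0 : (1/2 < 0 :> R) = false by apply/negbTE; lra.
  have h1 : (1 < 1/2 :> R) = false by apply/negbTE; lra.
  move: h => /= -[] /=; rewrite glued_arc1.
    by case: (sigma i) => [i'|] /= -[// _]; rewrite h0.
  case ei: (sigma i) => [i'|] /= -[e]; last by rewrite h1.
  by move=> _; apply: (sigma_inj ei); rewrite sj e.
rewrite ij; exists (1/2); first lra.
move=> s s' s01 s'01; rewrite !ltr_norml => ? ? ss'.
rewrite -[X in X < _]/(chart_map c (glued_arc j s)) -[X in _ < X]/(chart_map c (glued_arc j s')) !cj; lra.
Qed.

(** Taking all charts that increase along the arcs makes the compatibility of orientations an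
    instance of [increasing_near_arcs]; the two explicit families serve only to cover the space. *)
Definition glued_atlas : set (chart R glued) :=
  [set c | is_chart c /\ forall i, increasing_along c (glued_arc i)].

Lemma glued_atlas_cover x : exists2 c, glued_atlas c & chart_dom c x.
Proof.
have [x0|x0] := ltP 0 (gcoord x).2.
  by have h := glued_chart_arc (gcoord x).1; eexists; [exact: h|split=> //; left].
have {}x0 : (gcoord x).2 = 0 by have := glued_itv x; lra.
have [n|n] := pselect (forall i, sigma i <> Some (gcoord x).1).
  by have h := glued_chart_arc (gcoord x).1; eexists; [exact: h|split=> //; right].
have [i /contrapT si] : exists i, ~ (sigma i <> Some (gcoord x).1) by apply/existsNP.
have h := glued_chart_vertex si; eexists; first exact: h.
by right; rewrite x0; split=> //; lra.
Qed.

Lemma glued_atlas_oriented : atlas_preserving glued_atlas glued_atlas id.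
Proof.
move=> c d x [_ ic] [_ id_] cx dx.
apply: (@increasing_near_arcs _ _ _ _ glued_hausdorff glued_arcs _ _ glued_arc id) => //.
Qed.

Definition glued_manifold : omanifold R :=
  OManifold glued_compact glued_hausdorff (fun c => @proj1 _ _)
    glued_atlas_cover glued_atlas_oriented.

Lemma decomp_glued : decomp (glued_arc : J -> R -> glued_manifold).
Proof. split; [exact: glued_arcs|by move=> c j [_]]. Qed.

End Glued.

(** The gluing is given by a relation, not by a function, so that adjacency may be an arbitrary
    proposition about points of manifolds. Every manifold built later by gluing comes from here. *)
Lemma decomp_exists (R : realType) (J : finType) (nxt : J -> J -> Prop) :
  (forall i j j', nxt i j -> nxt i j' -> j = j') ->
  (forall i i' j, nxt i j -> nxt i' j -> i = i') ->
  exists (M : omanifold R) (q : J -> R -> M), decomp q /\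
    forall i j, q i 1 = q j 0 <-> nxt i j.
Proof.
move=> nf ni; pose sigma i := [pick j | `[< nxt i j >]].
have sP i j : sigma i = Some j <-> nxt i j.
  rewrite /sigma; case: pickP => [k /asboolP nik|n].
    by split=> [[<-]//|nij]; rewrite (nf _ _ _ nik nij).
  by split=> // /asboolP nij; have := n j; rewrite nij.
have si i i' j : sigma i = Some j -> sigma i' = Some j -> i = i'.
  by move=> /sP + /sP; exact: ni.
exists (glued_manifold R si), (@glued_arc R J sigma); split; first exact: decomp_glued.
by move=> i j; rewrite -sP; exact: glued_arc10.
Qed.

(** * Existence of decompositions *)

Record embedded_arc (R : realType) (M : omanifold R) (g : R -> M) : Prop := EmbeddedArc {
  earc_continuous : continuous g;
  earc_inj : forall s t : R, 0 <= s <= 1 -> 0 <= t <= 1 -> g s = g t -> s = t;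
  earc_increasing : forall c, atlas c -> increasing_along c g;
  earc_open : open (g @` [set t | 0 < t < 1])
}.

Lemma chart_open_preimage (R : realType) (T : topologicalType) (c : chart R T) (O : set R) :
  is_chart c -> open O -> open (chart_dom c `&` chart_map c @^-1` O).
Proof.
move=> [oc _ cc _] oO; rewrite openE => y [cy Oy]; apply: filterI.
  exact: open_nbhs_nbhs.
by apply: (cc y cy); exact: open_nbhs_nbhs.
Qed.

Lemma chart_open_image (R : realType) (T : topologicalType) (c : chart R T) (V : set T) :
  is_chart c -> open V -> exists2 U : set R, open U &
    chart_map c @` (V `&` chart_dom c) = U `&` `[0, 1].
Proof.
move=> [oc _ _ im] oV; have [||U oU e] := im (V `&` chart_dom c); last by exists U.
- exact: openI.
- by move=> ? [].
Qed.

(** The arc is the inverse of a chart on a closed interval around the value at [x], rescaled to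
    [[0, 1]]. It is continuous because charts are open maps onto their images, and it increases
    along every other chart because the atlas is oriented. *)
Lemma embedded_arc_exists (R : realType) (M : omanifold R) (x : M) :
  exists2 g : R -> M, embedded_arc g & nbhs x (g @` [set t | 0 <= t <= 1]).
Proof.
have [c Ac cx] := atlas_cover x.
have chc := atlas_chart Ac; have [oc injc cc im] := chc.
have [U oU eU] := chart_open_image chc (@openT M).
have inU y : chart_dom c y -> (U `&` `[0, 1]) (chart_map c y).
  by move=> cy; rewrite -eU; exists y.
have [Ux] := inU x cx; rewrite /= in_itv /= => u01.
have /nbhs_realP[d d0 dU] : nbhs (chart_map c x) U by exact: open_nbhs_nbhs.
set u := chart_map c x in Ux u01 dU *.
(* The half-width [d / 2] keeps [[a, b]] inside [U]. Where the interval would leave [[0, 1]] it is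
   cut off, so that the arc still fills a neighbourhood of [x] if [x] is a boundary point. *)
have [a [a0 au aE]] : exists a : R, [/\ 0 <= a <= u, u - d / 2 <= a &
    (a = u - d / 2 \/ a = 0)].
  by case: (leP (u - d / 2) 0) => h; [exists 0|exists (u - d / 2)]; split; lra.
have [b [b1 bu bE]] : exists b : R, [/\ u <= b <= 1, b <= u + d / 2 &
    (b = u + d / 2 \/ b = 1)].
  by case: (leP 1 (u + d / 2)) => h; [exists 1|exists (u + d / 2)]; split; lra.
have ab : a < b by move: aE bE; lra.
have /choice[e eP] : forall r : R, exists y : M, a <= r <= b ->
    chart_dom c y /\ chart_map c y = r.
  move=> r; have [r01|r01] := boolP (a <= r <= b); last by exists x.
  have : (U `&` `[0, 1]) r.
    by split; [apply: dU; rewrite ltr_norml; lra|rewrite /= in_itv /=; lra].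
  by rewrite -eU => -[y [_ cy] <-]; exists y.
pose rho (s : R) := a + clamp s * (b - a).
have rho_itv s : a <= rho s <= b.
  have /andP[h0 h1] := clamp_itv s; rewrite /rho.
  have : 0 <= clamp s * (b - a) by apply: mulr_ge0; lra.
  have : 0 <= (1 - clamp s) * (b - a) by apply: mulr_ge0; lra.
  rewrite mulrBl mul1r; lra.
have rhoE s : 0 <= s <= 1 -> rho s = a + s * (b - a) by move=> s01; rewrite /rho clamp_id.
have ab0 : b - a != 0 by apply/eqP; lra.
have rho_cont : continuous rho.
  move=> s; apply: cvgD; first exact: cvg_cst.
  by apply: cvgM; [exact: clamp_continuous|exact: cvg_cst].
have rho_lt s s' : 0 <= s <= 1 -> 0 <= s' <= 1 -> s < s' -> rho s < rho s'.
  by move=> s01 s'01 ss'; rewrite !rhoE // ltrD2l ltr_pM2r //; lra.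
pose g s := e (rho s).
have gP s : chart_dom c (g s) /\ chart_map c (g s) = rho s by exact: eP.
have g_cont : continuous g.
  move=> s V; rewrite nbhsE => -[V' [oV' V's] V'V].
  have [U' oU' eU'] := chart_open_image chc oV'.
  have : (U' `&` `[0, 1]) (rho s).
    by rewrite -eU' -(gP s).2; exists (g s) => //; split=> //; exact: (gP s).1.
  move=> [U's _]; have : nbhs s (rho @^-1` U').
    by apply: rho_cont; exact: open_nbhs_nbhs.
  apply: filterS => s' U's'; apply: V'V.
  have : (U' `&` `[0, 1]) (rho s').
    by split=> //; rewrite /= in_itv /=; have := rho_itv s'; lra.
  rewrite -eU' => -[y [V'y cy] ey].
  by rewrite (_ : g s' = y) //; apply: injc; rewrite ?inE //; [exact: (gP s').1|rewrite (gP s').2].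
have rho_surj r : a <= r <= b -> exists2 s, 0 <= s <= 1 & r = rho s /\ s = (r - a) / (b - a).
  move=> rab; have s01 : 0 <= (r - a) / (b - a) <= 1.
    apply/andP; split; first by apply: divr_ge0; lra.
    by rewrite ler_pdivrMr ?mul1r; lra.
  by exists ((r - a) / (b - a)) => //; split=> //; rewrite rhoE // divfK //; lra.
have g_rho y r : chart_dom c y -> chart_map c y = r -> forall s, rho s = r -> g s = y.
  move=> cy ey s es; apply: injc; rewrite ?inE //; first exact: (gP s).1.
  by rewrite (gP s).2 es ey.
exists g; first split=> //.
- move=> s t s01 t01 /(congr1 (chart_map c)); rewrite !(gP _).2 !rhoE //.
  by move=> /addrI /(mulIf ab0).
- move=> f Af t t01 ft.
  have [W xW WP] := atlas_oriented Ac Af (gP t).1 ft.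
  have /nbhs_realP[r r0 rW] := g_cont t W xW.
  exists r => // s s' s01 s'01 st s't ss'; apply: WP; [exact: rW|exact: rW|].
  by rewrite !(gP _).2; exact: rho_lt.
- have -> : g @` [set t | 0 < t < 1] =
      chart_dom c `&` chart_map c @^-1` ([set r | a < r] `&` [set r | r < b]).
    apply/seteqP; split=> [_ [t t01 <-]|y [cy [/= ay yb]]].
      split; first exact: (gP t).1.
      have r0 : rho 0 = a by rewrite rhoE ?mul0r ?addr0; lra.
      have r1 : rho 1 = b by rewrite rhoE ?mul1r; lra.
      rewrite /= (gP t).2; split=> /=; [rewrite -r0|rewrite -r1]; apply: rho_lt; move: t01 => /=; lra.
    have [s s01 [rs es]] : exists2 s, 0 <= s <= 1 & chart_map c y = rho s /\ s = (chart_map c y - a) / (b - a).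
      by apply: rho_surj; lra.
    exists s; last by apply: (g_rho _ (chart_map c y)).
    rewrite /= es; apply/andP; split; first by apply: divr_gt0; lra.
    by rewrite ltr_pdivrMr ?mul1r; lra.
  by apply: chart_open_preimage => //; apply: openI; [exact: open_gt|exact: open_lt].
- have : nbhs x (chart_dom c `&` chart_map c @^-1` ([set r | u - d / 2 < r] `&` [set r | r < u + d / 2])).
    apply: open_nbhs_nbhs; split; last by split=> //; split=> /=; rewrite -/u; lra.
    by apply: chart_open_preimage => //; apply: openI; [exact: open_gt|exact: open_lt].
  apply: filterS => y [cy [/= y1 y2]].
  have [_] := inU y cy; rewrite /= in_itv /= => cy01.
  have [s s01 [rs _]] : exists2 s, 0 <= s <= 1 & chart_map c y = rho s /\ s = (chart_map c y - a) / (b - a).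
    apply: rho_surj; move: aE bE; lra.
  by exists s => //; apply: (g_rho _ (chart_map c y)).
Qed.

(** Compactness enters as the near-covering property. For the filter on lists of points generated by
    the lists containing a given one, it says that some finite list of arcs covers [M]. *)
Lemma embedded_arcs_cover (R : realType) (M : omanifold R) :
  exists (J : finType) (g : J -> R -> M), (forall j, embedded_arc (g j)) /\
    forall x, exists j, exists2 t : R, 0 <= t <= 1 & x = g j t.
Proof.
have /choice[G GP] : forall x : M, exists g : R -> M, embedded_arc g /\
    nbhs x (g @` [set t | 0 <= t <= 1]).
  by move=> x; have [g eg xg] := embedded_arc_exists x; exists g.
pose F : set_system (seq M) :=
  [set S | exists l0 : seq M, forall l : seq M, {subset l0 <= l} -> S l].
have FF : Filter F.
  split; first by exists [::].
  - move=> S S' [l lS] [l' lS']; exists (l ++ l') => m lm; split.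
      by apply: lS => y yl; apply: lm; rewrite mem_cat yl.
    by apply: lS' => y yl; apply: lm; rewrite mem_cat yl orbT.
  - by move=> S S' SS' [l lS]; exists l => m /lS /SS'.
pose P (l : seq M) (y : M) := exists2 x, x \in l & (G x @` [set t : R | 0 <= t <= 1]) y.
have /compact_near_coveringP/(_ _ F P FF) := @space_compact R M.
move=> [x _|l0 l0P].
  exists (G x @` [set t | 0 <= t <= 1], [set l : seq M | x \in l]) => /=.
    split; first exact: (GP x).2.
    by exists [:: x] => l; apply; rewrite inE.
  by move=> [y l] /= [Gy xl]; exists x.
have {}l0P y : P l0 y by exact: (l0P l0).
exists 'I_(size l0), (fun j => G (tnth (in_tuple l0) j)); split.
  by move=> j; exact: (GP _).1.
move=> y; have [x xl [t t01 <-]] := l0P y.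
have /tnthP[j ej] : x \in in_tuple l0 by [].
by exists j, t; rewrite -?ej.
Qed.

Lemma embedded_arc_sub (R : realType) (M : omanifold R) (g : R -> M) (a b : R) :
  embedded_arc g -> 0 <= a -> a < b -> b <= 1 ->
  embedded_arc (fun s => g (a + s * (b - a))).
Proof.
move=> eg a0 ab b1.
have ba : 0 < b - a by lra.
have lin s : 0 <= s <= 1 -> a <= a + s * (b - a) <= b.
  move=> /andP[s0 s1]; have : 0 <= s * (b - a) by apply: mulr_ge0; lra.
  have : 0 <= (1 - s) * (b - a) by apply: mulr_ge0; lra.
  rewrite mulrBl mul1r; lra.
have clin : continuous (fun s : R => a + s * (b - a)).
  move=> s; apply: cvgD; first exact: cvg_cst.
  by apply: cvgM; [exact: cvg_id|exact: cvg_cst].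
split.
- move=> s; apply: (@cvg_comp _ _ _ (fun s => a + s * (b - a)) g _ (nbhs (a + s * (b - a)))).
    exact: clin.
  exact: (earc_continuous eg).
- move=> s t s01 t01 /(earc_inj eg) H; have := lin s s01; have := lin t t01 => ? ?.
  by apply: (mulIf (lt0r_neq0 ba)); apply: (addrI a); apply: H; lra.
- move=> c Ac t t01 ct; have [|e e0 eP] := earc_increasing eg Ac _ ct.
    by have := lin t t01; lra.
  exists (e / (b - a)); first exact: divr_gt0.
  have scale s : `|s - t| < e / (b - a) -> `|a + s * (b - a) - (a + t * (b - a))| < e.
    move=> h; rewrite opprD addrACA subrr add0r -mulrBl normrM (gtr0_norm ba).
    by rewrite -ltr_pdivlMr.
  move=> s s' s01 s'01 /scale st /scale s't ss'; apply: eP => //.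
  - by have := lin s s01; lra.
  - by have := lin s' s'01; lra.
  - by rewrite ltrD2l ltr_pM2r.
(* The interior of the subarc is the interior of [g] without the two compact outer pieces, hence
   open. *)
have -> : (fun s => g (a + s * (b - a))) @` [set t | 0 < t < 1] =
    g @` [set t | 0 < t < 1] `&` ~` (g @` `[0, a] `|` g @` `[b, 1]).
  apply/seteqP; split=> [_ [s /= s01 <-]|_ [[s /= s01 <-] n]].
    have s0 : 0 < s * (b - a) by apply: mulr_gt0; lra.
    have s1 : 0 < (1 - s) * (b - a) by apply: mulr_gt0; lra.
    rewrite mulrBl mul1r in s1.
    split; first by exists (a + s * (b - a)) => //=; lra.
    by move=> [[t /=]|[t /=]]; rewrite in_itv /= => t01 /(earc_inj eg) H;
      have := H _ _; lra.
  have [sa sb] : a < s /\ s < b.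
    split; rewrite ltNge; apply/negP => h; apply: n; [left|right]; exists s => //=;
      by rewrite in_itv /=; lra.
  exists ((s - a) / (b - a)) => /=.
    apply/andP; split; first by apply: divr_gt0; lra.
    by rewrite ltr_pdivrMr ?mul1r //; lra.
  by congr g; rewrite divfK ?lt0r_neq0 //; lra.
apply: openI; first exact: earc_open.
apply: closed_openC; apply: closedU; apply: compact_closed;
  try exact: space_hausdorff; apply: continuous_compact; try exact: segment_compact;
  apply: continuous_subspaceT; exact: earc_continuous.
Qed.

(** * Subdivision at a set of vertices *)

Section Cells.
Variables (R : realType) (M : omanifold R) (V : set M).
Implicit Types g h : R -> M.

Definition interior_of g : set M := g @` [set t | 0 < t < 1].

Definition ends_in g := V (g 0) /\ V (g 1).

Definition cell g := [/\ embedded_arc g, ends_in g & forall x, V x -> ~ interior_of g x].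

Lemma split_arcs (J : finType) (g : J -> R -> M) (v : M) :
  V v -> (forall j, embedded_arc (g j)) -> (forall j, ends_in (g j)) ->
  exists (J' : finType) (g' : J' -> R -> M),
    [/\ (forall j, embedded_arc (g' j)), (forall j, ends_in (g' j)),
        (forall i, exists2 j, interior_of (g' i) `<=` interior_of (g j) &
            ~ interior_of (g' i) v) &
        forall j (t : R), 0 <= t <= 1 -> exists i, exists2 s : R, 0 <= s <= 1 &
          g j t = g' i s].
Proof.
move=> Vv eg Vg.
have step j : exists h : bool -> R -> M, [/\ (forall b, embedded_arc (h b)),
    (forall b, ends_in (h b)),
    (forall b, interior_of (h b) `<=` interior_of (g j) /\ ~ interior_of (h b) v) &
    forall t : R, 0 <= t <= 1 -> exists b, exists2 s : R, 0 <= s <= 1 & g j t = h b s].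
  have [[r /= r01 rv]|nv] := pselect (interior_of (g j) v); last first.
    (* An arc whose interior misses [v] is listed twice, so that the index type is uniformly
       [J * bool]; repetitions are discarded at the end of the construction. *)
    exists (fun=> g j); split=> // [b|t t01]; first by split.
    by exists true, t.
  pose lo (b : bool) := if b then 0 else r.
  pose hi (b : bool) := if b then r else 1.
  have lohi b : 0 <= lo b /\ lo b < hi b <= 1 by case: b; rewrite /lo /hi; lra.
  have aff b (s : R) : 0 < s < 1 -> lo b < lo b + s * (hi b - lo b) < hi b.
    move=> s01; have [? ?] := lohi b.
    have : 0 < s * (hi b - lo b) by apply: mulr_gt0; lra.
    have : 0 < (1 - s) * (hi b - lo b) by apply: mulr_gt0; lra.
    rewrite mulrBl mul1r; lra.
  exists (fun b s => g j (lo b + s * (hi b - lo b))); split.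
  - by move=> b; have [? ?] := lohi b; apply: embedded_arc_sub; [exact: eg|lra..].
  - move=> b; have [V0 V1] := Vg j; split; rewrite ?mul0r ?mul1r ?addr0 ?subrKC;
      by case: b; rewrite /lo /hi ?rv.
  - move=> b; have [? ?] := lohi b; split.
      move=> _ [s s01 <-]; exists (lo b + s * (hi b - lo b)) => //=.
      by have := aff b s s01; lra.
    move=> [s s01]; rewrite -rv => /(earc_inj (eg j)) H; have := aff b s s01.
    have {}H : lo b + s * (hi b - lo b) = r by apply: H; have := aff b s s01; lra.
    by rewrite H; case: (b); rewrite /lo /hi; lra.
  - move=> t t01; have [tr|tr] := leP t r.
      exists true, (t / r).
        apply/andP; split; first by apply: divr_ge0; lra.
        by rewrite ler_pdivrMr ?mul1r; lra.
      by congr (g j); rewrite /lo /hi subr0 add0r divfK //; apply/eqP; lra.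
    exists false, ((t - r) / (1 - r)).
      apply/andP; split; first by apply: divr_ge0; lra.
      by rewrite ler_pdivrMr ?mul1r; lra.
    by congr (g j); rewrite /lo /hi divfK; [lra|apply/eqP; lra].
have [H HP] := choice step.
exists (J * bool)%type, (fun p => H p.1 p.2); split.
- by move=> p; have [] := HP p.1.
- by move=> p; have [] := HP p.1.
- by move=> p; exists p.1; have [_ _ /(_ p.2)[]] := HP p.1.
- move=> j t /= t01; have [_ _ _ /(_ t t01)[b [s s01 e]]] := HP j.
  by exists (j, b), s.
Qed.

Lemma split_arcs_seq (vs : seq M) (J : finType) (g : J -> R -> M) :
  (forall v, v \in vs -> V v) ->
  (forall j, embedded_arc (g j)) -> (forall j, ends_in (g j)) ->
  (forall x, exists j, exists2 t : R, 0 <= t <= 1 & x = g j t) ->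
  exists (J' : finType) (g' : J' -> R -> M),
    [/\ (forall j, embedded_arc (g' j)), (forall j, ends_in (g' j)),
        (forall i v, v \in vs -> ~ interior_of (g' i) v) &
        forall x, exists j, exists2 t : R, 0 <= t <= 1 & x = g' j t].
Proof.
move=> Vvs eg Vg cg; elim: vs Vvs => [|v vs IH] Vvs; first by exists J, g.
have [|J1 [g1 [eg1 Vg1 ng1 cg1]]] := IH.
  by move=> w wvs; apply: Vvs; rewrite inE wvs orbT.
have [|J2 [g2 [eg2 Vg2 ng2 cg2]]] := @split_arcs J1 g1 v _ eg1 Vg1.
  by apply: Vvs; rewrite inE eqxx.
exists J2, g2; split=> //.
- move=> i w; rewrite inE => /orP[/eqP->|wvs]; have [j sub nv] := ng2 i => //.
  by move=> /sub; exact: ng1.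
- move=> x; have [j [t t01 ->]] := cg1 x.
  by have [i [s s01 e]] := cg2 j t t01; exists i, s.
Qed.

Lemma arc_image_closed g : embedded_arc g -> closed (g @` [set t | 0 <= t <= 1]).
Proof.
move=> eg; apply: compact_closed; first exact: space_hausdorff.
have -> : [set t : R | 0 <= t <= 1] = `[0, 1]%classic.
  by apply/seteqP; split=> t; rewrite /= in_itv.
apply: continuous_compact; last exact: segment_compact.
by apply: continuous_subspaceT; exact: earc_continuous.
Qed.

(** The parameters that [g] sends into the interior of [h] form an open subset of the connected
    interval [(0, 1)]. It is also closed there: the interior of [g] avoids [V], hence the ends of
    [h], so it meets the closed image of [h] only in its interior. *)
Lemma cell_sub g h x : cell g -> cell h -> interior_of g x -> interior_of h x ->
  interior_of g `<=` interior_of h.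
Proof.
move=> [eg Vg ng] [eh [Vh0 Vh1] nh] [r r01 rx] hx.
pose I01 : set R := [set t | 0 < t < 1].
have cI : connected I01.
  apply/connected_intervalP => s t + + u; rewrite /I01 /=; lra.
have := cI (I01 `&` g @^-1` interior_of h) _ _ _.
have hE s : I01 s -> (h @` [set t | 0 <= t <= 1]) (g s) -> interior_of h (g s).
  move=> s01 [t /= t01 ts].
  have ngs : ~ V (g s) by move=> /ng; apply; exists s.
  have [t0|t0] := eqVneq t 0; first by case: ngs; rewrite -ts t0.
  have [t1|t1] := eqVneq t 1; first by case: ngs; rewrite -ts t1.
  by exists t => //=; move/eqP: t0; move/eqP: t1; lra.
move=> H _ [s s01 <-].
have {H} : I01 `&` g @^-1` interior_of h = I01.
  apply: H.
  - by exists r; split=> //=; rewrite rx.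
  - exists (g @^-1` interior_of h) => //; apply: open_comp; last exact: earc_open.
    by move=> t _; exact: (earc_continuous eg).
  - exists (g @^-1` (h @` [set t | 0 <= t <= 1])).
      apply: preimage_closed; last exact: arc_image_closed.
      by move=> t _; exact: (earc_continuous eg).
    apply/seteqP; split=> t [t01]; last by move=> /(hE t t01).
    by move=> [u u01 e]; split=> //; exists u => //=; move: u01 => /=; lra.
by move=> /seteqP[_ /(_ s s01)[]].
Qed.

Lemma closed_arc_closure g (C : set M) : continuous g -> closed C ->
  interior_of g `<=` C -> forall t : R, 0 <= t <= 1 -> C (g t).
Proof.
move=> cg cC gC t t01; apply: contrapT => nC.
have : nbhs t (g @^-1` (~` C)).
  apply: (cg t); apply: open_nbhs_nbhs; split=> //; exact: closed_openC.
move=> /nbhs_realP[e e0 eP].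
have inC s : 0 < s < 1 -> `|s - t| < e -> False.
  by move=> s01 /eP; apply; apply: gC; exists s.
have [m [m0 me m1]] : exists m : R, [/\ 0 < m, m < e & m < 1/2].
  by case: (leP e (1/2)) => h; [exists (e / 2)|exists (1 / 4)]; split; lra.
have [th|th] := leP t (1/2).
  by apply: (inC (t + m)); [lra|rewrite addrAC subrr add0r gtr0_norm].
by apply: (inC (t - m)); [lra|rewrite addrAC subrr add0r normrN gtr0_norm].
Qed.

End Cells.

(** Near a common starting point both arcs take all chart values slightly above
    that of the point. *)
Lemma embedded_arcs_start (R : realType) (M : omanifold R) (g h : R -> M) :
  embedded_arc g -> embedded_arc h -> g 0 = h 0 ->
  exists2 x, interior_of g x & interior_of h x.
Proof.
move=> eg eh gh; have [c Ac cx] := atlas_cover (g 0).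
have [oc injc cc im] := atlas_chart Ac.
have h00 : 0 <= (0 : R) <= 1 by lra.
have key f : embedded_arc f -> f 0 = g 0 -> exists2 s, 0 < s < 1 &
    (chart_map c (g 0) < chart_map c (f s) /\ forall w, chart_map c (g 0) < w ->
      w <= chart_map c (f s) -> exists2 u, 0 < u < 1 & chart_dom c (f u) /\ chart_map c (f u) = w).
  move=> ef fg; have [|e e0 eP] := chart_arc (earc_continuous ef) (earc_increasing ef Ac) Ac h00.
    by rewrite fg.
  have [m [m0 me m1]] : exists m : R, [/\ 0 < m, m < e & m < 1/2].
    by case: (leP e (1/2)) => h'; [exists (e / 2)|exists (1 / 4)]; split; lra.
  have inc : chart_map c (g 0) < chart_map c (f m).
    have [||||_ _] := eP 0 m; rewrite ?subrr ?normr0 ?subr0 ?gtr0_norm //; try lra.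
    by rewrite fg; exact.
  have domf u : 0 <= u <= m -> chart_dom c (f u).
    move=> um; have [||||//] := eP u u; try lra; rewrite subr0 ltr_norml; lra.
  exists m; first lra; split=> // w w1 w2.
  have [|||u] := @IVT R (chart_map c \o f) 0 m w.
  - lra.
  - apply: continuous_in_subspaceT => u; rewrite inE /= in_itv /= => um.
    apply: continuous_comp; first exact: (earc_continuous ef).
    by apply: cc; exact: domf.
  - by rewrite /= fg ge_min le_max (ltW w1) w2 orbT.
  rewrite in_itv /= => um fu; exists u; last by split=> //; exact: domf.
  have [u0|u0] := eqVneq u 0; first by move: w1; rewrite -fu u0 fg ltxx.
  by move/eqP: u0; lra.
have [s s01 [gs gw]] := key g eg erefl.
have [s' s'01 [hs hw]] := key h eh (esym gh).
pose w := Num.min (chart_map c (g s)) (chart_map c (h s')).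
have w0 : chart_map c (g 0) < w by rewrite lt_min gs.
have [|u u01 [du wu]] := gw w w0; first by rewrite ge_min lexx.
have [|v v01 [dv wv]] := hw w w0; first by rewrite ge_min lexx orbT.
exists (g u); first by exists u.
exists v => //; apply: injc; rewrite ?inE //.
by rewrite wu wv.
Qed.

Lemma embedded_arc_oreverse (R : realType) (M : omanifold R) (g : R -> M) :
  embedded_arc g -> embedded_arc (fun t => g (1 - t) : oreverse M).
Proof.
move=> eg; split.
- move=> t; apply: (@cvg_comp _ _ _ (fun t => 1 - t) g _ (nbhs (1 - t))).
    by apply: cvgB; [exact: cvg_cst|exact: cvg_id].
  exact: (earc_continuous eg).
- by move=> s t s01 t01 /(earc_inj eg) H; have : 1 - s = 1 - t by [apply: H; lra]; lra.
- move=> _ [c Ac <-]; exact: flip_increasing_along (earc_increasing eg Ac).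
- rewrite (_ : _ @` _ = g @` [set t | 0 < t < 1]); first exact: (earc_open eg).
  apply/seteqP; split=> _ [t /= t01 <-]; exists (1 - t) => //=; rewrite ?subKr //; lra.
Qed.

Lemma embedded_arcs_end (R : realType) (M : omanifold R) (g h : R -> M) :
  embedded_arc g -> embedded_arc h -> g 1 = h 1 ->
  exists2 x, interior_of g x & interior_of h x.
Proof.
move=> /embedded_arc_oreverse eg /embedded_arc_oreverse eh gh.
have [|x [s /= s01 sx] [t /= t01 tx]] := embedded_arcs_start eg eh.
  by rewrite /= subr0.
by exists x; [exists (1 - s)|exists (1 - t)] => //=; lra.
Qed.

(** Take finitely many chart arcs covering [M] and subdivide them at the set [V] of
    all their ends. By connectedness, two of the resulting arcs whose interiors meet
    have the same interior, so it remains to discard repetitions. *)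
Theorem decomposition (R : realType) (M : omanifold R) :
  exists (J : finType) (q : J -> R -> M), decomp q.
Proof.
have [J0 [g0 [eg0 cg0]]] := embedded_arcs_cover M.
pose vs : seq M := [seq g0 j 0 | j <- enum J0] ++ [seq g0 j 1 | j <- enum J0].
pose V : set M := [set x | x \in vs].
have [||J [g [eg Vg ng cg]]] := @split_arcs_seq R M V vs J0 g0 _ eg0 _ cg0.
- by [].
- move=> j; split; rewrite /V /= mem_cat; apply/orP; [left|right];
    by apply/mapP; exists j; rewrite ?mem_enum.
have cell_g j : cell V (g j) by split=> // x; exact: ng.
have same i j x : interior_of (g i) x -> interior_of (g j) x ->
    interior_of (g i) = interior_of (g j).
  by move=> ix jx; apply/seteqP; split; apply: cell_sub ix jx || apply: cell_sub jx ix.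
pose sameb i j := `[< interior_of (g j) = interior_of (g i) >].
(* A representative among the arcs with the same interior. The predicate depends only on that
   interior, so equal interiors yield the same choice; the default is never reached, as [j] itself
   qualifies. *)
pose r j := odflt j [pick i | sameb j i].
have rP j : interior_of (g (r j)) = interior_of (g j).
  by rewrite /r; case: pickP => // i /asboolP.
have rE i j : interior_of (g i) = interior_of (g j) -> r i = r j.
  move=> ij; rewrite /r (_ : [pick k | sameb i k] = [pick k | sameb j k]).
    by case: pickP => // /(_ j); rewrite /sameb asboolT.
  by apply: eq_pick => k; rewrite /sameb ij.
exists {j : J | r j == j}, (fun j => g (val j)).
have uniq_g (i j : {j : J | r j == j}) x :
    interior_of (g (val i)) x -> interior_of (g (val j)) x -> i = j.
  move=> ix jx; apply: val_inj; rewrite -(eqP (valP i)) -(eqP (valP j)).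
  exact/rE/(same _ _ x).
split; last by move=> c j Ac; exact: (earc_increasing (eg _) Ac).
split.
- by move=> j; exact: (earc_continuous (eg _)).
- move=> i j s t s01 t01 e.
  suff ij : i = j.
    by split=> //; move: e; rewrite ij => /(earc_inj (eg _)); apply; lra.
  (* Arcs with a common start have interiors that meet, and a start lies in no interior because
     every arc was cut at all vertices. *)
  have [s0|s0] := eqVneq s 0; have [t0|t0] := eqVneq t 0.
  + have [|x] := embedded_arcs_start (eg (val i)) (eg (val j)); first by rewrite -{1}s0 -t0.
    exact: uniq_g.
  + have [Vi _] := Vg (val i); case: (ng (val j) _ Vi); exists t; last by rewrite -e s0.
    by move/eqP: t0 => /=; lra.
  + have [Vi _] := Vg (val j); case: (ng (val i) _ Vi); exists s; last by rewrite e t0.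
    by move/eqP: s0 => /=; lra.
  + apply: (uniq_g _ _ (g (val i) s)); [exists s|exists t] => //=;
      by move/eqP: s0; move/eqP: t0; lra.
- move=> i j s t s01 t01 e.
  suff ij : i = j.
    by split=> //; move: e; rewrite ij => /(earc_inj (eg _)); apply; lra.
  have [s0|s0] := eqVneq s 1; have [t0|t0] := eqVneq t 1.
  + have [|x] := embedded_arcs_end (eg (val i)) (eg (val j)); first by rewrite -{1}s0 -t0.
    exact: uniq_g.
  + have [_ Vi] := Vg (val i); case: (ng (val j) _ Vi); exists t; last by rewrite -e s0.
    by move/eqP: t0 => /=; lra.
  + have [_ Vi] := Vg (val j); case: (ng (val i) _ Vi); exists s; last by rewrite e t0.
    by move/eqP: s0 => /=; lra.
  + apply: (uniq_g _ _ (g (val i) s)); [exists s|exists t] => //=;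
      by move/eqP: s0; move/eqP: t0; lra.
- move=> x; have [j [t t01 ->]] := cg x.
  have rj : r (r j) == r j by apply/eqP/rE/rP.
  (* The representative has the same interior and a closed image, so it also contains the ends of
     [g j]. *)
  have : (g (r j) @` [set t | 0 <= t <= 1]) (g j t).
    apply: closed_arc_closure t01; first exact: (earc_continuous (eg _)).
      exact: arc_image_closed.
    rewrite -rP => _ [s s01 <-]; exists s => //=; move: s01 => /=; lra.
  by move=> [s s01 e]; exists (exist _ (r j) rj), s.
Qed.

(** * Cobordisms from arcs *)

Lemma inj_surj_bij (T U : Type) (f : T -> U) :
  injective f -> (forall y, exists x, f x = y) -> bijective f.
Proof.
by move=> injf /choice[g gK]; exists g => // x; apply: injf; rewrite gK.
Qed.

Lemma end_of_inj (R : realType) : injective (@end_of R).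
Proof. by case=> -[] // /eqP; rewrite /end_of ?oner_eq0 // eq_sym oner_eq0. Qed.

Section BoundaryPoints.
Variables (R : realType) (a b : word).

(** The boundary points of a cobordism from [a] to [b], with their signs in the
    boundary of the manifold: outgoing letters are flipped. *)
Definition bd : finType := ('I_(size a) + 'I_(size b))%type.

Definition bsign (x : bd) : bool :=
  match x with inl i => letter i | inr j => ~~ letter j end.

Definition bpt (K : cob R a b) (x : bd) : K :=
  match x with inl i => inp K i | inr j => out K j end.

Lemma bpt_inj (K : cob R a b) : injective (bpt K).
Proof.
move=> [i|j] [i'|j'] /= e; first by rewrite (inp_inj e).
- by case: (inp_out_disjoint e).
- by case: (inp_out_disjoint (esym e)).
- by rewrite (out_inj e).
Qed.

Lemma bpt_sign (K : cob R a b) x : boundary_sign (bsign x) (bpt K x).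
Proof. by case: x => i; [exact: inp_sign|exact: out_sign]. Qed.

Lemma bpt_cover (K : cob R a b) s (p : K) : boundary_sign s p -> exists x, p = bpt K x.
Proof.
move=> sp; have : initial_point p \/ terminal_point p by case: s sp; [left|right].
by move=> /boundary_cover[[i ->]|[j ->]]; [exists (inl i)|exists (inr j)].
Qed.

Section MakeCob.
Variables (M : omanifold R) (p : bd -> M).
Hypothesis p_inj : injective p.
Hypothesis p_sign : forall x, boundary_sign (bsign x) (p x).
Hypothesis p_cover : forall s (z : M), boundary_sign s z -> exists x, z = p x.

Lemma make_inp_inj : injective (fun i => p (inl i)).
Proof. by move=> i j /p_inj[]. Qed.

Lemma make_out_inj : injective (fun i => p (inr i)).
Proof. by move=> i j /p_inj[]. Qed.

Lemma make_disjoint i j : p (inl i) <> p (inr j).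
Proof. by move=> /p_inj. Qed.

Lemma make_cover z : initial_point z \/ terminal_point z ->
  (exists i, z = p (inl i)) \/ (exists j, z = p (inr j)).
Proof.
by move=> [/(@p_cover true)|/(@p_cover false)] [[i|j] ->];
  [left; exists i|right; exists j|left; exists i|right; exists j].
Qed.

Definition make_cob : cob R a b :=
  Cob make_inp_inj make_out_inj make_disjoint (fun i => p_sign (inl i))
    (fun j => p_sign (inr j)) make_cover.

Lemma bpt_make_cob x : bpt make_cob x = p x.
Proof. by case: x. Qed.

End MakeCob.

End BoundaryPoints.

(** The two maps given by [decomp_map] preserve arc and parameter, so they are mutually inverse. *)
Lemma cob_equiv_decomp (R : realType) (a b : word) (K L : cob R a b) (J : finType)
    (qK : J -> R -> K) (qL : J -> R -> L) :
  decomp qK -> decomp qL ->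
  (forall i j, qK i 1 = qK j 0 <-> qL i 1 = qL j 0) ->
  (forall x j, bpt K x = qK j (end_of R (bsign x)) -> bpt L x = qL j (end_of R (bsign x))) ->
  cob_equiv K L.
Proof.
move=> dK dL g bp.
have [f [cf of_ fq]] := decomp_map dK dL (phi := id) (fun i j => (g i j).1).
have [h [ch oh hq]] := decomp_map dL dK (phi := id) (fun i j => (g i j).2).
have fb x : f (bpt K x) = bpt L x.
  have [j e] := boundary_sign_arc dK (bpt_sign K x).
  by rewrite (bp x j e) e fq // end_of_itv.
exists f, h; split=> //.
- split=> x.
    by have [j [t t01 ->]] := arc_cover dK x; rewrite fq // hq.
  by have [j [t t01 ->]] := arc_cover dL x; rewrite hq // fq.
- by move=> i; exact: (fb (inl i)).
- by move=> j; exact: (fb (inr j)).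
Qed.

(** An end of an arc lies on the boundary exactly when no arc continues it. Passing from [K] to [N],
    it therefore stays on the boundary unless an arc outside [K] is attached to it. *)
Lemma boundary_sign_embed (R : realType) (K N : omanifold R) (J J' : finType)
    (qK : J -> R -> K) (q : J' -> R -> N) (k : K -> N) (e : J -> J') :
  decomp qK -> decomp q -> injective k ->
  (forall j t, 0 <= t <= 1 -> q (e j) t = k (qK j t)) ->
  forall s x, boundary_sign s (k x) <->
    boundary_sign s x /\
    forall j, (forall i, j <> e i) -> q j (end_of R (~~ s)) <> k x.
Proof.
move=> dK dN injk qe s x; have [i [t t01 ->]] := arc_cover dK x.
rewrite -qe //; split.
  move=> sx; have te := boundary_arc dN t01 sx; move: sx; rewrite te.
  move=> /(boundary_signP dN) sx; split; last by move=> j _; exact: sx.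
  apply/(boundary_signP dK) => i' ei; apply: (sx (e i')).
  by rewrite !qe ?end_of_itv // ei.
move=> [sx n]; have te := boundary_arc dK t01 sx; move: sx n; rewrite te.
move=> /(boundary_signP dK) sx n; apply/(boundary_signP dN) => j.
have [[i' ->]|ne] := pselect (exists i', j = e i').
  by rewrite !qe ?end_of_itv // => /injk; exact: sx.
by apply: n => i' ji; apply: ne; exists i'.
Qed.

(** The arcs of both manifolds are glued anew, along the old adjacencies together with [glue].
    Opposite signs make an end meet a start, and a boundary point has no successor or predecessor in
    its own manifold, so adjacency remains a partial injection. *)
Lemma amalgam_exists (R : realType) (K L : omanifold R) (JK JL : finType)
    (qK : JK -> R -> K) (qL : JL -> R -> L) (glue : K -> L -> Prop) :
  decomp qK -> decomp qL ->
  (forall x y, glue x y -> exists s, boundary_sign s x /\ boundary_sign (~~ s) y) ->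
  (forall x y y', glue x y -> glue x y' -> y = y') ->
  (forall x x' y, glue x y -> glue x' y -> x = x') ->
  exists (N : omanifold R) (k : K -> N) (l : L -> N) (q : JK + JL -> R -> N),
    [/\ amalgam glue k l, decomp q,
        (forall j t, 0 <= t <= 1 -> q (inl j) t = k (qK j t)),
        (forall j t, 0 <= t <= 1 -> q (inr j) t = l (qL j t)) &
        (forall s x, boundary_sign s (k x) <->
           boundary_sign s x /\ ~ exists y, glue x y) /\
        (forall s y, boundary_sign s (l y) <->
           boundary_sign s y /\ ~ exists x, glue x y)].
Proof.
move=> dK dL gs gr gl.
have h0 : 0 <= (0 : R) <= 1 by lra.
have h1 : 0 <= (1 : R) <= 1 by lra.
have sgn x y s : glue x y -> boundary_sign s x -> boundary_sign (~~ s) y.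
  by move=> /gs[s' [s'x s'y]] sx; rewrite (boundary_sign_uniq dK sx s'x).
have sgn' x y s : glue x y -> boundary_sign s y -> boundary_sign (~~ s) x.
  by move=> /gs[s' [s'x s'y]] sy; rewrite (boundary_sign_uniq dL sy s'y) negbK.
have gK i y : glue (qK i 1) y -> boundary_sign false (qK i 1).
  move=> /gs[s [sx _]]; have := boundary_arc dK h1 sx.
  by move=> /(@end_of_inj R false) ->.
have gK0 i y : glue (qK i 0) y -> boundary_sign true (qK i 0).
  move=> /gs[s [sx _]]; have := boundary_arc dK h0 sx.
  by move=> /(@end_of_inj R true) ->.
have gL x i : glue x (qL i 1) -> boundary_sign false (qL i 1).
  move=> /gs[s [_ sx]]; have := boundary_arc dL h1 sx.
  by move=> /(@end_of_inj R false) ->.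
have gL0 x i : glue x (qL i 0) -> boundary_sign true (qL i 0).
  move=> /gs[s [_ sx]]; have := boundary_arc dL h0 sx.
  by move=> /(@end_of_inj R true) ->.
pose nxt (i j : JK + JL) : Prop := match i, j with
  | inl i, inl j => qK i 1 = qK j 0
  | inr i, inr j => qL i 1 = qL j 0
  | inl i, inr j => glue (qK i 1) (qL j 0)
  | inr i, inl j => glue (qK j 0) (qL i 1)
  end.
have injK0 i j : qK i 0 = qK j 0 -> i = j by exact: (arc_start_inj dK).
have injK1 i j : qK i 1 = qK j 1 -> i = j by exact: (arc_end_inj dK).
have injL0 i j : qL i 0 = qL j 0 -> i = j by exact: (arc_start_inj dL).
have injL1 i j : qL i 1 = qL j 1 -> i = j by exact: (arc_end_inj dL).
have nKf i j : boundary_sign false (qK i 1) -> qK i 1 <> qK j 0.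
  by move=> /(boundary_signP dK false i)/(_ j) n e; exact: (n (esym e)).
have nKt i j : boundary_sign true (qK j 0) -> qK i 1 <> qK j 0.
  by move=> /(boundary_signP dK true j)/(_ i).
have nLf i j : boundary_sign false (qL i 1) -> qL i 1 <> qL j 0.
  by move=> /(boundary_signP dL false i)/(_ j) n e; exact: (n (esym e)).
have nLt i j : boundary_sign true (qL j 0) -> qL i 1 <> qL j 0.
  by move=> /(boundary_signP dL true j)/(_ i).
have [||N [q [dq qn]]] := @decomp_exists R _ nxt.
- move=> [i|i] [j|j] [j'|j'] //=.
  + by move=> -> /injK0->.
  + by move=> e /gK/nKf/(_ e).
  + by move=> /gK/nKf n e; case: (n _ e).
  + by move=> g g'; rewrite (injL0 _ _ (gr _ _ _ g g')).
  + by move=> g g'; rewrite (injK0 _ _ (gl _ _ _ g g')).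
  + by move=> /gL/nLf n e; case: (n _ e).
  + by move=> e /gL/nLf/(_ e).
  + by move=> -> /injL0->.
- move=> [i|i] [i'|i'] [j|j] //=.
  + by move=> <- /esym/injK1->.
  + by move=> g g'; rewrite (injK1 _ _ (gl _ _ _ g g')).
  + by move=> e /gK0/nKt/(_ e).
  + by move=> /gL0/nLt n e; case: (n _ e).
  + by move=> /gK0/nKt n e; case: (n _ e).
  + by move=> e /gL0/nLt/(_ e).
  + by move=> g g'; rewrite (injL1 _ _ (gr _ _ _ g g')).
  + by move=> <- /esym/injL1->.
have [|k [ck ok kq]] := @decomp_map R K N _ _ qK q inl dK dq.
  by move=> i j e; apply/qn.
have [|l [cl ol lq]] := @decomp_map R L N _ _ qL q inr dL dq.
  by move=> i j e; apply/qn.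
have injk : injective k.
  move=> x y; have [i [s s01 ->]] := arc_cover dK x; have [j [t t01 ->]] := arc_cover dK y.
  rewrite !kq // => /(arc_eq dq s01 t01)[[[->] ->]//|[-> -> /qn//]|[-> -> /qn//]].
have injl : injective l.
  move=> x y; have [i [s s01 ->]] := arc_cover dL x; have [j [t t01 ->]] := arc_cover dL y.
  rewrite !lq // => /(arc_eq dq s01 t01)[[[->] ->]//|[-> -> /qn//]|[-> -> /qn//]].
have klg x y : k x = l y <-> glue x y.
  split.
    have [i [s s01 ->]] := arc_cover dK x; have [j [t t01 ->]] := arc_cover dL y.
    rewrite kq // lq // => /(arc_eq dq s01 t01)[[]//|[-> -> /qn//]|[-> -> /qn//]].
  move=> g; have [[] [sx sy]] := gs _ _ g.
    have [i ei] := boundary_sign_arc dK sx; have [j ej] := boundary_sign_arc dL sy.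
    rewrite ei ej /end_of /= kq // lq //; apply/esym/qn => /=.
    by move: g; rewrite ei ej.
  have [i ei] := boundary_sign_arc dK sx; have [j ej] := boundary_sign_arc dL sy.
  rewrite ei ej /end_of /= kq // lq //; apply/qn => /=.
  by move: g; rewrite ei ej.
exists N, k, l, q; split=> //.
- split=> //.
  + move=> z; have [[j|j] [t t01 ->]] := arc_cover dq z.
      by left; exists (qK j t); rewrite kq.
    by right; exists (qL j t); rewrite lq.
  + move=> U; split=> [oU|[oU1 oU2]].
      by split; apply: open_comp.
    rewrite -[U]setCK; apply: closed_openC.
    apply: (closed_arcs (@space_hausdorff R N) dq) => -[] j.
      rewrite (_ : mkset _ = `[0, 1]%classic `&` qK j @^-1` (k @^-1` (~` U))).
        apply: closedI; first exact: itv_closed.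
        apply: preimage_closed => [t _|]; first exact: (arc_continuous dK).
        by rewrite preimage_setC; exact: open_closedC.
      by apply/seteqP; split=> t; rewrite /= in_itv /= => -[t01]; rewrite kq.
    rewrite (_ : mkset _ = `[0, 1]%classic `&` qL j @^-1` (l @^-1` (~` U))).
      apply: closedI; first exact: itv_closed.
      apply: preimage_closed => [t _|]; first exact: (arc_continuous dL).
      by rewrite preimage_setC; exact: open_closedC.
    by apply/seteqP; split=> t; rewrite /= in_itv /= => -[t01]; rewrite lq.
- by move=> j t t01; rewrite kq.
- by move=> j t t01; rewrite lq.
have kqe j t : 0 <= t <= 1 -> q (inl j) t = k (qK j t) by move=> t01; rewrite kq.
have lqe j t : 0 <= t <= 1 -> q (inr j) t = l (qL j t) by move=> t01; rewrite lq.
split=> s z; [rewrite (boundary_sign_embed dK dq injk kqe)|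
              rewrite (boundary_sign_embed dL dq injl lqe)].
- split=> -[sz n]; split=> //.
    move=> [y g]; have [j ej] := boundary_sign_arc dL (sgn _ _ _ g sz).
    by apply: (n (inr j)) => //; rewrite lqe ?end_of_itv // -ej; apply/esym/klg.
  move=> [j /(_ j)//|j _]; rewrite lqe ?end_of_itv // => /esym/klg g.
  by apply: n; exists (qL j (end_of R (~~ s))).
- split=> -[sz n]; split=> //.
    move=> [y g]; have [j ej] := boundary_sign_arc dK (sgn' _ _ _ g sz).
    by apply: (n (inl j)) => //; rewrite kqe ?end_of_itv // -ej; apply/klg.
  move=> [j _|j /(_ j)//]; rewrite kqe ?end_of_itv // => /klg g.
  by apply: n; exists (qK j (end_of R (~~ s))).
Qed.

(** The decomposition of the composite consists of the arcs of both factors, not yet merged, so that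
    arcs can be followed through iterated composites. *)
Lemma comp_exists (R : realType) (a b c : word) (K : cob R a b) (L : cob R b c)
    (JK JL : finType) (qK : JK -> R -> K) (qL : JL -> R -> L) :
  decomp qK -> decomp qL ->
  exists (N : cob R a c) (k : K -> N) (l : L -> N) (q : JK + JL -> R -> N),
    [/\ amalgam (fun x y => exists p, x = out K p /\ y = inp L p) k l,
        (forall i, inp N i = k (inp K i)) /\ (forall j, out N j = l (out L j)),
        decomp q,
        (forall j t, 0 <= t <= 1 -> q (inl j) t = k (qK j t)) &
        (forall j t, 0 <= t <= 1 -> q (inr j) t = l (qL j t))].
Proof.
move=> dK dL.
pose glue x y := exists p, x = out K p /\ y = inp L p.
have [|||N [k [l [q [am dq kq lq [sk sl]]]]]] := @amalgam_exists R K L _ _ _ _ glue dK dL.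
- move=> _ _ [p [-> ->]]; exists (~~ letter p); split; first exact: out_sign.
  by rewrite negbK; exact: inp_sign.
- by move=> _ _ _ [p [-> ->]] [p' [/out_inj <- ->]].
- by move=> _ _ _ [p [-> ->]] [p' [-> /inp_inj <-]].
pose f (x : bd a c) : N := match x with inl i => k (inp K i) | inr j => l (out L j) end.
have f_inj : injective f.
  move=> [i|j] [i'|j'] //=.
  - by move=> /(amalgam_injl am)/inp_inj->.
  - by move=> /(amalgam_glue am)[p [/inp_out_disjoint]].
  - by move=> /esym/(amalgam_glue am)[p [/inp_out_disjoint]].
  - by move=> /(amalgam_injr am)/out_inj->.
have f_sign x : boundary_sign (bsign x) (f x).
  case: x => i /=.
    apply/sk; split; first exact: inp_sign.
    by move=> [y [p [/inp_out_disjoint]]].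
  apply/sl; split; first exact: out_sign.
  by move=> [y [p [_ /esym/inp_out_disjoint]]].
have f_cover s (z : N) : boundary_sign s z -> exists x, z = f x.
  have [[x ->]|[y ->]] := amalgam_surj am z.
    move=> /sk[/bpt_cover[[i|j] ->] n]; first by exists (inl i).
    by case: n; exists (inp L j), j.
  move=> /sl[/bpt_cover[[i|j] ->] n]; last by exists (inr j).
  by case: n; exists (out K i), i.
by exists (make_cob f_inj f_sign f_cover), k, l, q.
Qed.

Lemma letterE (a : word) (i : 'I_(size a)) : letter i = nth false a i.
Proof. by rewrite /letter (tnth_nth false). Qed.

Section CatOrd.
Variables (a b : word).

Lemma cat_ord_cases (i : 'I_(size (a ++ b))) :
  (exists2 i' : 'I_(size a), i = i' :> nat & letter i' = letter i) \/
  (exists2 i' : 'I_(size b), i = (size a + i')%N :> nat & letter i' = letter i).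
Proof.
have := ltn_ord i; rewrite {2}size_cat => ia.
have [h|h] := ltnP i (size a).
  by left; exists (Ordinal h) => //; rewrite !letterE nth_cat h.
right; have h' : (i - size a < size b)%N by rewrite ltn_subLR.
by exists (Ordinal h'); rewrite /= ?subnKC // !letterE nth_cat ltnNge h.
Qed.

Lemma cat_ordl (i' : 'I_(size a)) : exists i : 'I_(size (a ++ b)), i = i' :> nat.
Proof.
have h : (i' < size (a ++ b))%N by rewrite size_cat ltn_addr.
by exists (Ordinal h).
Qed.

Lemma cat_ordr (i' : 'I_(size b)) :
  exists i : 'I_(size (a ++ b)), i = (size a + i')%N :> nat.
Proof.
have h : (size a + i' < size (a ++ b))%N by rewrite size_cat ltn_add2l.
by exists (Ordinal h).
Qed.

End CatOrd.

Section CatBd.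
Variables (a b a' b' : word).

(** Boundary points of a concatenation are matched by comparing natural numbers, because
    [size (a ++ b)] is not convertible to the sum of the sizes. *)
Definition bd_left (x : bd (a ++ b) (a' ++ b')) (y : bd a a') : Prop :=
  match x, y with
  | inl i, inl i' => i = i' :> nat
  | inr j, inr j' => j = j' :> nat
  | _, _ => False
  end.

Definition bd_right (x : bd (a ++ b) (a' ++ b')) (y : bd b b') : Prop :=
  match x, y with
  | inl i, inl i' => i = (size a + i')%N :> nat
  | inr j, inr j' => j = (size a' + j')%N :> nat
  | _, _ => False
  end.

Lemma bd_cases x :
  (exists2 y, bd_left x y & bsign y = bsign x) \/
  (exists2 y, bd_right x y & bsign y = bsign x).
Proof.
case: x => i; have [[j ij lj]|[j ij lj]] := cat_ord_cases i.
- by left; exists (inl j).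
- by right; exists (inl j).
- by left; exists (inr j) => //=; rewrite lj.
- by right; exists (inr j) => //=; rewrite lj.
Qed.

Lemma bd_left_ex y : exists x, bd_left x y.
Proof.
by case: y => j; [have [i ij] := cat_ordl b j; exists (inl i)|
                  have [i ij] := cat_ordl b' j; exists (inr i)].
Qed.

Lemma bd_right_ex y : exists x, bd_right x y.
Proof.
by case: y => j; [have [i ij] := cat_ordr a j; exists (inl i)|
                  have [i ij] := cat_ordr a' j; exists (inr i)].
Qed.

Lemma bd_left_inj x x' y : bd_left x y -> bd_left x' y -> x = x'.
Proof.
by case: x x' y => [i|i] [i'|i'] [j|j] //= e e'; congr (_ _); apply: val_inj;
  rewrite /= e e'.
Qed.

Lemma bd_right_inj x x' y : bd_right x y -> bd_right x' y -> x = x'.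
Proof.
by case: x x' y => [i|i] [i'|i'] [j|j] //= e e'; congr (_ _); apply: val_inj;
  rewrite /= e e'.
Qed.

Lemma bd_left_fun x y y' : bd_left x y -> bd_left x y' -> y = y'.
Proof.
by case: x y y' => [i|i] [j|j] [j'|j'] //= e e'; congr (_ _); apply: val_inj;
  rewrite /= -e -e'.
Qed.

Lemma bd_right_fun x y y' : bd_right x y -> bd_right x y' -> y = y'.
Proof.
by case: x y y' => [i|i] [j|j] [j'|j'] //= e e'; congr (_ _); apply: val_inj;
  apply/eqP; rewrite -(eqn_add2l (size a)) -(eqn_add2l (size a')) /=;
  move: e e' => -> /eqP; rewrite !eqn_add2l.
Qed.

Lemma bd_left_right x y z : bd_left x y -> bd_right x z -> False.
Proof.
by case: x y z => [i|i] [j|j] [k|k] //= -> e; have := ltn_ord j;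
  rewrite e ltnNge leq_addr.
Qed.

End CatBd.

Lemma tensor_exists (R : realType) (a b a' b' : word) (K : cob R a a') (L : cob R b b')
    (JK JL : finType) (qK : JK -> R -> K) (qL : JL -> R -> L) :
  decomp qK -> decomp qL ->
  exists (N : cob R (a ++ b) (a' ++ b')) (k : K -> N) (l : L -> N) (q : JK + JL -> R -> N),
    [/\ is_tensor K L N,
        (forall x y, bd_left x y -> bpt N x = k (bpt K y)) /\
        (forall x y, bd_right x y -> bpt N x = l (bpt L y)),
        decomp q,
        (forall j t, 0 <= t <= 1 -> q (inl j) t = k (qK j t)) &
        (forall j t, 0 <= t <= 1 -> q (inr j) t = l (qL j t))].
Proof.
move=> dK dL.
have [|||N [k [l [q [am dq kq lq [sk sl]]]]]] :=
  @amalgam_exists R K L _ _ _ _ (fun _ _ => False) dK dL; [by []..|].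
have /choice[f fP] : forall x : bd (a ++ b) (a' ++ b'), exists z : N,
    (exists2 y, bd_left x y & z = k (bpt K y) /\ bsign y = bsign x) \/
    (exists2 y, bd_right x y & z = l (bpt L y) /\ bsign y = bsign x).
  move=> x; have [[y xy sy]|[y xy sy]] := bd_cases x.
    by exists (k (bpt K y)); left; exists y.
  by exists (l (bpt L y)); right; exists y.
have fl x y : bd_left x y -> f x = k (bpt K y).
  move=> xy; have [[z xz [-> _]]|[z xz _]] := fP x; first by rewrite (bd_left_fun xy xz).
  by case: (bd_left_right xy xz).
have fr x y : bd_right x y -> f x = l (bpt L y).
  move=> xy; have [[z xz _]|[z xz [-> _]]] := fP x; last by rewrite (bd_right_fun xy xz).
  by case: (bd_left_right xz xy).
have f_inj : injective f.
  move=> x x'; have [[y xy [-> _]]|[y xy [-> _]]] := fP x;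
  have [[y' xy' [-> _]]|[y' xy' [-> _]]] := fP x'.
  - by move=> /(amalgam_injl am)/bpt_inj e; apply: (bd_left_inj xy); rewrite e.
  - by move=> /(amalgam_glue am).
  - by move=> /esym/(amalgam_glue am).
  - by move=> /(amalgam_injr am)/bpt_inj e; apply: (bd_right_inj xy); rewrite e.
have f_sign x : boundary_sign (bsign x) (f x).
  have [[y xy [-> <-]]|[y xy [-> <-]]] := fP x.
    by apply/sk; split; [exact: bpt_sign|case].
  by apply/sl; split; [exact: bpt_sign|case].
have f_cover s (z : N) : boundary_sign s z -> exists x, z = f x.
  have [[x ->]|[y ->]] := amalgam_surj am z.
    move=> /sk[/bpt_cover[y ->] _]; have [x' xy] := bd_left_ex b b' y.
    by exists x'; rewrite (fl _ _ xy).
  move=> /sl[/bpt_cover[y' ->] _]; have [x' xy] := bd_right_ex a a' y'.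
  by exists x'; rewrite (fr _ _ xy).
exists (make_cob f_inj f_sign f_cover), k, l, q; split=> //.
- exists k, l; split=> //.
  + by move=> i i' e; exact: (fl (inl i) (inl i')).
  + by move=> i i' e; exact: (fr (inl i) (inl i')).
  + by move=> i i' e; exact: (fl (inr i) (inr i')).
  + by move=> i i' e; exact: (fr (inr i) (inr i')).
- by split=> x y xy; rewrite bpt_make_cob; [exact: fl|exact: fr].
Qed.

(** The hypotheses say that the boundary points correspond to the pairs of an interval and a sign,
    that is, to the ends of disjoint intervals. Cups, caps, identities and the swap are obtained in
    this way. *)
Lemma arcs_cob_exists (R : realType) (a b : word) (J : finType) (arc : bd a b -> J) :
  injective (fun x => (arc x, bsign x)) ->
  (forall j s, exists x, arc x = j /\ bsign x = s) ->
  exists (N : cob R a b) (q : J -> R -> N), [/\ decomp q,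
    (forall x, bpt N x = q (arc x) (end_of R (bsign x))) &
    forall i j, q i 1 <> q j 0].
Proof.
move=> arc_inj arc_surj.
have [||M [q [dq qn]]] := @decomp_exists R J (fun _ _ => False); [by []..|].
have n i j : q i 1 <> q j 0 by move=> /qn.
pose f x := q (arc x) (end_of R (bsign x)).
have f_inj : injective f.
  move=> x y /(arc_eq dq (end_of_itv _ _) (end_of_itv _ _))[[e1 /end_of_inj e2]|[_ _ /n//]|[_ _ /n//]].
  by apply: arc_inj; rewrite /= e1 e2.
have f_sign x : boundary_sign (bsign x) (f x).
  apply/(boundary_signP dq) => i; case: (bsign x) => //= /esym; exact: n.
have f_cover s (z : M) : boundary_sign s z -> exists x, z = f x.
  move=> /(boundary_sign_arc dq)[j ->]; have [x [<- <-]] := arc_surj j s.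
  by exists x.
exists (make_cob f_inj f_sign f_cover), q; split=> // x.
by rewrite bpt_make_cob.
Qed.

Lemma arcs_strands (R : realType) (a b : word) (p : nat -> nat) (N : cob R a b)
    (q : 'I_(size a) -> R -> N) :
  decomp q -> (forall i j, q i 1 <> q j 0) ->
  (forall i, inp N i = q i (end_of R (letter i))) ->
  (forall (i : 'I_(size a)) (j : 'I_(size b)), j = p i :> nat ->
     out N j = q i (end_of R (~~ letter i))) ->
  is_strands p N.
Proof.
move=> dq n qi qo.
(* A strand runs from its ingoing to its outgoing end; at a negative letter this is against the
   orientation of the arc. *)
pose g (i : 'I_(size a)) (t : R) := q i (if letter i then t else 1 - t).
have gitv i (t : R) : 0 <= t <= 1 -> 0 <= (if @letter a i then t else 1 - t) <= 1.
  by case: ifP => _; lra.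
exists g; split.
- move=> i; apply: continuous_subspaceT => t; rewrite /g; case: (letter i).
    exact: (arc_continuous dq).
  apply: (@cvg_comp _ _ _ (fun t => 1 - t) (q i) _ (nbhs (1 - t))).
    by apply: cvgB; [exact: cvg_cst|exact: cvg_id].
  exact: (arc_continuous dq).
- move=> i j s t; rewrite /= !in_itv /= => s01 t01.
  move=> /(arc_eq dq (gitv i s s01) (gitv j t t01))[[->]|[_ _ /n//]|[_ _ /n//]].
  by case: ifP => _ e; split=> //; lra.
- move=> x; have [i [t t01 ->]] := arc_cover dq x; exists i.
  exists (if letter i then t else 1 - t); first by rewrite /= in_itv /=; exact: gitv.
  by rewrite /g; case: (letter i) => //; rewrite subKr.
- by move=> i; rewrite qi /g; case: ifP; rewrite /end_of ?subr0.
- by move=> i j /qo->; rewrite /g; case: ifP; rewrite /end_of ?subrr.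
Qed.

(** * Normal forms *)

Lemma card_eq_bij (A B : finType) : #|A| = #|B| -> exists f : A -> B, bijective f.
Proof.
move=> e; exists (fun x => enum_val (cast_ord e (enum_rank x))).
exists (fun y => enum_val (cast_ord (esym e) (enum_rank y))) => x.
  by rewrite enum_valK cast_ordK enum_rankK.
by rewrite enum_valK cast_ordKV enum_rankK.
Qed.

Lemma surj_card_bij (A B : finType) (f : A -> B) :
  #|A| = #|B| -> (forall y, exists x, f x = y) -> bijective f.
Proof.
move=> AB /choice[g gK]; have injg : injective g by exact: (can_inj gK).
have [h gh hg] : bijective g by apply: inj_card_bij; rewrite ?AB.
exists g => // x; by rewrite -{1}(hg x) gK hg.
Qed.

(** * Merging consecutive arcs *)

Section Reduction.
Variables (R : realType) (M : omanifold R).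

(** Nothing is left to merge: each arc is a whole component, an interval or a circle closing on
    itself. *)
Definition reduced (J : finType) (q : J -> R -> M) :=
  forall i j, q i 1 = q j 0 -> i = j.

Lemma merge_one (J : finType) (q : J -> R -> M) (i j : J) :
  decomp q -> q j 1 = q i 0 -> i != j ->
  exists (J' : finType) (q' : J' -> R -> M), decomp q' /\ (#|J'| < #|J|)%N.
Proof.
move=> dq ji ij; pose J' : finType := {x | x != j}.
pose h (x : unit + J') : J := match x with inl _ => j | inr y => val y end.
have bh : bijective h.
  apply: inj_surj_bij => [[[]|[x nx]] [[]|[y ny]]//= e|y].
  - by have := ny; rewrite -{1}e eqxx.
  - by have := nx; rewrite {1}e eqxx.
  - by congr inr; apply: val_inj.
  - have [->|yj] := eqVneq y j; first by exists (inl tt).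
    by exists (inr (exist _ y yj)).
have [||q' [dq' _ _ _]] := @decomp_merge _ _ unit J' (fun x => q (h x)) (fun=> exist _ i ij).
- exact: decomp_reindex.
- by [].
exists J', q'; split=> //; rewrite card_sig.
have := cardC1 j; rewrite (eq_card (B := predC1 j)) // => ->.
by rewrite prednK //; apply/card_gt0P; exists j.
Qed.

(** Each merging step loses an arc. The last clause records that the number of arcs survives only if
    there was nothing to merge, which gives the equality case of the circle count. *)
Lemma reduction (J : finType) (q : J -> R -> M) : decomp q ->
  exists (J' : finType) (q' : J' -> R -> M), [/\ decomp q', reduced q',
    (#|J'| <= #|J|)%N & #|J'| = #|J| -> reduced q].
Proof.
have [n] := ubnP #|J|; elim: n J q => // n IH J q /ltnSE Jn dq.
have [r|] := pselect (reduced q); first by exists J, q.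
move=> /existsNP[j /existsNP[i /not_implyP[ji /eqP nij]]].
have [|J1 [q1 [dq1 c1]]] := merge_one dq ji _; first by rewrite eq_sym.
have [|J2 [q2 [dq2 r2 c2 _]]] := IH J1 q1 _ dq1; first exact: leq_trans c1 Jn.
have c : (#|J2| < #|J|)%N := leq_ltn_trans c2 c1.
exists J2, q2; split=> //; first exact: ltnW.
by move=> e; move: c; rewrite e ltnn.
Qed.

Lemma chain_merge (n : nat) (q : 'I_n.+1 -> R -> M) : decomp q ->
  (forall i j : 'I_n.+1, j = i.+1 :> nat -> q i 1 = q j 0) ->
  exists q' : unit -> R -> M,
    [/\ decomp q', q' tt 0 = q ord0 0 & q' tt 1 = q ord_max 1].
Proof.
elim: n q => [|n IH] q dq cq.
  exists (fun=> q ord0); split=> //; last by congr (q _ _); apply: val_inj.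
  apply: (@decomp_reindex _ _ _ _ q (fun=> ord0)) => //.
  by exists (fun=> tt) => [[]|x]//; apply: val_inj; case: x => -[].
pose h (x : unit + 'I_n.+1) : 'I_n.+2 :=
  match x with inl _ => ord0 | inr i => lift ord0 i end.
have bh : bijective h.
  apply: inj_surj_bij => [[[]|x] [[]|y]//= e|y].
  - by congr inr; apply: (@lift_inj _ ord0).
  - have [->|/eqP y0] := eqVneq y ord0; first by exists (inl tt).
    have : ord0 != y by apply/eqP => e; apply: y0.
    by move=> /unlift_some[i -> _]; exists (inr i).
have [||q' [dq' q'1 q'0 q'n]] :=
    @decomp_merge _ _ unit 'I_n.+1 (fun x => q (h x)) (fun=> ord0).
- exact: decomp_reindex.
- by move=> _ /=; apply: cq.
have [|q'' [dq'' e0 e1]] := IH q' dq'.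
  move=> i j ij; rewrite q'1 q'n => [|_ j0]; last by move: ij; rewrite -j0.
  by apply: cq; rewrite /= /bump !leq0n ij.
exists q''; split=> //; first by rewrite e0 (q'0 tt).
by rewrite e1 q'1; congr (q _ _); apply: val_inj.
Qed.

End Reduction.

(** The chain passes through every arc once, so the manifold is a single interval or circle. This
    recognises the zigzag as an identity and computes the shape of the closed-up cup. *)
Lemma chain_merge_seq (R : realType) (M : omanifold R) (J : finType)
    (q : J -> R -> M) (x : J) (s : seq J) :
  decomp q -> (size s).+1 = #|J| -> (forall y, y \in x :: s) ->
  path (fun y z => q y 1 == q z 0) x s ->
  exists q' : unit -> R -> M,
    [/\ decomp q', q' tt 0 = q x 0 & q' tt 1 = q (last x s) 1].
Proof.
move=> dq sJ sa px.
pose h (i : 'I_(size s).+1) := nth x (x :: s) i.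
have bh : bijective h.
  apply: surj_card_bij => [|y]; first by rewrite card_ord.
  have ys : (index y (x :: s) < (size s).+1)%N by rewrite -[(size s).+1]/(size (x :: s)) index_mem.
  by exists (Ordinal ys); rewrite /h /= nth_index.
have [||q' [dq' e0 e1]] := @chain_merge _ _ _ (fun i => q (h i)).
- exact: decomp_reindex.
- move=> i j ij; have : (i < size s)%N by rewrite -ltnS -ij.
  by move=> /(pathP x px)/eqP; rewrite /h ij.
by exists q'; split=> //; rewrite e1 /h /= -nth_last; case: (s).
Qed.

Section NormalForm.
Variables (R : realType) (a b : word).

(** The boundary points of sign +; they index the interval components, each of which starts at
    exactly one of them. *)
Definition source : finType := {x : bd a b | bsign x}.

(** In a reduced decomposition an arc that is not closed is continued by no arc at either end, so it
    runs from a boundary point of sign + to one of sign -. The intervals are indexed by their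
    starts, and [mu] records their other ends. *)
Lemma normal_form_exists (K : cob R a b) :
  exists (c : nat) (q : source + 'I_c -> R -> K) (mu : source -> bd a b),
    [/\ decomp q, forall s, q (inl s) 0 = bpt K (val s),
        forall s, q (inl s) 1 = bpt K (mu s) & forall i, q (inr i) 1 = q (inr i) 0].
Proof.
have [J0 [q0 dq0]] := decomposition K.
have [J [q [dq rq _ _]]] := reduction dq0.
have loopP j : q j 1 = q j 0 \/ (boundary_sign true (q j 0) /\ boundary_sign false (q j 1)).
  have [|nl] := pselect (q j 1 = q j 0); [by left|right; split].
    apply/(boundary_signP dq true) => i e; have ij := rq _ _ e.
    by apply: nl; rewrite -{1}ij.
  apply/(boundary_signP dq false) => i /esym e; have ij := rq _ _ e.
  by apply: nl; rewrite {2}ij.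
pose loop : {set J} := finset (fun j => q j 1 == q j 0).
have /choice[arc arcP] : forall s : source, exists j, bpt K (val s) = q j 0.
  move=> [x xs]; have sx := bpt_sign K x; rewrite xs in sx.
  by have [j e] := boundary_sign_arc dq sx; exists j.
have arcS s : boundary_sign true (q (arc s) 0).
  by rewrite -arcP -(valP s); exact: bpt_sign.
have arcT s : boundary_sign false (q (arc s) 1).
  have [e|[]//] := loopP (arc s).
  by have /(boundary_signP dq true)/(_ _ e) := arcS s.
have /choice[mu muP] : forall s : source, exists x, q (arc s) 1 = bpt K x.
  by move=> s; exact: bpt_cover (arcT s).
pose h (x : source + 'I_#|loop|) : J :=
  match x with inl s => arc s | inr i => enum_val i end.
have loop_arc s j : arc s = j -> j \in loop -> False.
  move=> <-; rewrite inE => /eqP e.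
  by have /(boundary_signP dq true)/(_ _ e) := arcS s.
have bh : bijective h.
  apply: inj_surj_bij => [[s|i] [s'|i'] /= e|j].
  - congr inl; apply: val_inj; apply: (@bpt_inj _ _ _ K).
    by rewrite !arcP e.
  - by case: (loop_arc _ _ e (enum_valP i')).
  - by case: (loop_arc _ _ (esym e) (enum_valP i)).
  - by rewrite (enum_val_inj e).
  - have [e|[sj _]] := loopP j.
      have jl : j \in loop by rewrite inE; apply/eqP.
      by exists (inr (enum_rank_in jl j)); rewrite /= enum_rankK_in.
    have [x e] := bpt_cover sj.
    have xs : bsign x.
      by rewrite (boundary_sign_uniq dq (bpt_sign K x) (s' := true)) // -e.
    exists (inl (exist _ x xs)); apply: (arc_start_inj dq).
    by rewrite /= -arcP -e.
exists #|loop|, (fun x => q (h x)), mu; split=> //=.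
- exact: decomp_reindex.
- by move=> s; rewrite arcP.
- by move=> i; apply/eqP; have := enum_valP i; rewrite inE.
Qed.

Lemma cob_equiv_normal (K L : cob R a b) (c : nat) (mu : source -> bd a b)
    (qK : source + 'I_c -> R -> K) (qL : source + 'I_c -> R -> L) :
  decomp qK -> decomp qL ->
  (forall s, qK (inl s) 0 = bpt K (val s)) -> (forall s, qL (inl s) 0 = bpt L (val s)) ->
  (forall s, qK (inl s) 1 = bpt K (mu s)) -> (forall s, qL (inl s) 1 = bpt L (mu s)) ->
  (forall i, qK (inr i) 1 = qK (inr i) 0) -> (forall i, qL (inr i) 1 = qL (inr i) 0) ->
  cob_equiv K L.
Proof.
move=> dK dL sK sL tK tL lK lL.
have glue (N : cob R a b) (q : source + 'I_c -> R -> N) : decomp q ->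
    (forall s, q (inl s) 0 = bpt N (val s)) -> (forall s, q (inl s) 1 = bpt N (mu s)) ->
    (forall i, q (inr i) 1 = q (inr i) 0) ->
    forall x y, q x 1 = q y 0 <-> exists i, x = inr i /\ y = inr i.
  move=> dN sN tN lN x y; split=> [|[i [-> ->]]//]; case: x => [s|i] e.
    have := bpt_sign N (mu s); rewrite -tN.
    move=> /(boundary_arc dN) h; have : bsign (mu s) = false.
      by apply: (@end_of_inj R); rewrite -h //; lra.
    move=> ms; have := bpt_sign N (mu s); rewrite -tN ms.
    by move=> /(boundary_signP dN false)/(_ y) n; case: n; exact: esym e.
  by exists i; split=> //; move: e; rewrite lN => /(arc_start_inj dN).
apply: (cob_equiv_decomp dK dL).
  by move=> x y; rewrite (glue K qK) // (glue L qL).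
move=> x [s|i].
  case e: (bsign x); rewrite /end_of.
    by rewrite sK => /bpt_inj->.
  by rewrite tK => /bpt_inj->.
move=> ex; have := bpt_sign K x; rewrite ex => /(boundary_signP dK)/(_ (inr i)).
by case: (bsign x); rewrite /= lK.
Qed.

End NormalForm.

(** * Duality and the value of the circle *)

Section TensorAlgebra.
Variable k : fieldType.
Implicit Types U V W : vectType k.

Lemma pure_basis V W i j :
  pure (vbasis {:V})`_(nat_of_ord i) (vbasis {:W})`_(nat_of_ord j) = delta_mx i j :> tens V W.
Proof.
have fV := basis_free (vbasisP {:V}); have fW := basis_free (vbasisP {:W}).
apply/matrixP => i' j'; rewrite !mxE !coord_free // -natrM.
by rewrite mulnb ![_ == i']eq_sym ![_ == j']eq_sym.
Qed.

Lemma tens_sum_pure V W (A : tens V W) :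
  A = \sum_j pure (\sum_i A i j *: (vbasis {:V})`_(nat_of_ord i)) (vbasis {:W})`_(nat_of_ord j).
Proof.
rewrite {1}[A]matrix_sum_delta exchange_big; apply: eq_bigr => j _.
apply/matrixP => i' j'; rewrite summxE !mxE linear_sum mulr_suml.
apply: eq_bigr => i _; rewrite linearZ /= -pure_basis !mxE; exact: mulrA.
Qed.

Lemma tens_ext U V W (f g : 'Hom(tens V W, U)) :
  (forall v w, f (pure v w) = g (pure v w)) -> f = g.
Proof.
move=> fg; apply/lfunP => A; rewrite [A]tens_sum_pure !linear_sum.
by apply: eq_bigr => j _; exact: fg.
Qed.

Lemma pure_sumr V W (I : finType) (v : V) (w : I -> W) :
  pure v (\sum_i w i) = \sum_i pure v (w i).
Proof.
apply/matrixP => i j; rewrite summxE mxE linear_sum mulr_sumr.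
by apply: eq_bigr => l _; rewrite mxE.
Qed.

Lemma pureZl V W (x : k) (v : V) (w : W) : pure (x *: v) w = x *: pure v w.
Proof. by apply/matrixP => i j; rewrite !mxE linearZ mulrA. Qed.

Lemma pureZr V W (x : k) (v : V) (w : W) : pure v (x *: w) = x *: pure v w.
Proof. by apply/matrixP => i j; rewrite !mxE linearZ mulrCA. Qed.

Lemma eq_hom_id (F : word -> vectType k) (a : word) (e : a = a) : eq_hom F e = \1%VF.
Proof. by rewrite (eq_irrelevance e erefl). Qed.

End TensorAlgebra.

Section ClosedValues.
Variables (R : realType) (k : fieldType) (F : tqft R k).
Local Notation V := (obj F [:: true]).
Local Notation W := (obj F [:: false]).

Lemma lfun_eq (U U' : vectType k) (f g : 'Hom(U, U')) x : f = g -> f x = g x.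
Proof. by move->. Qed.

Lemma F0_neq0 : tqft_F0 F (1 : k^o) != 0.
Proof.
have [G GF FG] := F0_iso F; apply/eqP => h.
have := lfun_eq (1 : k^o) GF; rewrite comp_lfunE h linear0 id_lfunE => /eqP.
by rewrite eq_sym oner_eq0.
Qed.

Lemma F0_scale (x : k) : tqft_F0 F (x : k^o) = x *: tqft_F0 F (1 : k^o).
Proof. by rewrite -linearZ /= /GRing.scale /= mulr1. Qed.

Lemma F0_surj (v : obj F [::]) : exists x : k, v = x *: tqft_F0 F (1 : k^o).
Proof.
have [G GF FG] := F0_iso F; exists (G v); rewrite -F0_scale.
by have := lfun_eq v FG; rewrite comp_lfunE id_lfunE.
Qed.

(** Through [tqft_F0] the space of the empty word is a line, so one value determines an
    endomorphism. *)
Lemma closed_scalar (f : 'Hom(obj F [::], obj F [::])) (x : k) :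
  f (tqft_F0 F (1 : k^o)) = x *: tqft_F0 F (1 : k^o) -> f = x *: \1%VF.
Proof.
move=> fx; apply/lfunP => v; have [y ->] := F0_surj v.
by rewrite linearZ /= fx scale_lfunE id_lfunE !scalerA mulrC.
Qed.

Lemma closed_scalar_inj (x y : k) :
  x *: \1%VF = y *: \1%VF :> 'Hom(obj F [::], obj F [::]) -> x = y.
Proof.
move=> /(lfun_eq (tqft_F0 F (1 : k^o))); rewrite !scale_lfunE id_lfunE.
move=> /eqP; rewrite -subr_eq0 -scalerBl scaler_eq0 (negbTE F0_neq0) orbF subr_eq0.
by move/eqP.
Qed.

(** Disjoint union multiplies the values of closed cobordisms. The statement is well typed because
    [[::] ++ [::]] is convertible to [[::]]. *)
Lemma hom_tensor_closed (K L : cob R [::] [::]) (N : cob R ([::] ++ [::]) ([::] ++ [::])) x y :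
  is_tensor K L N -> Defs.hom F K = x *: \1%VF -> Defs.hom F L = y *: \1%VF ->
  Defs.hom F N = (x * y) *: \1%VF :> 'Hom(obj F [::], obj F [::]).
Proof.
move=> /(F2_natural F) e Kx Ly; have [G GF FG] := F2_iso F [::] [::].
have : Defs.hom F N = (Defs.hom F N \o tqft_F2 F [::] [::] \o G)%VF.
  by rewrite -comp_lfunA FG comp_lfun1r.
rewrite e Kx Ly => ->; apply/lfunP => v; rewrite !comp_lfunE scale_lfunE id_lfunE.
have -> : tmap (x *: \1%VF : 'Hom(obj F [::], obj F [::])) (y *: \1%VF : 'Hom(obj F [::], obj F [::])) =
    (x * y) *: \1%VF.
  apply: tens_ext => u w; rewrite tmapE !scale_lfunE !id_lfunE pureZl pureZr.
  by rewrite scalerA.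
rewrite scale_lfunE id_lfunE linearZ /=; congr (_ *: _).
by have := lfun_eq v FG; rewrite comp_lfunE id_lfunE.
Qed.

(** The zigzag identity forces the pairing [Q] and the copairing [P] to be
    dual, so that the value of the circle is the trace of the identity. *)
Lemma duality_trace (P : cob R [::] [:: false; true]) (Q : cob R [:: true; false] [::])
    (I Z : cob R [:: true] [:: true]) (T : cob R [:: false; true] [:: true; false])
    (A : cob R [:: true] [:: true; false; true])
    (B : cob R [:: true; false; true] [:: true]) :
  is_id I -> is_id Z ->
  @Defs.is_tensor R [:: true] [::] [:: true] [:: false; true] I P A ->
  @Defs.is_tensor R [:: true; false] [:: true] [::] [:: true] Q I B ->
  is_comp A B Z -> @Defs.is_sym R [:: false] [:: true] T ->
  (Defs.hom F Q \o (Defs.hom F T \o Defs.hom F P))%VF = (\dim {:V})%:R *: \1%VF.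
Proof.
move=> /(hom_id F) hI /(hom_id F) hZ /(F2_natural F) hA /(F2_natural F) hB.
move=> /(hom_comp F) hAB /(F2_sym F) hT.
have [G0 G0F F0G] := F0_iso F.
have [G GF FG] := F2_iso F [:: false] [:: true].
set u0 := tqft_F0 F (1 : k^o).
(* The copairing as a tensor; expanded along the basis [v_] of [V] it is the sum of the tensors of
   [om j] with [v_ j]. *)
pose S : tens W V := G (Defs.hom F P u0).
pose om (j : 'I_(\dim {:V})) : W := \sum_i S i j *: (vbasis {:W})`_(nat_of_ord i).
pose v_ (j : 'I_(\dim {:V})) : V := (vbasis {:V})`_(nat_of_ord j).
have PE : Defs.hom F P u0 = tqft_F2 F [:: false] [:: true] (\sum_j pure (om j) (v_ j)).
  rewrite -[X in tqft_F2 F _ _ X](tens_sum_pure S).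
  by have := lfun_eq (Defs.hom F P u0) FG; rewrite comp_lfunE id_lfunE => ->.
pose ev (v : V) (w : W) : k := G0 (Defs.hom F Q (tqft_F2 F [:: true] [:: false] (pure v w))).
have evE v w : Defs.hom F Q (tqft_F2 F [:: true] [:: false] (pure v w)) = tqft_F0 F (ev v w).
  by have := lfun_eq (Defs.hom F Q (tqft_F2 F [:: true] [:: false] (pure v w))) F0G;
    rewrite comp_lfunE id_lfunE => ->.
(* The zigzag composite acts as the identity. Evaluated at [v], it inserts the copairing to the
   right of [v] and then pairs [v] with the first factor. *)
have zig v : v = \sum_j ev v (om j) *: v_ j.
  have v1 : tqft_F2 F [:: true] [::] (pure v u0) = v.
    have := lfun_eq (pure v (1 : k^o)) (F2_unitr F [:: true]).
    rewrite !comp_lfunE tmapE id_lfunE tunitrE scale1r.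
    by rewrite (@eq_hom_id k (obj F) [:: true]) id_lfunE.
  transitivity (Defs.hom F Z v); first by rewrite hZ id_lfunE.
  rewrite hAB comp_lfunE -{1}v1.
  have := lfun_eq (pure v u0) hA; rewrite !comp_lfunE => ->.
  rewrite tmapE hI id_lfunE PE [tqft_F2 F [:: false] _ _]linear_sum pure_sumr !linear_sum.
  apply: eq_bigr => j _.
  have E : tqft_F2 F [:: true] [:: false; true]
        (pure v (tqft_F2 F [:: false] [:: true] (pure (om j) (v_ j)))) =
      tqft_F2 F [:: true; false] [:: true]
        (pure (tqft_F2 F [:: true] [:: false] (pure v (om j))) (v_ j)).
    have := lfun_eq (pure v (pure (om j) (v_ j))) (F2_assoc F [:: true] [:: false] [:: true]).
    rewrite !comp_lfunE tassocE !tmapE !id_lfunE.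
    by rewrite (@eq_hom_id k (obj F) [:: true; false; true]) id_lfunE => ->.
  transitivity (Defs.hom F B (tqft_F2 F [:: true; false] [:: true]
      (pure (tqft_F2 F [:: true] [:: false] (pure v (om j))) (v_ j)))).
    exact: (congr1 (Defs.hom F B) E).
  have := lfun_eq (pure (tqft_F2 F [:: true] [:: false] (pure v (om j))) (v_ j)) hB.
  rewrite !comp_lfunE => ->; rewrite tmapE hI id_lfunE evE.
  have := lfun_eq (pure (ev v (om j) : k^o) (v_ j)) (F2_unitl F [:: true]).
  by rewrite comp_lfunE tmapE id_lfunE tunitlE.
(* This is coordinate [j] of the zigzag identity at [v_ j]. The value of the circle is the sum of
   these numbers, one for each basis vector. *)
have ev1 j : ev (v_ j) (om j) = 1.
  have fV := basis_free (vbasisP {:V}).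
  have := congr1 (coord (vbasis {:V}) j) (zig (v_ j)).
  by rewrite coord_sum_free // coord_free // eqxx => <-.
apply: closed_scalar; rewrite !comp_lfunE -/u0 PE.
have := lfun_eq (\sum_j pure (om j) (v_ j)) hT; rewrite !comp_lfunE => ->.
rewrite !linear_sum (eq_bigr (fun=> u0)) => [|j _].
  by rewrite sumr_const card_ord scaler_nat.
have := evE (v_ j) (om j); rewrite ev1 -(tswapE (om j) (v_ j)); exact.
Qed.

End ClosedValues.

(** * Elementary cobordisms *)

Section Fold.
Variable a : word.

(** The point [j] of [a ++ map negb a] is one of the two copies of the point [i] of [a]. *)
Definition fold_ord (j : 'I_(size (a ++ map negb a))) (i : 'I_(size a)) : Prop :=
  (j = i :> nat /\ letter j = letter i) \/
  (j = (size a + i)%N :> nat /\ letter j = ~~ letter i).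

Lemma fold_ord_ex j : exists i, fold_ord j i.
Proof.
have [[i ji li]|[i ji li]] := cat_ord_cases j; first by exists i; left.
exists (cast_ord (size_map negb a) i); right; split=> //.
by rewrite -li !letterE (nth_map false) // -[X in (_ < X)%N](size_map negb).
Qed.

Lemma fold_ord_surj i s : exists2 j, fold_ord j i & letter j = s.
Proof.
have [<-|si] := eqVneq (letter i) s.
  have [j ji] := cat_ordl (map negb a) i; exists j.
    by left; split=> //; rewrite !letterE ji nth_cat ltn_ord.
  by rewrite !letterE ji nth_cat ltn_ord.
have [j ji] := cat_ordr a (cast_ord (esym (size_map negb a)) i).
have lj : letter j = ~~ letter i.
  by rewrite !letterE ji nth_cat /= ltnNge leq_addr addKn (nth_map false).
by exists j; [right|rewrite lj; case: (letter i) (s) si => -[]].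
Qed.

Lemma fold_ord_inj j j' i : fold_ord j i -> fold_ord j' i -> letter j = letter j' -> j = j'.
Proof.
move=> [[e l]|[e l]] [[e' l']|[e' l']]; rewrite l l'.
- by move=> _; apply: val_inj; rewrite /= e e'.
- by case: (letter i).
- by case: (letter i).
- by move=> _; apply: val_inj; rewrite /= e e'.
Qed.

Lemma fold_ordl (j : 'I_(size (a ++ map negb a))) (i i' : 'I_(size a)) :
  fold_ord j i' -> j = i :> nat -> i' = i /\ letter j = letter i.
Proof.
move=> [[e l]|[e l]] ji; last by have := ltn_ord i; rewrite -ji e ltnNge leq_addr.
have ii : i' = i by apply: val_inj; rewrite /= -e ji.
by rewrite -ii.
Qed.

Lemma fold_ordr (j : 'I_(size (a ++ map negb a))) (i i' : 'I_(size a)) :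
  fold_ord j i' -> j = (size a + i)%N :> nat ->
  i' = i /\ letter j = ~~ letter i.
Proof.
move=> [[e l]|[e l]] ji; first by have := ltn_ord i'; rewrite -e ji ltnNge leq_addr.
have ii : i' = i by apply: val_inj; apply/eqP; rewrite -(eqn_add2l (size a)) /= -e ji.
by rewrite -ii.
Qed.

Lemma fold_ord_fun (j : 'I_(size (a ++ map negb a))) (i i' : 'I_(size a)) :
  fold_ord j i -> fold_ord j i' -> i' = i.
Proof.
by move=> [[e _]|[e _]] ji'; [have [] := fold_ordl ji' e|have [] := fold_ordr ji' e].
Qed.

End Fold.

Section ElementaryCobs.
Variable R : realType.

(** The dual of [a] negates the letters and keeps their order, interval [i] joining the points [i]
    and [size a + i]. This is the order in which the mirror image of a cobordism presents its
    boundary. *)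
Lemma cup_exists (a : word) :
  exists (P : cob R [::] (a ++ map negb a)) (q : 'I_(size a) -> R -> P), decomp q /\
    forall (i : 'I_(size a)) (j : 'I_(size (a ++ map negb a))),
      (j = i :> nat -> out P j = q i (end_of R (~~ letter i))) /\
      (j = (size a + i)%N :> nat -> out P j = q i (end_of R (letter i))).
Proof.
pose spec (x : bd [::] (a ++ map negb a)) (i : 'I_(size a)) : Prop :=
  match x with inl _ => False | inr j => fold_ord j i end.
have /choice[arc arcP] : forall x, exists i, spec x i.
  by move=> [[]|j] //; exact: fold_ord_ex.
have [||P [q [dq bq _]]] := @arcs_cob_exists R _ _ _ arc.
- move=> [[]|j] [[]|j'] // [e s]; congr inr; apply: (fold_ord_inj (arcP (inr j))).
    by rewrite e; exact: (arcP (inr j')).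
  exact: negb_inj.
- move=> i s; have [j ji js] := fold_ord_surj i (~~ s); exists (inr j).
  split; last by rewrite /= js negbK.
  exact: (fold_ord_fun ji (arcP (inr j))).
exists P, q; split=> // i j; split=> ji.
  by have [e l] := fold_ordl (arcP (inr j)) ji; transitivity (bpt P (inr j)) => //; rewrite bq /= e l.
by have [e l] := fold_ordr (arcP (inr j)) ji; transitivity (bpt P (inr j)) => //; rewrite bq /= e l negbK.
Qed.

Lemma cap_exists (a : word) :
  exists (Q : cob R (a ++ map negb a) [::]) (q : 'I_(size a) -> R -> Q), decomp q /\
    forall (i : 'I_(size a)) (j : 'I_(size (a ++ map negb a))),
      (j = i :> nat -> inp Q j = q i (end_of R (letter i))) /\
      (j = (size a + i)%N :> nat -> inp Q j = q i (end_of R (~~ letter i))).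
Proof.
pose spec (x : bd (a ++ map negb a) [::]) (i : 'I_(size a)) : Prop :=
  match x with inr _ => False | inl j => fold_ord j i end.
have /choice[arc arcP] : forall x, exists i, spec x i.
  by move=> [j|[]] //; exact: fold_ord_ex.
have [||Q [q [dq bq _]]] := @arcs_cob_exists R _ _ _ arc.
- move=> [j|[]] [j'|[]] // [e s]; congr inl; apply: (fold_ord_inj (arcP (inl j))) => //.
  by rewrite e; exact: (arcP (inl j')).
- move=> i s; have [j ji js] := fold_ord_surj i s; exists (inl j); split=> //.
  exact: (fold_ord_fun ji (arcP (inl j))).
exists Q, q; split=> // i j; split=> ji.
  by have [e l] := fold_ordl (arcP (inl j)) ji; transitivity (bpt Q (inl j)) => //; rewrite bq /= e l.
by have [e l] := fold_ordr (arcP (inl j)) ji; transitivity (bpt Q (inl j)) => //; rewrite bq /= e l.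
Qed.

Lemma id_exists (a : word) :
  exists (N : cob R a a) (q : 'I_(size a) -> R -> N), [/\ decomp q,
    forall i, inp N i = q i (end_of R (letter i)),
    forall i, out N i = q i (end_of R (~~ letter i)) & is_id N].
Proof.
pose arc (x : bd a a) : 'I_(size a) := match x with inl i => i | inr i => i end.
have [||N [q [dq bq n]]] := @arcs_cob_exists R a a _ arc.
- move=> [i|i] [j|j] /= [->] //; first by case: (letter j).
  by case: (letter j).
- move=> i s; have [<-|si] := eqVneq (letter i) s; first by exists (inl i).
  by exists (inr i); split=> //=; case: (letter i) (s) si => -[].
exists N, q; split=> //.
- by move=> i; exact: (bq (inl i)).
- by move=> i; exact: (bq (inr i)).
- apply: (arcs_strands dq n) => [i|i j ij]; first exact: (bq (inl i)).
  by have -> : i = j by [apply: val_inj]; exact: (bq (inr j)).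
Qed.

Lemma swap_exists :
  exists (T : cob R [:: false; true] [:: true; false]) (q : 'I_2 -> R -> T),
    [/\ decomp q, @Defs.is_sym R [:: false] [:: true] T,
      (inp T (@Ordinal 2 0 isT) = q (@Ordinal 2 0 isT) 1 /\
       inp T (@Ordinal 2 1 isT) = q (@Ordinal 2 1 isT) 0) &
      (out T (@Ordinal 2 0 isT) = q (@Ordinal 2 1 isT) 1 /\
       out T (@Ordinal 2 1 isT) = q (@Ordinal 2 0 isT) 0)].
Proof.
pose arc (x : bd [:: false; true] [:: true; false]) : 'I_2 :=
  match x with inl i => i | inr j => rev_ord j end.
have l0 : letter (a := [:: false; true]) (@Ordinal 2 0 isT) = false by rewrite letterE.
have l1 : letter (a := [:: false; true]) (@Ordinal 2 1 isT) = true by rewrite letterE.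
have m0 : letter (a := [:: true; false]) (@Ordinal 2 0 isT) = true by rewrite letterE.
have m1 : letter (a := [:: true; false]) (@Ordinal 2 1 isT) = false by rewrite letterE.
have o2 (i : 'I_2) : i = @Ordinal 2 0 isT \/ i = @Ordinal 2 1 isT.
  by case: i => [[|[|//]] p]; [left|right]; apply: val_inj.
have r0 : rev_ord (@Ordinal 2 0 isT) = @Ordinal 2 1 isT by apply: val_inj.
have r1 : rev_ord (@Ordinal 2 1 isT) = @Ordinal 2 0 isT by apply: val_inj.
have [||T [q [dq bq n]]] := @arcs_cob_exists R _ _ _ arc.
- by move=> [i|i] [j|j] /=; case: (o2 i) => ->; case: (o2 j) => ->;
    rewrite ?r0 ?r1 ?l0 ?l1 ?m0 ?m1.
- move=> j []; case: (o2 j) => ->.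
  + by exists (inr (@Ordinal 2 1 isT)); split; [exact: r1|exact: (congr1 negb m1)].
  + by exists (inl (@Ordinal 2 1 isT)).
  + by exists (inl (@Ordinal 2 0 isT)).
  + by exists (inr (@Ordinal 2 0 isT)); split; [exact: r0|exact: (congr1 negb m0)].
pose qs s i := q i (end_of R s).
exists T, q; split=> //.
- apply: (@arcs_strands R [:: false; true] [:: true; false] _ T q dq n).
    by move=> i; exact: (bq (inl i)).
  move=> i j ij; transitivity (bpt T (inr j)) => //; rewrite bq.
  case: (o2 i) ij => ->; case: (o2 j) => -> //= _.
    exact: (congr2 (fun s i => qs (~~ s) i) (etrans m1 (esym l0)) r1).
  exact: (congr2 (fun s i => qs (~~ s) i) (etrans m0 (esym l1)) r0).
- split; [exact: (etrans (bq (inl _)) (congr1 (fun s => qs s _) l0))|].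
  exact: (etrans (bq (inl _)) (congr1 (fun s => qs s _) l1)).
- split; [exact: (etrans (bq (inr _)) (congr2 (fun s i => qs (~~ s) i) m0 r0))|].
  exact: (etrans (bq (inr _)) (congr2 (fun s i => qs (~~ s) i) m1 r1)).
Qed.

End ElementaryCobs.

(** * The zigzag and the circle *)

Section Circle.
Variables (R : realType) (k : fieldType) (F : tqft R k).

Local Notation o i n := (@Ordinal n i isT).

Lemma circle_exists : exists (C : cob R [::] [::]) (q : unit -> R -> C),
  [/\ decomp q, q tt 1 = q tt 0 &
      Defs.hom F C = (\dim {: obj F [:: true]})%:R *: \1%VF].
Proof.
have h0 : 0 <= (0 : R) <= 1 by lra.
have h1 : 0 <= (1 : R) <= 1 by lra.
(* Built on the letter -, the cup has the boundary word -+, which lets it meet the cap on +- in the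
   zigzag through +-+; closing it directly by the cap then takes a swap. *)
have [P [qP [dP bP]]] := cup_exists R [:: false].
have [Q [qQ [dQ bQ]]] := cap_exists R [:: true].
have [I [qI [dI iI oI idI]]] := id_exists R [:: true].
have [T [qT [dT symT [iT0 iT1] [oT0 oT1]]]] := swap_exists R.
have lt : letter (a := [:: true]) (o 0 1) = true by rewrite letterE.
have lf : letter (a := [:: false]) (o 0 1) = false by rewrite letterE.
have oP0 : out P (o 0 2) = qP (o 0 1) 0 by rewrite (bP (o 0 1) _).1 // lf.
have oP1 : out P (o 1 2) = qP (o 0 1) 1 by rewrite (bP (o 0 1) _).2 // lf.
have iQ0 : inp Q (o 0 2) = qQ (o 0 1) 0 by rewrite (bQ (o 0 1) _).1 // lt.
have iQ1 : inp Q (o 1 2) = qQ (o 0 1) 1 by rewrite (bQ (o 0 1) _).2 // lt.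
have iI0 : inp I (o 0 1) = qI (o 0 1) 0 by rewrite iI lt.
have oI0 : out I (o 0 1) = qI (o 0 1) 1 by rewrite oI lt.
have ord1E (i : 'I_1) : i = o 0 1 by apply: val_inj; case: i => -[].
have [A [kA [lA [qA [tA [blA brA] dA kqA lqA]]]]] :=
  @tensor_exists R [:: true] [::] [:: true] [:: false; true] I P _ _ _ _ dI dP.
have [B [kB [lB [qB [tB [blB brB] dB kqB lqB]]]]] :=
  @tensor_exists R [:: true; false] [:: true] [::] [:: true] Q I _ _ _ _ dQ dI.
have [Z [kZ [lZ [qZ [aZ [iZ oZ] dZ kqZ lqZ]]]]] :=
  @comp_exists R [:: true] [:: true; false; true] [:: true] A B _ _ _ _ dA dB.
have gZ i : kZ (out A i) = lZ (inp B i) by apply/(amalgam_glue aZ); exists i.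
have iA0 : inp A (o 0 1) = kA (inp I (o 0 1)) := blA (inl (o 0 1)) (inl (o 0 1)) erefl.
have oA0 : out A (o 0 3) = kA (out I (o 0 1)) := blA (inr (o 0 3)) (inr (o 0 1)) erefl.
have oA1 : out A (o 1 3) = lA (out P (o 0 2)) := brA (inr (o 1 3)) (inr (o 0 2)) erefl.
have oA2 : out A (o 2 3) = lA (out P (o 1 2)) := brA (inr (o 2 3)) (inr (o 1 2)) erefl.
have iB0 : inp B (o 0 3) = kB (inp Q (o 0 2)) := blB (inl (o 0 3)) (inl (o 0 2)) erefl.
have iB1 : inp B (o 1 3) = kB (inp Q (o 1 2)) := blB (inl (o 1 3)) (inl (o 1 2)) erefl.
have iB2 : inp B (o 2 3) = lB (inp I (o 0 1)) := brB (inl (o 2 3)) (inl (o 0 1)) erefl.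
have oB0 : out B (o 0 1) = lB (out I (o 0 1)) := brB (inr (o 0 1)) (inr (o 0 1)) erefl.
(* The zigzag passes through the lower identity strand, the cap, the cup and the upper identity
   strand. *)
have [||||q' [dq' q'0 q'1]] := @chain_merge_seq R Z _ qZ (inl (inl (o 0 1)))
  [:: inr (inl (o 0 1)); inl (inr (o 0 1)); inr (inr (o 0 1))].
- exact: dZ.
- by rewrite !card_sum !card_ord.
- by move=> [[i|i]|[i|i]]; rewrite (ord1E i) !inE.
- rewrite /= !kqZ // !lqZ // !kqA // !lqA // !kqB // !lqB //.
  rewrite -oI0 -oA0 gZ iB0 iQ0 -iQ1 -iB1 -gZ oA1 oP0 -oP1 -oA2 gZ iB2 iI0.
  by rewrite !eqxx.
have q'i : q' tt 0 = inp Z (o 0 1) by rewrite q'0 kqZ // kqA // -iI0 -iA0 iZ.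
have q'o : q' tt 1 = out Z (o 0 1) by rewrite q'1 /= lqZ // lqB // -oI0 -oB0 oZ.
have idZ : is_id Z.
  apply: (@arcs_strands R [:: true] [:: true] _ Z (fun _ : 'I_1 => q' tt)).
  - apply: (@decomp_reindex _ _ _ _ q' (fun=> tt)) => //.
    by exists (fun=> o 0 1) => [i|[]] //; rewrite (ord1E i).
  - move=> _ _; have : boundary_sign true (q' tt 0).
      by rewrite q'i; have := inp_sign Z (o 0 1); rewrite lt.
    by move=> /(boundary_signP dq' true); exact.
  - by move=> i; rewrite (ord1E i) lt -q'i.
  - by move=> i j _; rewrite (ord1E j) (ord1E i) lt -q'o.
have [X [kX [lX [qX [aX [iX oX] dX kqX lqX]]]]] :=
  @comp_exists R [::] [:: false; true] [:: true; false] P T _ _ _ _ dP dT.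
have [C [kC [lC [qC [aC [iC oC] dC kqC lqC]]]]] :=
  @comp_exists R [::] [:: true; false] [::] X Q _ _ _ _ dX dQ.
have gX i : kX (out P i) = lX (inp T i) by apply/(amalgam_glue aX); exists i.
have gC i : kC (out X i) = lC (inp Q i) by apply/(amalgam_glue aC); exists i.
(* The circle passes through the cup, the positive strand of the swap, the cap and the negative
   strand. *)
have [||||p' [dp' p'0 p'1]] := @chain_merge_seq R C _ qC (inl (inl (o 0 1)))
  [:: inl (inr (o 1 2)); inr (o 0 1); inl (inr (o 0 2))].
- exact: dC.
- by rewrite !card_sum !card_ord.
- move=> [[i|[[|[|//]] p]]|i]; rewrite ?(ord1E i) !inE ?eqxx ?orbT //.
- rewrite /= !kqC // !lqC // !kqX // !lqX //.
  rewrite -oP1 gX iT1 -oT0 -oX gC iQ0 -iQ1 -gC oX oT1.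
  by rewrite !eqxx.
exists C, p'; split=> //.
  rewrite p'0 p'1 /= !kqC // !kqX // !lqX //.
  by rewrite -iT0 -gX oP0.
have cX : is_comp P T X by exists kX, lX; split.
have cC : is_comp X Q C by exists kC, lC; split.
have cZ : is_comp A B Z by exists kZ, lZ; split.
rewrite (hom_comp F cC) (hom_comp F cX).
exact: (duality_trace F idI idZ tA tB cZ symT).
Qed.

End Circle.

(** * Closed cobordisms and mirror images *)

Section ClosedCob.
Variables (R : realType) (k : fieldType) (F : tqft R k).
Local Notation d := ((\dim {: obj F [:: true]})%:R : k).

Lemma bd_nil_empty (x : bd [::] [::]) : False.
Proof. by case: x => -[]. Qed.

Lemma closed_reduced_loop (N : cob R [::] [::]) (J : finType) (q : J -> R -> N) :
  decomp q -> reduced q -> forall j, q j 1 = q j 0.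
Proof.
move=> dq rq j.
have /existsNP[i /contrapT e] : ~ forall i, q i (end_of R true) <> q j (end_of R false).
  move=> h; have /bpt_cover[/bd_nil_empty[]] : boundary_sign false (q j 1).
  exact/(boundary_signP dq false).
by rewrite [RHS](_ : _ = q i 0) //; rewrite (rq j i).
Qed.

Lemma loops_exist (n : nat) :
  exists (N : cob R [::] [::]) (q : 'I_n -> R -> N), decomp q /\ forall i, q i 1 = q i 0.
Proof.
have [||M [q [dq qn]]] := @decomp_exists R 'I_n (fun i j => i = j).
- by move=> i j j' -> ->.
- by move=> i i' j -> ->.
pose p (x : bd [::] [::]) : M := False_rect _ (bd_nil_empty x).
have p_inj : injective p by move=> x; case: (bd_nil_empty x).
have p_sign x : boundary_sign (bsign x) (p x) by case: (bd_nil_empty x).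
have p_cover s (z : M) : boundary_sign s z -> exists x, z = p x.
  move=> sz; have [j e] := boundary_sign_arc dq sz; move: sz; rewrite e.
  have loop : q j 1 = q j 0 by apply/qn.
  by move=> /(boundary_signP dq)/(_ j); case: s e; rewrite /= loop.
by exists (make_cob p_inj p_sign p_cover), q; split=> // i; apply/qn.
Qed.

Lemma closed_equiv (K L : cob R [::] [::]) (J : finType) (qK : J -> R -> K) (qL : J -> R -> L) :
  decomp qK -> decomp qL ->
  (forall j, qK j 1 = qK j 0) -> (forall j, qL j 1 = qL j 0) -> cob_equiv K L.
Proof.
move=> dK dL lK lL; apply: (cob_equiv_decomp dK dL) => [i j|x].
  by rewrite lK lL; split=> [/(arc_start_inj dK)->|/(arc_start_inj dL)->].
by case: (bd_nil_empty x).
Qed.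

(** Closed cobordisms with equally many circles are equivalent, so [N] may be replaced by a disjoint
    union of [n] circles with the circle of known value. Without circles, the empty cobordism is the
    identity of the empty word. *)
Lemma hom_loops (n : nat) (N : cob R [::] [::]) (q : 'I_n -> R -> N) :
  decomp q -> (forall i, q i 1 = q i 0) -> Defs.hom F N = d ^+ n *: \1%VF.
Proof.
elim: n N q => [|n IH] N q dq lq.
  rewrite expr0 scale1r; apply: hom_id.
  by apply: (@arcs_strands R [::] [::] id N q dq) => -[].
have [C [qC [dC lC hC]]] := circle_exists F.
have [L [qL [dL lL]]] := loops_exist n.
have [T [l [c [qT [tT _ dT lqT cqT]]]]] := @tensor_exists R [::] [::] [::] [::] L C _ _ _ _ dL dC.
have [|f bf] := @card_eq_bij ('I_n + unit)%type 'I_n.+1.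
  by rewrite card_sum !card_ord card_unit addn1.
have h0 : 0 <= (0 : R) <= 1 by lra.
have h1 : 0 <= (1 : R) <= 1 by lra.
have -> : Defs.hom F N = Defs.hom F (T : cob R [::] [::]).
  apply: hom_equiv; apply: (closed_equiv (decomp_reindex dq bf) dT) => [j|[j|[]]] //.
    by rewrite !lqT // lL.
  by rewrite !cqT // lC.
by rewrite exprSr; apply: hom_tensor_closed tT _ hC; exact: IH dL lL.
Qed.

(** Here [n] is the number of arcs left after reduction, all of them circles. The bound and its
    equality case hold for any given decomposition, so the circles need not be traced. *)
Lemma hom_closed (N : cob R [::] [::]) (J : finType) (q : J -> R -> N) : decomp q ->
  exists n, [/\ Defs.hom F N = d ^+ n *: \1%VF, (n <= #|J|)%N & n = #|J| <-> reduced q].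
Proof.
move=> dq.
have value (J' : finType) (q' : J' -> R -> N) : decomp q' -> reduced q' ->
    Defs.hom F N = d ^+ #|J'| *: \1%VF.
  move=> dq' rq'; apply: (@hom_loops _ N (fun i => q' (enum_val i))).
    by apply: decomp_reindex.
  by move=> i; exact: closed_reduced_loop.
have [rq|nrq] := pselect (reduced q); first by exists #|J|; split=> //; exact: value dq rq.
have [J' [q' [dq' rq' J'J eJ]]] := reduction dq.
exists #|J'|; split=> //; first exact: value dq' rq'.
Qed.

End ClosedCob.

(** * Mirror images and doubles *)

Section Reverse.
Variables (R : realType) (a b : word).

Definition bd_neg (x : bd a b) : bd (map negb a) (map negb b) :=
  match x with
  | inl i => inl (cast_ord (esym (size_map negb a)) i)
  | inr j => inr (cast_ord (esym (size_map negb b)) j)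
  end.

Definition bd_pos (x : bd (map negb a) (map negb b)) : bd a b :=
  match x with
  | inl i => inl (cast_ord (size_map negb a) i)
  | inr j => inr (cast_ord (size_map negb b) j)
  end.

Lemma bd_negK : cancel bd_neg bd_pos.
Proof. by case=> i /=; rewrite cast_ordKV. Qed.

Lemma bd_posK : cancel bd_pos bd_neg.
Proof. by case=> i /=; rewrite cast_ordK. Qed.

Lemma letter_neg (c : word) (i : 'I_(size (map negb c))) :
  letter i = ~~ letter (cast_ord (size_map negb c) i).
Proof. by rewrite !letterE (nth_map false) // -[X in (_ < X)%N](size_map negb). Qed.

Lemma bsign_pos x : bsign x = ~~ bsign (bd_pos x).
Proof. by case: x => i /=; rewrite letter_neg. Qed.

(** The mirror image keeps ingoing points ingoing and negates the letters. Its tensor product with a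
    cobordism from [a] to [b] is then closed off by one cup and one cap. *)
Lemma reverse_exists (L : cob R a b) (J : finType) (q : J -> R -> L) : decomp q ->
  exists (L' : cob R (map negb a) (map negb b)) (f : L -> L') (q' : J -> R -> L'),
    [/\ decomp q', forall j t, q' j t = f (q j (1 - t)) &
        forall x, bpt L' (bd_neg x) = f (bpt L x)].
Proof.
move=> dq; pose p x : oreverse L := bpt L (bd_pos x).
have p_inj : injective p by move=> x y /bpt_inj/(can_inj bd_posK).
have p_sign x : boundary_sign (bsign x) (p x).
  by apply/boundary_sign_oreverse; rewrite bsign_pos negbK; exact: bpt_sign.
have p_cover s (z : oreverse L) : boundary_sign s z -> exists x, z = p x.
  move=> /boundary_sign_oreverse/bpt_cover[x ->]; exists (bd_neg x).
  by rewrite /p bd_negK.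
exists (make_cob p_inj p_sign p_cover), (fun x => x), (fun j t => q j (1 - t)); split=> //.
  exact: decomp_oreverse.
by move=> x; rewrite bpt_make_cob /p bd_negK.
Qed.

End Reverse.

Section Double.
Variables (R : realType) (k : fieldType) (F : tqft R k) (a b : word).
Variables (L : cob R a b) (JL : finType) (qL : JL -> R -> L).
Hypothesis dL : decomp qL.

(** Gluing [K] to the mirror image of [L] along an arc for each boundary point. *)
Lemma double_exists : exists Phi : 'Hom(obj F a, obj F b) -> 'Hom(obj F [::], obj F [::]),
  forall (K : cob R a b) (JK : finType) (qK : JK -> R -> K), decomp qK ->
  exists (N : cob R [::] [::]) (f : K -> N) (g : L -> N)
      (q : bd a b + (JK + JL) -> R -> N),
    [/\ decomp q, Defs.hom F N = Phi (Defs.hom F K),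
      (forall j t, 0 <= t <= 1 -> q (inr (inl j)) t = f (qK j t)),
      (forall j t, 0 <= t <= 1 -> q (inr (inr j)) t = g (qL j (1 - t))) &
      forall x, q (inl x) (end_of R (~~ bsign x)) = f (bpt K x) /\
                q (inl x) (end_of R (bsign x)) = g (bpt L x)].
Proof.
have [P [qP [dP bP]]] := cup_exists R a.
have [Q [qQ [dQ bQ]]] := cap_exists R b.
have [L' [r [q' [dq' q'E bL']]]] := reverse_exists dL.
have [G GF FG] := F2_iso F a (map negb a).
(* This is the value of the composite of cup, [K] tensor mirror image and cap, rewritten by
   naturality of [tqft_F2] with inverse [G]; [K] enters only through [h]. *)
exists (fun h => Defs.hom F Q \o (tqft_F2 F b (map negb b) \o
  (tmap h (Defs.hom F L') \o (G \o Defs.hom F P))))%VF.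
move=> K JK qK dK.
have [Y [kY [lY [qY [tY [blY brY] dY kqY lqY]]]]] := tensor_exists dK dq'.
have [X [kX [lX [qX [aX [iX oX] dX kqX lqX]]]]] := comp_exists dP dY.
have [N [kN [lN [qN [aN [iN oN] dN kqN lqN]]]]] := comp_exists dX dQ.
have gX i : kX (out P i) = lX (inp Y i) by apply/(amalgam_glue aX); exists i.
have gN i : kN (out X i) = lN (inp Q i) by apply/(amalgam_glue aN); exists i.
(* The connecting arc at a boundary point is an interval of the cup if the point is ingoing and one
   of the cap if it is outgoing. *)
pose e (x : bd a b + (JK + JL)) : ('I_(size a) + (JK + JL)) + 'I_(size b) :=
  match x with
  | inl (inl i) => inl (inl i) | inl (inr j) => inr j | inr y => inl (inr y)
  end.
have be : bijective e.
  pose e' (x : ('I_(size a) + (JK + JL)) + 'I_(size b)) : bd a b + (JK + JL) :=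
    match x with
    | inl (inl i) => inl (inl i) | inr j => inl (inr j) | inl (inr y) => inr y
    end.
  by exists e'; [move=> [[]|]|move=> [[]|]].
exists N, (fun x => kN (lX (kY x))), (fun x => kN (lX (lY (r x)))), (fun x => qN (e x)).
split.
- exact: decomp_reindex.
- have cX : is_comp P Y X by exists kX, lX; split.
  have cN : is_comp X Q N by exists kN, lN; split.
  rewrite (hom_comp F cN) (hom_comp F cX); congr (_ \o _)%VF.
  rewrite !comp_lfunA -(F2_natural F tY) -(comp_lfunA _ _ G) FG.
  by rewrite comp_lfun1r.
- by move=> j t t01; rewrite /= kqN // lqX // kqY.
- by move=> j t t01; rewrite /= kqN // lqX // lqY // q'E.
- move=> [i|j] /=; split.
  + have [j ji] := cat_ordl (map negb a) i.
    have := blY (inl j) (inl i) ji => /= <-.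
    by rewrite -gX (bP i j).1 // kqN ?kqX // end_of_itv.
  + have [j ji] := cat_ordr a (cast_ord (esym (size_map negb a)) i).
    have := brY (inl j) (bd_neg (b := b) (inl i)) ji; rewrite bL' /= => <-.
    by rewrite -gX (bP i j).2 // kqN ?kqX // end_of_itv.
  + have [i ij] := cat_ordl (map negb b) j.
    have := blY (inr i) (inr j) ij => /= <-.
    by rewrite -oX gN (bQ j i).1 // lqN ?end_of_itv // negbK.
  + have [i ij] := cat_ordr b (cast_ord (esym (size_map negb b)) j).
    have := brY (inr i) (bd_neg (a := a) (inr j)) ij; rewrite bL' /= => <-.
    by rewrite -oX gN (bQ j i).2 // lqN ?end_of_itv.
Qed.

End Double.

Section DoubleNormal.
Variables (R : realType) (k : fieldType) (F : tqft R k) (a b : word).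
Local Notation S := (source a b).

Record normal_form_of (K : cob R a b) (c : nat) (q : S + 'I_c -> R -> K)
    (mu : S -> bd a b) : Prop := NormalForm {
  nf_decomp : decomp q;
  nf_source : forall s, q (inl s) 0 = bpt K (val s);
  nf_target : forall s, q (inl s) 1 = bpt K (mu s);
  nf_loop : forall i, q (inr i) 1 = q (inr i) 0
}.

Section Targets.
Variables (K : cob R a b) (c : nat) (q : S + 'I_c -> R -> K) (mu : S -> bd a b).
Hypothesis nf : normal_form_of q mu.

Lemma target_sign s : bsign (mu s) = false.
Proof.
have := bpt_sign K (mu s); rewrite -(nf_target nf).
move=> /(boundary_arc (nf_decomp nf)) h; apply: (@end_of_inj R).
by rewrite -h //; lra.
Qed.

Lemma target_inj : injective mu.
Proof.
move=> s s' e; suff [] : inl s = inl s' :> S + 'I_c by [].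
by apply: (arc_end_inj (nf_decomp nf)); rewrite !(nf_target nf) e.
Qed.

Lemma target_surj x : bsign x = false -> exists s, mu s = x.
Proof.
move=> xs; have := bpt_sign K x; rewrite xs => sx.
have [[s|i] e] := boundary_sign_arc (nf_decomp nf) sx.
  by exists s; apply: (@bpt_inj _ _ _ K); rewrite e -(nf_target nf).
move: sx; rewrite e => /(boundary_signP (nf_decomp nf))/(_ (inr i)).
by rewrite /end_of /= (nf_loop nf).
Qed.

End Targets.

Variables (L : cob R a b) (cL : nat) (qL : S + 'I_cL -> R -> L) (muL : S -> bd a b).
Hypothesis nL : normal_form_of qL muL.

(** An interval of the mirror image of [L] is followed by a connecting arc, an interval of [K],
    another connecting arc and again an interval of the mirror image. Once the first three are
    absorbed into the last, [c_K + s + c_L] arcs remain, and those through the former boundary are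
    all closed exactly when each returns to the interval of [L] it left. *)
Lemma double_normal : exists Phi : 'Hom(obj F a, obj F b) -> 'Hom(obj F [::], obj F [::]),
  forall (K : cob R a b) cK (qK : S + 'I_cK -> R -> K) (muK : S -> bd a b),
  normal_form_of qK muK ->
  exists (N : cob R [::] [::]) (q : 'I_cK + (S + 'I_cL) -> R -> N),
    [/\ decomp q, Defs.hom F N = Phi (Defs.hom F K) & reduced q <-> muK =1 muL].
Proof.
have h0 : 0 <= (0 : R) <= 1 by lra.
have h1 : 0 <= (1 : R) <= 1 by lra.
have [Phi PhiP] := double_exists F (nf_decomp nL); exists Phi.
move=> K cK qK muK nK.
have [N [f [g [q [dq hN fq gq bq]]]]] := PhiP K _ qK (nf_decomp nK).
(* [arc x] is the arc of [K] or of the mirror image of [L] that follows the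
   connecting arc at the boundary point [x] *)
have /choice[arc arcP] : forall x : bd a b, exists y : (S + 'I_cK) + (S + 'I_cL),
    (bsign x /\ exists2 s, x = val s & y = inl (inl s)) \/
    (bsign x = false /\ exists2 s, muL s = x & y = inr (inl s)).
  move=> x; case e: (bsign x).
    by exists (inl (inl (exist _ x e))); left; split=> //; exists (exist _ x e).
  by have [s sx] := target_surj nL e; exists (inr (inl s)); right; split=> //; exists s.
have arcE : forall x, q (inl x) 1 = q (inr (arc x)) 0.
  move=> x; have [bK bL] := bq x; move: bK bL.
  have [[-> [s xs ->]]|[-> [s xs ->]]] := arcP x; rewrite /end_of /= => bK bL.
    by rewrite bK fq // (nf_source nK) xs.
  by rewrite bL gq // subr0 (nf_target nL) xs.
(* First round: every connecting arc is absorbed by the interval that follows it. *)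
have [q1 [dq1 q1_1 q1_arc q1_n]] := decomp_merge dq arcE.
have arc_source s : arc (val s) = inl (inl s).
  have [[_ [s' /val_inj-> //]]|[e _]] := arcP (val s).
  by have := valP s; rewrite e.
have arc_target s : arc (muL s) = inr (inl s).
  have [[e _]|[_ [s' /(target_inj nL)-> //]]] := arcP (muL s).
  by move: e; rewrite (target_sign nL).
have arc_loopK i x : arc x <> inl (inr i).
  by have [[_ [s _ ->]]|[_ [s _ ->]]] := arcP x.
have arc_loopL i x : arc x <> inr (inr i).
  by have [[_ [s _ ->]]|[_ [s _ ->]]] := arcP x.
(* [nu] is muL^{-1} muK: the interval of [K] starting at [s] leads to the mirrored interval [nu s]
   of [L]. *)
have /choice[nu nuP] : forall s, exists s', muL s' = muK s.
  by move=> s; exact: (target_surj nL (target_sign nK s)).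
pose e (x : S + ('I_cK + (S + 'I_cL))) : (S + 'I_cK) + (S + 'I_cL) :=
  match x with
  | inl s => inl (inl s) | inr (inl i) => inl (inr i) | inr (inr y) => inr y
  end.
have be : bijective e.
  pose e' (x : (S + 'I_cK) + (S + 'I_cL)) : S + ('I_cK + (S + 'I_cL)) :=
    match x with
    | inl (inl s) => inl s | inl (inr i) => inr (inl i) | inr y => inr (inr y)
    end.
  by exists e'; [move=> [|[]]|move=> [[]|]].
have [||q2 [dq2 q2_1 q2_arc q2_n]] := @decomp_merge R N _ _ (fun x => q1 (e x)) (fun s => inr (inl (nu s))).
- exact: decomp_reindex.
- move=> s /=; rewrite q1_1 fq // (nf_target nK) -arc_target nuP q1_arc.
  by have [<- _] := bq (muK s); rewrite (target_sign nK).
exists N, q2; split=> //.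
(* After the second round, in which the intervals of [K] are absorbed, the arc [s] is followed by
   the arc [nu s]; being reduced therefore forces [nu] to be the identity. *)
have q2_0 s : q2 (inr (inl (nu s))) 0 = q2 (inr (inl s)) 1.
  rewrite q2_arc /= -arc_source q1_arc q2_1 /= q1_1 gq // subrr (nf_source nL).
  by have [_ <-] := bq (val s); rewrite (valP s).
split=> [rq s|mm].
  by have [es] := rq _ _ (esym (q2_0 s)); rewrite -(nuP s) -es.
suff loop y : q2 y 1 = q2 y 0 by move=> x y; rewrite loop => /(arc_start_inj dq2).
case: y => [i|[s|i]].
- by rewrite q2_1 q2_n //= q1_1 q1_n ?fq // ?(nf_loop nK).
- rewrite -q2_0; congr (q2 (inr (inl _)) _); apply: (target_inj nL).
  by rewrite nuP mm.
- by rewrite q2_1 q2_n //= q1_1 q1_n ?gq // ?subrr ?subr0 ?(nf_loop nL).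
Qed.

End DoubleNormal.

(** The characteristic and the dimension enter here: natural numbers embed into the field, and
    powers of a number greater than 1 are distinct. *)
Lemma natr_exp_inj (k : fieldType) (d m n : nat) : [pchar k]%R =i pred0 -> (1 < d)%N ->
  (d%:R : k) ^+ m = d%:R ^+ n -> m = n.
Proof.
move=> char0 d1; wlog mn : m n / (m <= n)%N.
  by move=> H e; case/orP: (leq_total m n) => ?; [exact: H|apply/esym/H].
rewrite -!natrX => /eqP; rewrite eq_sym -subr_eq0 -natrB ?leq_exp2l //.
rewrite ((pcharf0P k).1 char0) subn_eq0 leq_exp2l // => nm.
by apply/eqP; rewrite eqn_leq mn.
Qed.

Theorem theorem5p7 (R : realType) (k : fieldType)
    (char0 : [pchar k]%R =i pred0) (F : tqft R k)
    (dim_plus : (2 <= \dim (fullv : {vspace obj F [:: true]}))%N)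
    (dim_minus : (2 <= \dim (fullv : {vspace obj F [:: false]}))%N) :
  faithful F.
Proof.
move=> a b K L KL.
have loops_le (K1 K2 : cob R a b) c1 c2 (q1 : source a b + 'I_c1 -> R -> K1)
    (q2 : source a b + 'I_c2 -> R -> K2) mu1 mu2 :
    normal_form_of q1 mu1 -> normal_form_of q2 mu2 -> Defs.hom F K1 = Defs.hom F K2 ->
    (c2 <= c1)%N /\ (c1 = c2 -> mu1 =1 mu2).
  move=> n1 n2 e; have [Phi PhiP] := double_normal F n2.
  have [N [q [dq hN rN]]] := PhiP _ _ _ _ n1.
  have [N' [q' [dq' hN' rN']]] := PhiP _ _ _ _ n2.
  have [n [nE nle nr]] := hom_closed F dq.
  have [n' [n'E _ n'r]] := hom_closed F dq'.
  (* Doubled with itself, [K2] attains the bound. The double of [K1] has the same value, hence the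
     same exponent, and comparison with its own bound gives the inequality and the equality case. *)
  have n'J : n' = #|{: 'I_c2 + (source a b + 'I_c2)}| by apply/n'r/rN'.
  have nn' : n = n'.
    apply: (natr_exp_inj char0 dim_plus); apply: (@closed_scalar_inj R k F).
    by rewrite -nE -n'E hN hN' e.
  move: nle; rewrite nn' n'J !card_sum !card_ord leq_add2r => c21.
  split=> // c12; apply/rN/nr; rewrite nn' n'J !card_sum !card_ord c12//.
have [cK [qK [muK [dK sK tK lK]]]] := normal_form_exists K.
have [cL [qL [muL [dL sL tL lL]]]] := normal_form_exists L.
have nK : normal_form_of qK muK by split.
have nL : normal_form_of qL muL by split.
have [le1 mm] := loops_le _ _ _ _ _ _ _ _ nK nL KL.
have [le2 _] := loops_le _ _ _ _ _ _ _ _ nL nK (esym KL).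
have c : cK = cL by apply/eqP; rewrite eqn_leq le1 le2.
have {mm}mu : muL = muK by apply/funext => s; rewrite mm.
subst cK muL.
exact: (cob_equiv_normal dK dL sK sL tK tL lK lL).
Qed.
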